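(* Let $X_1,X_2,\ldots$ be independent random variables with common right-continuous distribution function $F$, with quantile function $Q$ and, where it exists, density $f=F'$, and write $fQ(s):=f(Q(s))$. Let $\alpha>0$, let $p>0$ be an integer, let $\theta_0,\ldots,\theta_p\in\mathbb R$, and suppose that $$\log Q(1-s)=-\alpha\log s+\theta_0+2\sum_{k=1}^{p}\theta_k\cos(2\pi ks),\qquad 0<s<1.$$ Let $0<a<b<1$ be fixed, let $\widetilde p>p$ be a fixed integer, and let $s_j=j/n$ for $j=\lceil na\rceil,\ldots,\lfloor nb\rfloor$. Assume, with $a^*=\sup\{x:F(x)=0\}$ and $b^*=\inf\{x:F(x)=1\}$, $-\infty\le a^*<b^*\le\infty$, that: (i) $F$ is continuous and twice differentiable on $(a^*,b^* )$, and $f(x)=F'(x)\neq 0$ on $(a^*,b^* )$; (ii) $\sup_{a^*<x<b^*}F(x)(1-F(x))\,|f'(x)/f^2(x)|<\infty$; (iii) $\sup_{1-b\le s\le 1-a}1/|Q(s)|<\infty$, $\sup_{1-b\le s\le 1-a}1/fQ(s)<\infty$ and $\sup_{1-b\le s\le 1-a}1/|fQ(s)Q(s)|<\infty$; (iv) the weight function $R$ is nonnegative and Riemann integrable on $[a,b]$; (v) the matrix $M(a,b,R)$ (defined in the context) is invertible. Let $\widehat\alpha_n^{(W)}$ be the weighted least squares estimator of $\alpha$ and $G_R$ the function, both defined in the context. Then, as $n\to\infty$, $$\sqrt n\,(\widehat\alpha_n^{(W)}-\alpha)\overset{D}{\longrightarrow}N(0,V),$$ where $$V=\int_a^b\int_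a^b\frac{G_R(s)G_R(t)\big((1-s)\wedge(1-t)-(1-s)(1-t)\big)}{Q(1-s)\,Q(1-t)\,fQ(1-s)\,fQ(1-t)}\,ds\,dt.$$
   Context: Quantile function: $Q(s):=\inf\{x:F(x)\ge s\}$ for $0<s\le 1$, and $Q(0):=Q(0+)$. For each $n$, $X_{1,n}\le\cdots\le X_{n,n}$ are the order statistics of $X_1,\ldots,X_n$. The empirical quantile function is $Q_n(s)=X_{k,n}$ if $\frac{k-1}{n}<s\le\frac kn$, $k=1,\ldots,n$. The symbol $\overset{D}{\longrightarrow}$ denotes convergence in distribution, $x\wedge y=\min(x,y)$, and a prime on a vector or matrix denotes transpose. Estimator: put $y_j:=\log Q_n(1-s_j)$ and $y:=(y_{\lceil na\rceil},\ldots,y_{\lfloor nb\rfloor})'$. The weights are $w_{j,n}=R(j/n)$, and $W:=\mathrm{diag}(w_{\lceil na\rceil,n},\ldots,w_{\lfloor nb\rfloor,n})$. The design matrix is $X:=[G^*,G_0,2G_1,\ldots,2G_{\widetilde p}]$, with columns built from $$G^*=\big(-\log s_{\lceil na\rceil},\ldots,-\log s_{\lfloor nb\rfloor}\big)',\qquad G_k=\big(\cos(2\pi ks_{\lceil na\rceil}),\ldots,\cos(2\pi ks_{\lfloor nb\rfloor})\big)',\quad k=0,\ldots,\widetilde p.$$ ($X$, $W$, $y$ depend on $n$.) With $e_1=(1,0,\ldots,0)'\in\mathbb R^{\widetilde p+2}$, the weighted least squares estimator of $\alpha$ is $$\widehat\alpha_n^{(W)}:=e_1'(X'WX)^{-1}X'Wy,$$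 where the inverse exists (under condition (v) this is so for all sufficiently large $n$). Limit matrix: $M(a,b,R):=\lim_{n\to\infty}n^{-1}X'WX$. This is the $(\widetilde p+2)\times(\widetilde p+2)$ matrix whose entries are $\int_a^b h_i(u)h_j(u)R(u)\,du$, $0\le i,j\le\widetilde p+1$, where $h_0(u)=-\log u$, $h_1(u)=1$, and $h_{k+1}(u)=2\cos(2\pi ku)$ for $1\le k\le\widetilde p$. Function $G_R$: let $(v^*,v_0,\ldots,v_{\widetilde p})$ be the first row of $M(a,b,R)^{-1}$, and set $$G_R(u):=R(u)\Big(-v^*\log u+v_0+2\sum_{k=1}^{\widetilde p}v_k\cos(2\pi ku)\Big).$$ *)

(* Defs.v *)
From HB Require Import structures.
From mathcomp Require Import all_boot all_order all_algebra.
From mathcomp Require Import finmap.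
From mathcomp Require Import all_classical all_reals all_analysis.

Set Implicit Arguments.
Unset Strict Implicit.
Unset Printing Implicit Defensive.

Import Order.TTheory GRing.Theory Num.Theory.
Import numFieldNormedType.Exports.

Local Open Scope classical_set_scope.
Local Open Scope ring_scope.

Definition mutually_independent (d : measure_display) (T : measurableType d)
    (R : realType) (P : probability T R) (X : nat -> {RV P >-> R}) : Prop :=
  forall (J : {fset nat}) (A : nat -> set R),
    (forall i, i \in J -> measurable (A i)) ->
    P (\bigcap_(i in [set` J]) (X i @^-1` A i)) =
    (\prod_(i <- J) P (X i @^-1` A i))%E.

(* The library's [normal_prob m s] takes the standard deviation and is not the
   point mass at [m] when [s = 0], hence the separate degenerate case. *)
Definition normal_law (R : realType) (m v : R) :
    probability (measurableTypeR R) R :=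
  if v == 0 then (\d_(m : measurableTypeR R) : probability _ _)
  else (normal_prob m (Num.sqrt v) : probability _ _).

Definition cvg_in_distribution (d : measure_display) (T : measurableType d)
    (R : realType) (P : probability T R) (Z : nat -> T -> R)
    (mu : probability (measurableTypeR R) R) : Prop :=
  (forall n, measurable_fun [set: T] (Z n)) /\
  forall x : R, {for x, continuous (fun y : R => mu `]-oo, y]%classic)} ->
    P [set w | Z n w <= x] @[n --> \oo] --> mu `]-oo, x]%classic.

(* Limit of tagged Riemann sums as the mesh tends to 0: [x] lists the nodes of
   a partition of [a, b] into [n] pieces, [t] the tags. A Riemann integrable
   function need not be Borel measurable, so the library's [Rintegral] is not
   used for these integrands. *)
Definition is_riemann_integral (R : realType) (f : R -> R) (a b l : R) : Prop :=
  forall e, 0 < e -> exists2 d, 0 < d &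
    forall (n : nat) (x t : nat -> R),
      x 0%N = a -> x n = b ->
      (forall i, (i < n)%N -> x i <= t i <= x i.+1 /\ x i.+1 - x i < d) ->
      `| \sum_(i < n) f (t i) * (x i.+1 - x i) - l | < e.

Definition riemann_integrable (R : realType) (f : R -> R) (a b : R) : Prop :=
  exists l, is_riemann_integral f a b l.

Definition riemann_integral (R : realType) (f : R -> R) (a b : R) : R :=
  xget 0 [set l | is_riemann_integral f a b l].

Section quantile.
Context {R : realType}.
Implicit Types (F : R -> R) (s : R) (x : nat -> R) (n k : nat).

(* a^* = sup {x : F x = 0} and b^* = inf {x : F x = 1}; in [\bar R] they are
   -oo, resp. +oo, when the set is empty. *)
Definition lower_endpoint F : \bar R := ereal_sup [set x%:E | x in [set x | F x = 0]].
Definition upper_endpoint F : \bar R := ereal_inf [set x%:E | x in [set x | F x = 1]].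

Definition open_support F : set R :=
  [set x | (lower_endpoint F < x%:E)%E /\ (x%:E < upper_endpoint F)%E].

(* Extended-real valued, since Q(0) or Q(1) may be infinite. *)
Definition quantile F s : \bar R :=
  let q r := ereal_inf [set x%:E | x in [set x | r <= F x]] in
  if s == 0 then lim (q r @[r --> 0^'+]) else q s.

(* f(Q(s)) with f = F', for 0 < s < 1, where Q(s) is finite. *)
Definition density_quantile F s : R := F^`()%classic (fine (quantile F s)).

(* X_{k,n}, for 1 <= k <= n, where X_1, X_2, ... is [x 0], [x 1], ... *)
Definition order_stat x n k : R := nth 0 (sort <=%R (mkseq x n)) k.-1.

Definition empirical_quantile x n s : R :=
  if [pick k : 'I_n | (k%:R / n%:R < s) && (s <= k.+1%:R / n%:R)] is Some k
  then order_stat x n k.+1 else 0.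

End quantile.

Section estimator.
Context {R : realType}.
(* Regression on s_j = j/n in [a, b] with weights [wt s_j]; [pt] is the number
   of cosine terms. *)
Variables (a b : R) (pt : nat) (wt : R -> R).

Definition regressor (j : nat) (u : R) : R :=
  match j with
  | 0%N => - ln u
  | 1%N => 1
  | k.+1 => 2 * cos (2 * pi * k%:R * u)
  end.

(* The observations used are j = ceil (n a), ..., floor (n b); row [i] of the
   regression corresponds to j = ceil (n a) + i. *)
Definition first_index (n : nat) : nat := `|Num.ceil (n%:R * a)|%N.
Definition last_index (n : nat) : nat := `|Num.floor (n%:R * b)|%N.
Definition nb_obs (n : nat) : nat := ((last_index n).+1 - first_index n)%N.

Definition node (n i : nat) : R := (first_index n + i)%:R / n%:R.

Definition design_mx (n : nat) : 'M[R]_(nb_obs n, pt.+2) :=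
  \matrix_(i, j) regressor j (node n i).

Definition weight_mx (n : nat) : 'M[R]_(nb_obs n) :=
  diag_mx (\row_i wt (node n i)).

Definition response (x : nat -> R) (n : nat) : 'cV[R]_(nb_obs n) :=
  \col_i ln (empirical_quantile x n (1 - node n i)).

Definition wls_estimator (x : nat -> R) (n : nat) : R :=
  let Xn := design_mx n in
  let Wn := weight_mx n in
  let e1 : 'cV[R]_pt.+2 := delta_mx ord0 ord0 in
  (e1^T *m invmx (Xn^T *m Wn *m Xn) *m Xn^T *m Wn *m response x n) ord0 ord0.

Definition limit_mx : 'M[R]_pt.+2 :=
  \matrix_(i, j)
    riemann_integral (fun u => regressor i u * regressor j u * wt u) a b.

Definition weight_kernel (u : R) : R :=
  wt u * \sum_(j < pt.+2) invmx limit_mx ord0 j * regressor j u.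

Definition asymptotic_variance (F : R -> R) : R :=
  let Q s := fine (quantile F s) in
  let fQ := density_quantile F in
  riemann_integral (fun s => riemann_integral (fun t =>
    weight_kernel s * weight_kernel t *
    (Num.min (1 - s) (1 - t) - (1 - s) * (1 - t)) /
    (Q (1 - s) * Q (1 - t) * fQ (1 - s) * fQ (1 - t))) a b) a b.

End estimator.

(* Main.v *)
Require Import Defs.
From HB Require Import structures.
From mathcomp Require Import all_boot all_order all_algebra.
From mathcomp Require Import finmap.
From mathcomp Require Import all_classical all_reals all_analysis.
From mathcomp Require Import measurable_realfun zify ring lra.

Set Implicit Arguments.
Unset Strict Implicit.
Unset Printing Implicit Defensive.

Import Order.TTheory GRing.Theory Num.Theory.
Import numFieldNormedType.Exports.

Local Open Scope classical_set_scope.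
Local Open Scope ring_scope.

(* With [g s = log Q (1 - s)], exactness of the regression on cosines turns the
   error of the estimator into a weighted sum, with weights of order [1 / n], of
   [log Q_n (1 - s_j) - g s_j]. Each of these is [- g' s_j D_n s_j] up to a
   remainder, where [D_n t] is the average of the indicators of [X_i > Q (1 - t)]
   minus [t]. The event [log Q_n (1 - u) <= g t] is [t + D_n t <= u], so the
   remainder is governed by the oscillation of [D_n] near [u]; counting
   mismatches over a grid of mesh of order [n^(-1/2)] and taking means gives
   [o(n^(-1/2))] in L1, uniformly in [u], from the bound
   [E (D_n t - D_n u)^2 <= |t - u| / n] alone. What is left is a sum of i.i.d.
   bounded variables for each [n]; Stein's method gives its normal limit and
   Riemann sums, uniform over Lipschitz multipliers of the weight, its variance. *)

(** * Riemann sums and integrals *)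

(** The weight is Riemann integrable but perhaps not Borel. Sums over nodes are therefore compared
    with integrals through oscillations over tagged partitions, and the Lipschitz factors
    (regressors, [g1], covariance kernel) are kept apart from the weight. Uniformity over these
    factors settles the double integral, whose inner integrand changes with the outer variable.
    Independence is given as a product rule on events. At each [n] an observation enters only
    through finitely many threshold indicators, so conditioning is a finite sum. The remainder is
    controlled in mean at each node separately, which is enough because the weights sum to order 1.
    Two constants are tuned: the mesh times [sqrt n], which is the cost of the grid itself, and [K],
    which separates nodes close to [u] (few of them) from distant ones (many, but each unlikely to
    mismatch). The assumptions bear on [[a, b]], whereas the remainder near [a] or [b] looks at
    levels on both sides; a larger interval [[a', b']] with the same properties is built for it. The
    variance may be 0, a case that Stein's equation does not cover and that is treated apart. *)

Section riemann.
Context {R : realType}.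
Variables (a b : R).
Hypothesis ab : a < b.
Implicit Types (f g rho : R -> R) (x y t u : nat -> R) (n m : nat).

Definition tagged_partition (d : R) n x t :=
  [/\ x 0%N = a, x n = b &
   forall i, (i < n)%N -> x i <= t i <= x i.+1 /\ x i.+1 - x i < d].

Definition riemann_sum f n x t := \sum_(i < n) f (t i) * (x i.+1 - x i).

Lemma tagged_partition_le d n x t i j : tagged_partition d n x t ->
  (i <= j)%N -> (j <= n)%N -> x i <= x j.
Proof.
move=> [_ _ h]; elim: j => [|j IH]; first by rewrite leqn0 => /eqP ->.
rewrite leq_eqVlt => /orP[/eqP ->//|ij jn].
have [/andP[h1 h2] _] := h j jn.
by rewrite (le_trans (IH ij (ltnW jn)))// (le_trans h1).
Qed.

Lemma tagged_partition_itv d n x t i : tagged_partition d n x t ->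
  (i <= n)%N -> a <= x i <= b.
Proof.
move=> xt; have [<- <- _] := xt => i_n.
by rewrite !(tagged_partition_le xt).
Qed.

Lemma tagged_partition_tag d n x t i : tagged_partition d n x t ->
  (i < n)%N -> a <= t i <= b.
Proof.
move=> xt i_n; have [_ _ /(_ i i_n)[/andP[h1 h2] _]] := xt.
have /andP[h3 _] := tagged_partition_itv xt (ltnW i_n).
have /andP[_ h4] := tagged_partition_itv xt i_n.
by rewrite (le_trans h3)//= (le_trans h2).
Qed.

Lemma tagged_partition_step d n x t i : tagged_partition d n x t ->
  (i < n)%N -> 0 <= x i.+1 - x i.
Proof. by move=> xt i_n; rewrite subr_ge0 (tagged_partition_le xt). Qed.

Lemma tagged_partition_mesh d d' n x t : d <= d' ->
  tagged_partition d n x t -> tagged_partition d' n x t.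
Proof.
move=> dd' [h0 h1 h]; split=> // i i_n.
by have [h2 h3] := h i i_n; split=> //; rewrite (lt_le_trans h3).
Qed.

Lemma tagged_partition_total d n x t : tagged_partition d n x t ->
  \sum_(i < n) (x i.+1 - x i) = b - a.
Proof.
move=> [<- <- _]; rewrite -(big_mkord xpredT (fun i => x i.+1 - x i)).
by rewrite telescope_sumr.
Qed.

Lemma tagged_partition_gt0 d n x t : tagged_partition d n x t -> (0 < n)%N.
Proof.
by move=> [h0 h1 _]; case: n h1 => // h1; move: ab; rewrite -h0 -h1 ltxx.
Qed.

Lemma exists_tagged_partition d : 0 < d ->
  exists n x, tagged_partition d n x x.
Proof.
move=> d0; pose n := (Num.truncn ((b - a) / d)).+1.
have n0 : 0 < n%:R :> R by rewrite ltr0n.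
have step : (b - a) / n%:R < d.
  by rewrite ltr_pdivrMr// mulrC -ltr_pdivrMr// truncnS_gt.
exists n, (fun i => a + i%:R * ((b - a) / n%:R)); split.
- by rewrite mul0r addr0.
- by rewrite mulrC divfK ?gt_eqF// addrC subrK.
- move=> i _; rewrite lexx/= lerD2l ler_wpM2r ?ler_nat//; last first.
    by rewrite divr_ge0 ?subr_ge0 ?ltW.
  split=> //; have -> : a + i.+1%:R * ((b - a) / n%:R) - (a + i%:R * ((b - a) / n%:R))
    = (b - a) / n%:R by rewrite -natr1; ring.
  by [].
Qed.

Lemma is_riemann_integralP f l : is_riemann_integral f a b l <->
  forall e, 0 < e -> exists2 d, 0 < d &
  forall n x t, tagged_partition d n x t -> `|riemann_sum f n x t - l| < e.
Proof.
split=> h e e0; have [d d0 hd] := h e e0; exists d => // n x t.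
  by move=> [? ? ?]; exact: hd.
by move=> ? ? ?; exact: hd.
Qed.

Lemma is_riemann_integral_unique f l l' :
  is_riemann_integral f a b l -> is_riemann_integral f a b l' -> l = l'.
Proof.
move=> /is_riemann_integralP h /is_riemann_integralP h'.
apply/eqP; rewrite -subr_eq0 -normr_le0; apply/ler_addgt0Pr => e e0.
rewrite add0r.
have [d d0 hd] := h (e / 2) (divr_gt0 e0 (ltr0n _ 2)).
have [d' d'0 hd'] := h' (e / 2) (divr_gt0 e0 (ltr0n _ 2)).
have dd'0 : 0 < Num.min d d' by rewrite lt_min d0.
have [n [x nx]] := exists_tagged_partition dd'0.
have := hd _ _ _ (tagged_partition_mesh (_ : Num.min d d' <= d) nx).
rewrite ge_min lexx => /(_ isT) k1.
have := hd' _ _ _ (tagged_partition_mesh (_ : Num.min d d' <= d') nx).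
rewrite ge_min lexx orbT => /(_ isT) k2.
set s := riemann_sum f n x x in k1 k2.
have -> : l - l' = (s - l') - (s - l) by ring.
by rewrite (le_trans (ler_normB _ _))//; lra.
Qed.

Lemma riemann_integralE f l :
  is_riemann_integral f a b l -> riemann_integral f a b = l.
Proof.
move=> fl; rewrite /riemann_integral.
by case: xgetP => [y _ /is_riemann_integral_unique|/(_ l)//]; exact.
Qed.

Lemma eq_is_riemann_integral f g (l : R) : (forall v : R, a <= v <= b -> f v = g v) ->
  is_riemann_integral f a b l -> is_riemann_integral g a b l.
Proof.
move=> fg /is_riemann_integralP h; apply/is_riemann_integralP => e e0.
have [d d0 hd] := h e e0; exists d => // n x t nxt.
rewrite (_ : riemann_sum g n x t = riemann_sum f n x t); first exact: hd.
by apply: eq_bigr => i _; rewrite fg// (tagged_partition_tag nxt).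
Qed.

Lemma eq_riemann_integral f g : (forall v : R, a <= v <= b -> f v = g v) ->
  riemann_integral f a b = riemann_integral g a b.
Proof.
move=> fg; rewrite /riemann_integral; congr (xget 0 _).
apply/seteqP; split => l /=; apply: eq_is_riemann_integral => // u uab.
by rewrite fg.
Qed.

Lemma is_riemann_integralZ f (c l : R) : is_riemann_integral f a b l ->
  is_riemann_integral (fun v => c * f v) a b (c * l).
Proof.
move=> /is_riemann_integralP h; apply/is_riemann_integralP => e e0.
have c0 : 0 < `|c| + 1 by rewrite ltr_wpDl.
have [d d0 hd] := h (e / (`|c| + 1)) (divr_gt0 e0 c0); exists d => // n x t nxt.
have -> : riemann_sum (fun v => c * f v) n x t = c * riemann_sum f n x t.
  by rewrite /riemann_sum mulr_sumr; apply: eq_bigr => i _; rewrite mulrA.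
rewrite -mulrBr normrM; have := hd _ _ _ nxt; rewrite ltr_pdivlMr//.
by apply: le_lt_trans; rewrite mulrC ler_wpM2l// lerDl.
Qed.

(** Taking in each cell the tag with the larger value of [f], then the one with the smaller, turns
    the sum of absolute differences into a difference of two Riemann sums, each within [e / 2] of
    the integral. *)
Lemma riemann_oscillation f : riemann_integrable f a b ->
  forall e, 0 < e -> exists2 d, 0 < d &
  forall n x t t', tagged_partition d n x t -> tagged_partition d n x t' ->
  \sum_(i < n) `|f (t i) - f (t' i)| * (x i.+1 - x i) <= e.
Proof.
move=> [l /is_riemann_integralP h] e e0.
have [d d0 hd] := h (e / 2) (divr_gt0 e0 (ltr0n _ 2)); exists d => // n x t t' xt xt'.
pose p i := if f (t' i) <= f (t i) then t i else t' i.
pose q i := if f (t' i) <= f (t i) then t' i else t i.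
have xp : tagged_partition d n x p.
  have [h0 h1 h2] := xt; have [_ _ h3] := xt'; split=> // i i_n.
  by rewrite /p; case: ifP => _; [exact: h2|exact: h3].
have xq : tagged_partition d n x q.
  have [h0 h1 h2] := xt; have [_ _ h3] := xt'; split=> // i i_n.
  by rewrite /q; case: ifP => _; [exact: h3|exact: h2].
have -> : \sum_(i < n) `|f (t i) - f (t' i)| * (x i.+1 - x i) =
    riemann_sum f n x p - riemann_sum f n x q.
  rewrite /riemann_sum -sumrB; apply: eq_bigr => i _; rewrite -mulrBl; congr (_ * _).
  rewrite /p /q; case: leP => ft; first by rewrite ger0_norm// subr_ge0.
  by rewrite ltr0_norm ?subr_lt0// opprB.
have k1 := hd _ _ _ xp; have k2 := hd _ _ _ xq.
have -> : riemann_sum f n x p - riemann_sum f n x q =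
  (riemann_sum f n x p - l) - (riemann_sum f n x q - l) by ring.
by rewrite (le_trans (ler_norm _))// (le_trans (ler_normB _ _))//; lra.
Qed.

Lemma tagged_partition_cover d n x t v : tagged_partition d n x t ->
  a <= v <= b -> exists2 i, (i < n)%N & x i <= v <= x i.+1.
Proof.
move=> xt /andP[av vb].
have n0 := tagged_partition_gt0 xt.
have [x0 xn _] := xt; move: av vb; rewrite -x0 -xn.
elim: n n0 {xt x0 xn} => // n IH _ av vb.
have [vn|vn] := leP v (x n); last by exists n => //; rewrite (ltW vn).
case: n IH av vb vn => [_ av vb vn|n IH av vb vn]; first by exists 0%N => //; rewrite av.
by have [i i_n xi] := IH isT av vn; exists i => //; rewrite ltnW.
Qed.

(** On one fixed partition, moving a single tag to [v] changes the sum by [|f v - f (x i)|] times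
    the cell length, and by at most 1 in view of the oscillation. The finitely many values [f (x i)]
    and inverse lengths then give the bound. A cell of length zero contains only its endpoint. *)
Lemma riemann_integrable_bounded f : riemann_integrable f a b ->
  exists2 B, 0 < B & forall v, a <= v <= b -> `|f v| <= B.
Proof.
move=> fi; have [d d0 hd] := riemann_oscillation fi ltr01.
have [n [x nx]] := exists_tagged_partition d0.
pose S := \sum_(i < n) `|f (x i)|.
pose D := \sum_(i < n) (x i.+1 - x i)^-1 .
have D0 (i : 'I_n) : 0 <= (x i.+1 - x i)^-1 by rewrite invr_ge0 (tagged_partition_step nx).
have S0 : 0 <= S by apply: sumr_ge0.
have DD0 : 0 <= D by apply: sumr_ge0.
exists (S + D + 1) => [|v vab]; first by rewrite ltr_wpDl// addr_ge0.
have [i i_n /andP[xv vx]] := tagged_partition_cover nx vab.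
have Si : `|f (x i)| <= S.
  by rewrite /S (bigD1 (Ordinal i_n))//= lerDl sumr_ge0.
have Di : (x i.+1 - x i)^-1 <= D.
  by rewrite /D (bigD1 (Ordinal i_n))//= lerDl sumr_ge0.
have [E|xx] := eqVneq (x i.+1) (x i).
  have -> : v = x i by apply/eqP; rewrite eq_le xv -E vx.
  by rewrite (le_trans Si)// -addrA lerDl addr_ge0.
have x0 : 0 < x i.+1 - x i.
  by rewrite lt_neqAle eq_sym subr_eq0 xx (tagged_partition_step nx).
pose t j := if j == i then v else x j.
have nt : tagged_partition d n x t.
  have [h0 h1 h2] := nx; split=> // j jn; rewrite /t; case: eqP => [->|_]; last exact: h2.
  by rewrite xv vx; have [_] := h2 i i_n.
have := hd _ _ _ _ nt nx; rewrite (bigD1 (Ordinal i_n))//= {1}/t eqxx => K.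
have : `|f v - f (x i)| * (x i.+1 - x i) <= 1.
  apply: le_trans K; rewrite lerDl sumr_ge0// => j _.
  by rewrite mulr_ge0// (tagged_partition_step nx).
rewrite -ler_pdivlMr// mul1r => K2.
have := ler_normD (f v - f (x i)) (f (x i)); rewrite subrK.
lra.
Qed.

(* [clip x x' y' - clip x x' y] is the length of [x, x'] `&` [y, y']. *)
Let clip (x x' y : R) := Num.max x (Num.min x' y).
Let overlap (x x' y y' : R) := clip x x' y' - clip x x' y.

Let overlap_cases (x x' y y' : R) : x <= x' -> y <= y' ->
  overlap x x' y y' = 0 /\ overlap y y' x x' = 0 \/
  [/\ x <= y', y <= x', overlap x x' y y' = Num.min x' y' - Num.max x y
    & overlap y y' x x' = Num.min x' y' - Num.max x y].
Proof.
move=> xx yy; rewrite /overlap /clip.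
have [yx|xy] := leP y' x.
  left; have y'x' := le_trans yx xx; have yx' := le_trans yy y'x'.
  have yx0 := le_trans yy yx.
  rewrite (min_idPr y'x') (min_idPr yx') (max_idPl yx) (max_idPl yx0).
  by rewrite [Num.min y' x'](min_idPl y'x') (max_idPr yy) !subrr.
have [x'y|yx'] := leP x' y.
  left; have xy0 := le_trans xx x'y; have x'y' := le_trans x'y yy.
  rewrite [Num.min x' y'](min_idPl x'y') subrr.
  by rewrite (min_idPr x'y') ?(min_idPr (ltW xy)) (max_idPl x'y) (max_idPl xy0) subrr.
right; split; rewrite ?ltW//.
  rewrite ?(min_idPr (ltW yx')); congr (_ - _); apply/max_idPr.
  by rewrite le_min xx ltW.
rewrite ?(min_idPr (ltW xy)) [Num.max y x]maxC [Num.min y' _]minC.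
by congr (_ - _); apply/max_idPr; rewrite le_min yy ltW.
Qed.

Let overlapC (x x' y y' : R) : x <= x' -> y <= y' ->
  overlap x x' y y' = overlap y y' x x'.
Proof. by move=> xx yy; have [[-> ->]|[_ _ -> ->]] := overlap_cases xx yy. Qed.

Let overlap_ge0 (x x' y y' : R) : x <= x' -> y <= y' -> 0 <= overlap x x' y y'.
Proof.
move=> xx yy; have [[-> _]//|[xy yx -> _]] := overlap_cases xx yy.
by rewrite subr_ge0 le_min !ge_max xx yy xy yx.
Qed.

Let overlap_gt0 (x x' y y' : R) : x <= x' -> y <= y' -> overlap x x' y y' != 0 ->
  x <= y' /\ y <= x'.
Proof.
by move=> xx yy; have [[-> _]|[]//] := overlap_cases xx yy; rewrite eqxx.
Qed.

(** Written as increments of [clip], the lengths telescope from [clip x x' a = x] to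
    [clip x x' b = x']. *)
Let overlap_sum (x x' : R) d m y u : tagged_partition d m y u -> a <= x -> x <= x' -> x' <= b ->
  \sum_(j < m) overlap x x' (y j) (y j.+1) = x' - x.
Proof.
move=> [y0 ym _] ax xx xb.
rewrite -(big_mkord xpredT (fun j => clip x x' (y j.+1) - clip x x' (y j))).
rewrite telescope_sumr// y0 ym /clip.
have -> : Num.min x' b = x' by apply/min_idPl.
have -> : Num.min x' a = a by apply/min_idPr; rewrite (le_trans ax).
have -> : Num.max x x' = x' by apply/max_idPr.
by have -> : Num.max x a = x by apply/max_idPl.
Qed.

Let exists_argmax (F : nat -> R) m : exists2 j, (j <= m)%N &
  forall i, (i <= m)%N -> F i <= F j.
Proof.
elim: m => [|m [j jm hj]]; first by exists 0%N => // i; rewrite leqn0 => /eqP ->.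
have [Fm|Fm] := leP (F m.+1) (F j).
  exists j; first exact: leqW.
  by move=> i; rewrite leq_eqVlt => /orP[/eqP ->//|/hj].
exists m.+1 => // i; rewrite leq_eqVlt => /orP[/eqP ->//|/hj].
by move/le_trans; apply; exact: ltW.
Qed.

(* Points of overlapping cells are compared through a point of the overlap, so
   that the oscillation of each partition bounds its half of the difference. *)
Let half_oscillation f e d n x t m y u d' :
  (forall n x t t', tagged_partition d n x t -> tagged_partition d n x t' ->
    \sum_(i < n) `|f (t i) - f (t' i)| * (x i.+1 - x i) <= e) ->
  tagged_partition d n x t -> tagged_partition d' m y u ->
  \sum_(i < n) \sum_(j < m) overlap (x i) (x i.+1) (y j) (y j.+1) *
     `|f (t i) - f (Num.max (x i) (y j))| <= e.
Proof.
move=> osc xt yu.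
have m0 := tagged_partition_gt0 yu.
(* [w i j] has to be a legal tag of cell [i] for every [j]; where the cells do not overlap, [t i]
   serves and the term vanishes with its factor. The worst [j] for each [i] then gives a single
   tagging that dominates all [j] at once. *)
pose w i j := if overlap (x i) (x i.+1) (y j) (y j.+1) == 0 then t i
              else Num.max (x i) (y j).
have xi (i : nat) : (i < n)%N -> x i <= x i.+1.
  by move=> i_n; rewrite (tagged_partition_le xt).
have yj (j : nat) : (j < m)%N -> y j <= y j.+1.
  by move=> jm; rewrite (tagged_partition_le yu).
have wI i j : (i < n)%N -> (j < m)%N -> x i <= w i j <= x i.+1.
  move=> i_n jm; rewrite /w; have [_|o0] := eqVneq.
    by have [_ _ /(_ i i_n)[]] := xt.
  have [h1 h2] := overlap_gt0 (xi i i_n) (yj j jm) o0.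
  by rewrite le_max lexx ge_max xi.
have /choice[j0 hj0] : forall i, exists j, (j <= m.-1)%N /\
    forall l, (l <= m.-1)%N -> `|f (t i) - f (w i l)| <= `|f (t i) - f (w i j)|.
  move=> i; have [j jm hj] := exists_argmax (fun j => `|f (t i) - f (w i j)|) m.-1.
  by exists j.
have jm i : (j0 i < m)%N by rewrite -(prednK m0) ltnS; exact: (hj0 i).1.
have xt' : tagged_partition d n x (fun i => w i (j0 i)).
  have [h0 h1 h2] := xt; split=> // i i_n; split; first exact: wI.
  exact: (h2 i i_n).2.
apply: le_trans (osc _ _ _ _ xt xt'); apply: ler_sum => i _.
have /andP[ax _] := tagged_partition_itv xt (ltnW (ltn_ord i)).
have /andP[_ xb] := tagged_partition_itv xt (ltn_ord i).
rewrite -(overlap_sum yu ax (xi i (ltn_ord i)) xb) mulr_sumr.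
apply: ler_sum => j _; rewrite mulrC.
have [->|o0] := eqVneq (overlap (x i) (x i.+1) (y j) (y j.+1)) 0; first by rewrite !mulr0.
apply: ler_wpM2r; first by rewrite overlap_ge0 ?xi// yj.
have := (hj0 i).2 j; rewrite {1}/w (negbTE o0); apply.
by rewrite -ltnS prednK.
Qed.

(** One constant bounds both size and slope, so that a single [C] describes a class of multipliers
    over which the mesh can be chosen uniformly. *)
Definition lipschitz_itv (C : R) rho :=
  (forall v : R, a <= v <= b -> `|rho v| <= C) /\
  (forall v w : R, a <= v <= b -> a <= w <= b -> `|rho v - rho w| <= C * `|v - w|).

(** The mesh is fixed before [rho]. Tags of overlapping cells are within [2 * d], so the variation
    of [rho] costs [B * C * (2 * d)] per unit length; the variation of [f] costs [C] times its
    oscillation on each of the two partitions. The budget is [e / 2 + e / 4 + e / 4]. *)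
Lemma riemann_sum_cauchy f C e : riemann_integrable f a b -> 0 < C -> 0 < e ->
  exists2 d, 0 < d & forall rho, lipschitz_itv C rho ->
  forall n x t m y u, tagged_partition d n x t -> tagged_partition d m y u ->
  `|riemann_sum (fun v => f v * rho v) n x t -
    riemann_sum (fun v => f v * rho v) m y u| <= e.
Proof.
move=> fi C0 e0; have [B B0 fB] := riemann_integrable_bounded fi.
have ba : 0 < b - a by rewrite subr_gt0.
have e1 : 0 < e / (4 * C) by rewrite divr_gt0// mulr_gt0.
have [d1 d10 osc] := riemann_oscillation fi e1.
have d20 : 0 < e / (4 * B * C * (b - a)) by rewrite divr_gt0// !mulr_gt0.
pose d := Num.min d1 (e / (4 * B * C * (b - a))).
have d0 : 0 < d by rewrite lt_min d10.
exists d => // rho [rhoC rhoL] n x t m y u xt yu.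
have dd1 : d <= d1 by rewrite ge_min lexx.
have dd2 : d <= e / (4 * B * C * (b - a)) by rewrite ge_min lexx orbT.
pose ov (i : nat) (j : nat) := overlap (x i) (x i.+1) (y j) (y j.+1).
have xi (i : nat) : (i < n)%N -> x i <= x i.+1.
  by move=> i_n; rewrite (tagged_partition_le xt).
have yj (j : nat) : (j < m)%N -> y j <= y j.+1.
  by move=> jm; rewrite (tagged_partition_le yu).
have ov0 (i : 'I_n) (j : 'I_m) : 0 <= ov i j by rewrite overlap_ge0 ?xi// yj.
have sx (i : 'I_n) : \sum_(j < m) ov i j = x i.+1 - x i.
  have /andP[ax _] := tagged_partition_itv xt (ltnW (ltn_ord i)).
  have /andP[_ xb] := tagged_partition_itv xt (ltn_ord i).
  by rewrite (overlap_sum yu ax (xi i (ltn_ord i)) xb).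
have sy (j : 'I_m) : \sum_(i < n) ov i j = y j.+1 - y j.
  have /andP[ay _] := tagged_partition_itv yu (ltnW (ltn_ord j)).
  have /andP[_ yb] := tagged_partition_itv yu (ltn_ord j).
  rewrite -(overlap_sum xt ay (yj j (ltn_ord j)) yb); apply: eq_bigr => i _.
  by rewrite /ov overlapC ?xi ?yj.
have Ex : riemann_sum (fun v => f v * rho v) n x t =
    \sum_(i < n) \sum_(j < m) ov i j * (f (t i) * rho (t i)).
  by apply: eq_bigr => i _; rewrite -mulr_suml sx mulrC.
have Ey : riemann_sum (fun v => f v * rho v) m y u =
    \sum_(i < n) \sum_(j < m) ov i j * (f (u j) * rho (u j)).
  by rewrite exchange_big/=; apply: eq_bigr => j _; rewrite -mulr_suml sy mulrC.
rewrite Ex Ey -sumrB.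
under eq_bigr do rewrite -sumrB.
have K (i : 'I_n) (j : 'I_m) :
  `|ov i j * (f (t i) * rho (t i)) - ov i j * (f (u j) * rho (u j))| <=
  C * (ov i j * `|f (t i) - f (Num.max (x i) (y j))|) +
  C * (ov i j * `|f (u j) - f (Num.max (y j) (x i))|) +
  ov i j * (B * C * (2 * d)).
  rewrite -mulrBr normrM (ger0_norm (ov0 i j)).
  have [->|o0] := eqVneq (ov i j) 0; first by rewrite !mul0r !mulr0 !addr0.
  have [h1 h2] := overlap_gt0 (xi i (ltn_ord i)) (yj j (ltn_ord j)) o0.
  rewrite (mulrCA C) (mulrCA C (ov i j)) -!mulrDr ler_wpM2l//.
  have tab := tagged_partition_tag xt (ltn_ord i).
  have uab := tagged_partition_tag yu (ltn_ord j).
  have [_ _ /(_ i (ltn_ord i))[/andP[t1 t2] t3]] := xt.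
  have [_ _ /(_ j (ltn_ord j))[/andP[u1 u2] u3]] := yu.
  have -> : f (t i) * rho (t i) - f (u j) * rho (u j) =
    (f (t i) - f (Num.max (x i) (y j))) * rho (t i) -
    (f (u j) - f (Num.max (y j) (x i))) * rho (t i) +
    f (u j) * (rho (t i) - rho (u j)) by rewrite [Num.max (y j) _]maxC; ring.
  rewrite (le_trans (ler_normD _ _))// lerD//.
    rewrite (le_trans (ler_normB _ _))// mulrDr lerD// normrM mulrC ler_wpM2r//; exact: rhoC.
  rewrite normrM -mulrA ler_pM//; first exact: fB.
  rewrite (le_trans (rhoL _ _ tab uab))// ler_wpM2l ?(ltW C0)//.
  by rewrite ler_norml; apply/andP; split; lra.
apply: (@le_trans _ _ (\sum_(i < n) \sum_(j < m) (
  C * (ov i j * `|f (t i) - f (Num.max (x i) (y j))|) +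
  C * (ov i j * `|f (u j) - f (Num.max (y j) (x i))|) +
  ov i j * (B * C * (2 * d))))).
  rewrite (le_trans (ler_norm_sum _ _ _))//; apply: ler_sum => i _.
  by rewrite (le_trans (ler_norm_sum _ _ _))//; apply: ler_sum.
under eq_bigr do rewrite !big_split/= -!mulr_sumr -mulr_suml sx.
rewrite !big_split/= -!mulr_sumr -mulr_suml (tagged_partition_total xt).
have H1 : \sum_(i < n) \sum_(j < m) ov i j * `|f (t i) - f (Num.max (x i) (y j))| <= e / (4 * C).
  exact: (half_oscillation osc (tagged_partition_mesh dd1 xt) yu).
have H2 : \sum_(i < n) \sum_(j < m) ov i j * `|f (u j) - f (Num.max (y j) (x i))| <= e / (4 * C).
  rewrite exchange_big/=.
  have := half_oscillation osc (tagged_partition_mesh dd1 yu) xt.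
  apply: le_trans; apply: ler_sum => j _; apply: ler_sum => i _.
  by rewrite /ov overlapC ?xi ?yj.
have H3 : (b - a) * (B * C * (2 * d)) <= e / 2.
  apply: (@le_trans _ _ ((b - a) * (B * C * (2 * (e / (4 * B * C * (b - a))))))).
    apply: ler_wpM2l; first exact: ltW.
    by apply: ler_wpM2l; [rewrite mulr_ge0 ?ltW|exact: ler_wpM2l].
  rewrite le_eqVlt; apply/orP; left; apply/eqP; field.
  by rewrite !gt_eqF// .
have K4 : C * (e / (4 * C)) = e / 4 by field; rewrite gt_eqF.
have := ler_wpM2l (ltW C0) H1; have := ler_wpM2l (ltW C0) H2; rewrite K4.
lra.
Qed.

Lemma riemann_integrable_cauchy f :
  (forall e, 0 < e -> exists2 d, 0 < d & forall n x t m y u,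
    tagged_partition d n x t -> tagged_partition d m y u ->
    `|riemann_sum f n x t - riemann_sum f m y u| <= e) ->
  riemann_integrable f a b.
Proof.
move=> fc.
have h0 (k : nat) : 0 < k.+1%:R^-1 :> R by rewrite invr_gt0.
have /choice[N /choice[x Nx]] := fun k => exists_tagged_partition (h0 k).
pose s k := riemann_sum f (N k) (x k) (x k).
have mesh (d : R) : 0 < d -> exists K, forall k, (K <= k)%N ->
    tagged_partition d (N k) (x k) (x k).
  move=> d0; exists (Num.truncn d^-1) => k Kk.
  apply: tagged_partition_mesh (Nx k); rewrite invf_ple ?posrE// ltW//.
  by rewrite (lt_le_trans (truncnS_gt _))// ler_nat.
have /cvg_ex[l sl] : cvgn s.
  apply: R_complete; apply: cauchy_exP => e e0.
  have [d d0 hd] := fc _ (divr_gt0 e0 (ltr0n R 2)).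
  have [K HK] := mesh _ d0.
  exists (s K); exists K => // k /= Kk; rewrite /ball/=.
  apply: (@le_lt_trans _ _ (e / 2)); first by apply: hd; exact: HK.
  by rewrite ltr_pdivrMr// ltr_pMr// ltr1n.
exists l; apply/is_riemann_integralP => e e0.
have [d d0 hd] := fc _ (divr_gt0 e0 (ltr0n R 4)).
exists d => // n z t zt.
have [K HK] := mesh _ d0.
have /cvgrPdist_le /(_ _ (divr_gt0 e0 (ltr0n R 4)))[K' _ HK'] := sl.
have := HK' (maxn K K') (leq_maxr _ _); have := HK (maxn K K') (leq_maxl _ _).
set k := maxn K K' => k1 /= k2.
have k3 := hd _ _ _ _ _ _ zt k1.
have -> : riemann_sum f n z t - l = (riemann_sum f n z t - s k) - (l - s k) by ring.
rewrite (le_lt_trans (ler_normB _ _))// (le_lt_trans (lerD k3 k2))//.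
by lra.
Qed.

Lemma riemann_sum_close f (d e : R) : riemann_integrable f a b -> 0 < d ->
  (forall n x t m y u,
    tagged_partition d n x t -> tagged_partition d m y u ->
    `|riemann_sum f n x t - riemann_sum f m y u| <= e) ->
  forall n x t, tagged_partition d n x t ->
  `|riemann_sum f n x t - riemann_integral f a b| <= e.
Proof.
move=> [l fl] d0 hd n x t xt; rewrite (riemann_integralE fl).
apply/ler_addgt0Pr => eta eta0.
have [d' d'0 hd'] := (is_riemann_integralP _ _).1 fl eta eta0.
have dd'0 : 0 < Num.min d d' by rewrite lt_min d0.
have [m [y my]] := exists_tagged_partition dd'0.
have := hd' _ _ _ (tagged_partition_mesh (_ : Num.min d d' <= d') my).
rewrite ge_min lexx orbT => /(_ isT) k2.
have := hd _ _ _ _ _ _ xt (tagged_partition_mesh (_ : Num.min d d' <= d) my).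
rewrite ge_min lexx => /(_ isT) k1.
rewrite -[_ - l](subrKA (riemann_sum f m y y)).
by rewrite (le_trans (ler_normD _ _))// lerD// ltW.
Qed.

Lemma riemann_integrable_mul f C rho : riemann_integrable f a b -> 0 < C ->
  lipschitz_itv C rho -> riemann_integrable (fun v => f v * rho v) a b.
Proof.
move=> fi C0 rhoC; apply: riemann_integrable_cauchy => e e0.
have [d d0 hd] := riemann_sum_cauchy fi C0 e0.
by exists d => // n x t m y u; exact: hd.
Qed.

Lemma riemann_sum_uniform f C e : riemann_integrable f a b -> 0 < C -> 0 < e ->
  exists2 d, 0 < d & forall rho, lipschitz_itv C rho ->
  forall n x t, tagged_partition d n x t ->
  `|riemann_sum (fun v => f v * rho v) n x t -
    riemann_integral (fun v => f v * rho v) a b| <= e.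
Proof.
move=> fi C0 e0; have [d d0 hd] := riemann_sum_cauchy fi C0 e0.
exists d => // rho rhoC; apply: riemann_sum_close => //.
  exact: riemann_integrable_mul rhoC.
by move=> n x t m y u; exact: hd.
Qed.

(** Both integrals are read on one common partition, where the estimate is termwise. It gives the
    Lipschitz continuity, in the outer variable, of the inner integral of the variance. *)
Lemma riemann_integral_dist f B C rho rho' (eta : R) :
  riemann_integrable f a b -> 0 < C -> (forall v : R, a <= v <= b -> `|f v| <= B) ->
  lipschitz_itv C rho -> lipschitz_itv C rho' ->
  (forall v : R, a <= v <= b -> `|rho v - rho' v| <= eta) ->
  `|riemann_integral (fun v => f v * rho v) a b -
    riemann_integral (fun v => f v * rho' v) a b| <= B * eta * (b - a).
Proof.
move=> fi C0 fB rhoC rho'C rr; apply/ler_addgt0Pr => e e0.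
have [d d0 hd] := riemann_sum_uniform fi C0 (divr_gt0 e0 (ltr0n R 2)).
have [n [x nx]] := exists_tagged_partition d0.
have k1 := hd _ rhoC _ _ _ nx; have k2 := hd _ rho'C _ _ _ nx.
have k3 : `|riemann_sum (fun v => f v * rho v) n x x -
    riemann_sum (fun v => f v * rho' v) n x x| <= B * eta * (b - a).
  rewrite /riemann_sum -sumrB -(tagged_partition_total nx) mulr_sumr.
  rewrite (le_trans (ler_norm_sum _ _ _))//; apply: ler_sum => i _.
  have xab := tagged_partition_tag nx (ltn_ord i).
  rewrite -mulrBl -mulrBr !normrM (ger0_norm (tagged_partition_step nx (ltn_ord i))).
  rewrite ler_wpM2r ?(tagged_partition_step nx (ltn_ord i))//.
  by rewrite ler_pM// ?fB ?rr.
move: k1 k2 k3; set s := riemann_sum _ _ _ _; set s' := riemann_sum _ _ _ _.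
set l := riemann_integral _ _ _; set l' := riemann_integral _ _ _ => k1 k2 k3.
have -> : l - l' = (s - s') - (s - l) + (s' - l') by ring.
rewrite (le_trans (ler_normD _ _))//.
have := ler_normB (s - s') (s - l).
lra.
Qed.

(** * Sums over the nodes [j / n] as Riemann sums *)

Section nodes.
Hypothesis a0 : 0 < a.

Lemma first_indexE n : (first_index a n)%:R = (Num.ceil (n%:R * a))%:~R :> R.
Proof.
rewrite /first_index natr_absz ger0_norm// ceil_ge0.
by rewrite (lt_le_trans (ltrN10 R))// mulr_ge0// ltW.
Qed.

Lemma last_indexE n : (last_index b n)%:R = (Num.floor (n%:R * b))%:~R :> R.
Proof.
rewrite /last_index natr_absz ger0_norm// floor_ge0.
by rewrite mulr_ge0// ltW// (lt_trans a0).
Qed.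

Lemma node_ge n i : (0 < n)%N -> a <= node a n i.
Proof.
move=> n0; rewrite /node ler_pdivlMr ?ltr0n// mulrC natrD first_indexE.
by rewrite (le_trans (ceil_ge _))// lerDl.
Qed.

Lemma node_le n i : (i < nb_obs a b n)%N -> (0 < n)%N -> node a n i <= b.
Proof.
move=> i_n n0; rewrite /node ler_pdivrMr ?ltr0n// mulrC.
apply: (le_trans _ (floor_le _)); rewrite -last_indexE ler_nat.
by move: i_n; rewrite /nb_obs; lia.
Qed.

Lemma node_first n : (0 < n)%N -> node a n 0 < a + n%:R^-1.
Proof.
move=> n0; have n0' : 0 < n%:R :> R by rewrite ltr0n.
rewrite /node addn0 first_indexE ltr_pdivrMr// mulrDl mulVf ?gt_eqF// mulrC -ltrBlDr.
by have := ceilB1_lt (a * n%:R); rewrite intrB.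
Qed.

Lemma node_last n : (0 < n)%N -> (0 < nb_obs a b n)%N -> b < node a n (nb_obs a b n).
Proof.
move=> n0 m0; have n0' : 0 < n%:R :> R by rewrite ltr0n.
rewrite /node ltr_pdivlMr// mulrC; have := floorD1_gt (n%:R * b).
move/lt_le_trans; apply; rewrite intrD -last_indexE natr1 ler_nat.
by move: m0; rewrite /nb_obs; lia.
Qed.

Lemma nodeS n i : (0 < n)%N -> node a n i.+1 = node a n i + n%:R^-1.
Proof. by move=> n0; rewrite /node addnS -natr1 mulrDl mul1r. Qed.

Lemma nb_obs_gt0 n : (b - a)^-1 <= n%:R -> (0 < nb_obs a b n)%N.
Proof.
move=> nab; have ba : 0 < b - a by rewrite subr_gt0.
have K : n%:R * a + 1 <= n%:R * b.
  rewrite addrC -lerBrDr -mulrBr -ler_pdivrMr//.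
  by rewrite mul1r.
rewrite /nb_obs subn_gt0 ltnS -(ler_nat R) first_indexE last_indexE ler_int.
rewrite -ltzD1 -(ltr_int R) intrD.
have := ceilB1_lt (n%:R * a); have := floorD1_gt (n%:R * b).
rewrite intrD intrB; lra.
Qed.

(** The nodes tag the partition that they form themselves, once the first breakpoint is moved to [a]
    and the one just beyond [b] is moved to [b]. Each of these two moves is at most [1 / n]: hence
    the total [2 / n], and cells of length at most [2 / n], strictly below [3 / n]. *)
Lemma node_partition n : (0 < n)%N -> (b - a)^-1 <= n%:R ->
  exists x, tagged_partition (3 / n%:R) (nb_obs a b n) x (node a n) /\
  \sum_(i < nb_obs a b n) `|(x i.+1 - x i) - n%:R^-1| <= 2 / n%:R.
Proof.
move=> n0 nab; have m0 := nb_obs_gt0 nab; have n0' : 0 < n%:R :> R by rewrite ltr0n.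
have iV0 : 0 < n%:R^-1 :> R by rewrite invr_gt0.
set m := nb_obs a b n in m0 *.
pose x i := if i == 0%N then a else if (i < m)%N then node a n i else b.
have x0 : x 0%N = a by [].
have xm : x m = b by rewrite /x ltnn eqn0Ngt m0.
have xi i : (0 < i < m)%N -> x i = node a n i.
  by move=> /andP[i0 im]; rewrite /x eqn0Ngt i0 im.
pose eps i := x i - node a n i.
have eps0 i : (0 < i < m)%N -> eps i = 0 by move=> im; rewrite /eps xi// subrr.
have first : - n%:R^-1 < eps 0%N <= 0.
  rewrite /eps x0 subr_le0 node_ge// andbT.
  by have := node_first n0; lra.
have last : - n%:R^-1 <= eps m <= 0.
  rewrite /eps xm subr_le0 (ltW (node_last _ _))// andbT.
  have mE : m = m.-1.+1 by rewrite prednK.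
  have := @node_le n m.-1; rewrite -/m {2}mE ltnS leqnn => /(_ isT n0).
  by rewrite [in node a n m]mE nodeS//; lra.
have epsi i : (i <= m)%N -> - n%:R^-1 <= eps i <= 0.
  case: i => [_|i]; first by move: first => /andP[/ltW -> ->].
  rewrite leq_eqVlt => /orP[/eqP ->//|im]; rewrite eps0//.
  by rewrite oppr_le0 lexx ltW.
have dE i : (x i.+1 - x i) - n%:R^-1 = eps i.+1 - eps i.
  by rewrite /eps nodeS//; ring.
exists x; split.
  split=> // i im; have /andP[e1 e2] := epsi i (ltnW im); have /andP[e3 e4] := epsi i.+1 im.
  split; last first.
    have -> : 3 / n%:R = n%:R^-1 + n%:R^-1 + n%:R^-1 :> R by ring.
    by have := dE i; lra.
  by apply/andP; split; move: e1 e2 e3 e4; rewrite /eps nodeS//; lra.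
have S1 : \sum_(i < m) `|eps i| <= n%:R^-1.
  rewrite (bigD1 (Ordinal m0))//= big1 ?addr0.
    by rewrite ler_norml; move: first => /andP[/ltW -> /le_trans ->]//; exact: ltW.
  by move=> i i0; rewrite eps0 ?normr0// ltn_ord lt0n andbT.
have S2 : \sum_(i < m) `|eps i.+1| <= n%:R^-1.
  have mm : (m.-1 < m)%N by rewrite prednK.
  rewrite (bigD1 (Ordinal mm))//= big1 ?addr0.
    by rewrite prednK// ler_norml; move: last => /andP[-> /le_trans ->]//; exact: ltW.
  move=> i /eqP im; rewrite eps0 ?normr0//=; have := ltn_ord i.
  have : (i : nat) <> m.-1 by move=> E; apply: im; exact: val_inj.
  by lia.
have -> : 2 / n%:R = n%:R^-1 + n%:R^-1 :> R by ring.
apply: le_trans (lerD S2 S1); rewrite -big_split/=; apply: ler_sum => i _.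
by rewrite dE ler_normB.
Qed.

Lemma node_sum_uniform f C e : riemann_integrable f a b -> 0 < C -> 0 < e ->
  exists N, forall n, (N <= n)%N -> forall rho, lipschitz_itv C rho ->
  `|\sum_(i < nb_obs a b n) f (node a n i) * rho (node a n i) / n%:R -
    riemann_integral (fun v => f v * rho v) a b| <= e.
Proof.
move=> fi C0 e0; have [B B0 fB] := riemann_integrable_bounded fi.
have [d d0 hd] := riemann_sum_uniform fi C0 (divr_gt0 e0 (ltr0n R 2)).
(* The three bounds on [n] make the set of nodes nonempty, bring the mesh [3 / n] below [d], and
   make the cost [B * C * (2 / n)] of replacing cell lengths by [1 / n] at most [e / 2]. *)
pose M := Num.max (b - a)^-1 (Num.max (3 / d) (B * C * 4 / e)).
exists (Num.truncn M).+1 => n Mn rho rhoC.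
have n0 : (0 < n)%N by exact: leq_trans Mn.
have n0' : 0 < n%:R :> R by rewrite ltr0n.
have : M <= n%:R by rewrite (le_trans (ltW (truncnS_gt _)))// ler_nat.
rewrite !ge_max => /and3P[M1 M2 M3].
have [x [xn S]] := node_partition n0 M1.
have k1 := hd _ rhoC _ _ _ (tagged_partition_mesh (_ : 3 / n%:R <= d) xn).
have {k1} /k1 k1 : 3 / n%:R <= d.
  by rewrite ler_pdivrMr// mulrC -ler_pdivrMr.
have k2 : `|\sum_(i < nb_obs a b n) f (node a n i) * rho (node a n i) / n%:R -
    riemann_sum (fun v => f v * rho v) (nb_obs a b n) x (node a n)| <= e / 2.
  rewrite distrC /riemann_sum -sumrB (le_trans (ler_norm_sum _ _ _))//.
  apply: (@le_trans _ _ (\sum_(i < nb_obs a b n) B * C * `|(x i.+1 - x i) - n%:R^-1|)).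
    apply: ler_sum => i _; rewrite -mulrBr normrM ler_wpM2r// normrM.
    have iab := tagged_partition_tag xn (ltn_ord i).
    by rewrite ler_pM// ?fB//; exact: rhoC.1.
  rewrite -mulr_sumr; apply: (@le_trans _ _ (B * C * (2 / n%:R))).
    by rewrite ler_wpM2l// mulr_ge0// ltW.
  move: M3; rewrite ler_pdivrMr// mulrA ler_pdivrMr// => M3.
  have -> : e / 2 * n%:R = n%:R * e / 2 by ring.
  by lra.
have := ler_distD (riemann_sum (fun v => f v * rho v) (nb_obs a b n) x (node a n))
  (\sum_(i < nb_obs a b n) f (node a n i) * rho (node a n i) / n%:R)
  (riemann_integral (fun v => f v * rho v) a b).
by lra.
Qed.

End nodes.

End riemann.

(** * Bounded random variables and independence *)

Section bounded_random_variables.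
Context d (T : measurableType d) (R : realType) (P : probability T R).
Implicit Types (f g : T -> R) (A : set T).

(** Bounded variables are integrable and stable under all the operations used, which makes the mean
    linear without further integrability conditions. *)
Definition bounded_rv (f : T -> R) : Prop :=
  measurable_fun [set: T] f /\ exists C, forall w, `|f w| <= C.

Lemma bounded_rv_integrable f : bounded_rv f -> P.-integrable setT (EFin \o f).
Proof.
move=> [mf [C fC]]; apply: measurable_bounded_integrable => //.
  by apply: (le_lt_trans (probability_le1 P measurableT)); rewrite ltry.
exists `|C|; split; first exact: num_real.
by move=> M CM w _ /=; rewrite (le_trans (fC w))// (le_trans (ler_norm C))// ltW.
Qed.

Lemma bounded_rv_cst (c : R) : bounded_rv (fun=> c).
Proof. by split; [exact: measurable_cst|exists `|c|]. Qed.

Lemma bounded_rvD f g : bounded_rv f -> bounded_rv g ->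
  bounded_rv (fun w => f w + g w).
Proof.
move=> [mf [C fC]] [mg [D gD]]; split; first exact: measurable_funD.
by exists (C + D) => w; rewrite (le_trans (ler_normD _ _))// lerD.
Qed.

Lemma bounded_rvM f g : bounded_rv f -> bounded_rv g ->
  bounded_rv (fun w => f w * g w).
Proof.
move=> [mf [C fC]] [mg [D gD]]; split; first exact: measurable_funM.
by exists (C * D) => w; rewrite normrM ler_pM.
Qed.

Lemma bounded_rvZ (c : R) f : bounded_rv f -> bounded_rv (fun w => c * f w).
Proof. by move=> bf; apply: bounded_rvM => //; exact: bounded_rv_cst. Qed.

Lemma bounded_rvN f : bounded_rv f -> bounded_rv (fun w => - f w).
Proof.
move=> bf; have := bounded_rvZ (-1) bf.
by congr bounded_rv; apply/funext => w; rewrite mulN1r.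
Qed.

Lemma bounded_rvB f g : bounded_rv f -> bounded_rv g ->
  bounded_rv (fun w => f w - g w).
Proof. by move=> bf bg; apply: bounded_rvD => //; exact: bounded_rvN. Qed.

Lemma bounded_rv_sum (I : Type) (r : seq I) (Q : pred I) (F : I -> T -> R) :
  (forall i, Q i -> bounded_rv (F i)) ->
  bounded_rv (fun w => \sum_(i <- r | Q i) F i w).
Proof.
move=> bF; elim: r => [|i r IH].
  have := bounded_rv_cst 0; congr bounded_rv; apply/funext => w.
  by rewrite big_nil.
have [Qi|Qi] := boolP (Q i).
  have := bounded_rvD (bF _ Qi) IH; congr bounded_rv; apply/funext => w.
  by rewrite big_cons Qi.
move: IH; congr bounded_rv; apply/funext => w.
by rewrite big_cons (negbTE Qi).
Qed.

Lemma bounded_rv_indic A : measurable A -> bounded_rv (\1_A : T -> R).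
Proof.
move=> mA; split; first exact: measurable_indic.
by exists 1 => w; rewrite indicE; case: (w \in A); rewrite ?normr1 ?normr0.
Qed.

Lemma bounded_rv_sqr f : bounded_rv f -> bounded_rv (fun w => f w ^+ 2).
Proof.
by move=> bf; have := bounded_rvM bf bf; congr bounded_rv; apply/funext => w.
Qed.

Lemma bounded_rv_norm f : bounded_rv f -> bounded_rv (fun w => `|f w|).
Proof.
move=> [mf [C fC]]; split; first exact: measurableT_comp.
by exists C => w; rewrite normr_id.
Qed.

Lemma bounded_rv_comp (psi : R -> R) f : measurable_fun [set: R] psi ->
  (forall M, exists C, forall x, `|x| <= M -> `|psi x| <= C) ->
  bounded_rv f -> bounded_rv (fun w => psi (f w)).
Proof.
move=> mpsi bpsi [mf [M fM]]; split; first exact: measurableT_comp.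
by have [C psiC] := bpsi M; exists C => w; exact: psiC.
Qed.

Lemma meanD f g : bounded_rv f -> bounded_rv g ->
  \int[P]_w (f w + g w) = \int[P]_w f w + \int[P]_w g w.
Proof. by move=> bf bg; rewrite RintegralD//; exact: bounded_rv_integrable. Qed.

Lemma meanB f g : bounded_rv f -> bounded_rv g ->
  \int[P]_w (f w - g w) = \int[P]_w f w - \int[P]_w g w.
Proof. by move=> bf bg; rewrite RintegralB//; exact: bounded_rv_integrable. Qed.

Lemma meanZ (c : R) f : bounded_rv f -> \int[P]_w (c * f w) = c * \int[P]_w f w.
Proof. by move=> bf; rewrite RintegralZl//; exact: bounded_rv_integrable. Qed.

Lemma mean_cst (c : R) : \int[P]_w c = c.
Proof.
rewrite /Rintegral integral_cst//.
transitivity (fine (c%:E * 1)%E); last by rewrite mule1.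
by congr (fine (_ * _)%E); exact: probability_setT.
Qed.

Lemma mean_sum (I : Type) (r : seq I) (Q : pred I) (F : I -> T -> R) :
  (forall i, Q i -> bounded_rv (F i)) ->
  \int[P]_w (\sum_(i <- r | Q i) F i w) = \sum_(i <- r | Q i) \int[P]_w F i w.
Proof.
move=> bF; elim: r => [|i r IH].
  by rewrite big_nil -[RHS](mean_cst 0); apply: eq_Rintegral => w _; rewrite big_nil.
rewrite big_cons; have [Qi|Qi] := boolP (Q i).
  rewrite -IH -meanD//; [|exact: bF|exact: bounded_rv_sum].
  by apply: eq_Rintegral => w _; rewrite big_cons Qi.
by rewrite -IH; apply: eq_Rintegral => w _; rewrite big_cons (negbTE Qi).
Qed.

Lemma ler_mean f g : bounded_rv f -> bounded_rv g -> (forall w, f w <= g w) ->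
  \int[P]_w f w <= \int[P]_w g w.
Proof.
by move=> bf bg fg; apply: le_Rintegral => //; exact: bounded_rv_integrable.
Qed.

Lemma ler_norm_mean f g : bounded_rv f -> bounded_rv g ->
  (forall w, `|f w| <= g w) -> `|\int[P]_w f w| <= \int[P]_w g w.
Proof.
move=> bf bg fg; apply: le_trans (le_normr_Rintegral _ _) _ => //.
  exact: bounded_rv_integrable.
by apply: ler_mean => //; exact: bounded_rv_norm.
Qed.

Lemma mean_indic A : measurable A -> \int[P]_w (\1_A w : R) = fine (P A).
Proof. by move=> mA; rewrite /Rintegral integral_indic// setIT. Qed.

Lemma measurable_ler f (t : R) : measurable_fun [set: T] f ->
  measurable [set w | t <= f w].
Proof.
move=> mf; have := mf measurableT _ (measurable_itv `[t, +oo[).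
by rewrite setTI; congr measurable; apply/seteqP; split => w /=; rewrite in_itv/= andbT.
Qed.

Lemma measurable_ltr f (t : R) : measurable_fun [set: T] f ->
  measurable [set w | t < f w].
Proof.
move=> mf; have := mf measurableT _ (measurable_itv `]t, +oo[).
by rewrite setTI; congr measurable; apply/seteqP; split => w /=; rewrite in_itv/= andbT.
Qed.

Lemma markov_bounded f t : bounded_rv f -> (forall w, 0 <= f w) -> 0 < t ->
  fine (P [set w | t <= f w]) <= (\int[P]_w f w) / t.
Proof.
move=> bf f0 t0; have mA := measurable_ler t (proj1 bf).
rewrite -mean_indic// ler_pdivlMr// mulrC -meanZ; last exact: bounded_rv_indic.
apply: ler_mean => //; first exact/bounded_rvZ/bounded_rv_indic.
move=> w; rewrite indicE; have [|_] := boolP (w \in _); last by rewrite mulr0.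
by rewrite inE/= mulr1.
Qed.

Lemma chebyshev_bounded f t : bounded_rv f -> 0 < t ->
  fine (P [set w | t <= `|f w|]) <= (\int[P]_w (f w ^+ 2)) / t ^+ 2.
Proof.
move=> bf t0.
have -> : [set w | t <= `|f w|] = [set w | t ^+ 2 <= f w ^+ 2].
  by apply/seteqP; split => w /=; rewrite -[f w ^+ 2]real_normK ?num_real// ler_sqr ?nnegrE// ltW.
apply: markov_bounded; [exact: bounded_rv_sqr| |by rewrite exprn_gt0].
by move=> w; exact: sqr_ge0.
Qed.

Lemma fine_prob_ge0 A : 0 <= fine (P A).
Proof. exact: fine_ge0. Qed.

Lemma fine_prob_le A B : measurable A -> measurable B -> A `<=` B ->
  fine (P A) <= fine (P B).
Proof.
move=> mA mB AB; apply: fine_le; rewrite ?fin_num_measure//.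
by apply: le_measure; rewrite ?inE.
Qed.

Lemma fine_prob_setU A B : measurable A -> measurable B ->
  fine (P (A `|` B)) <= fine (P A) + fine (P B).
Proof.
move=> mA mB; rewrite -fineD ?fin_num_measure//; apply: fine_le.
- by rewrite fin_num_measure//; exact: measurableU.
- by rewrite fin_numD !fin_num_measure.
- exact: measureU2.
Qed.

Lemma fine_probC A : measurable A -> fine (P (~` A)) = 1 - fine (P A).
Proof.
by move=> mA; rewrite probability_setC// fineB// fin_num_measure.
Qed.

End bounded_random_variables.

(** * Independence through finite-valued functions of the observations *)

Section independence.
Context d (T : measurableType d) (R : realType) (P : probability T R).
Variable X : nat -> {RV P >-> R}.
Hypothesis indepX : mutually_independent X.

Let measurable_bigcap (K : {fset nat}) (A : nat -> set R) :
  (forall i, i \in K -> measurable (A i)) ->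
  measurable (\bigcap_(i in [set` K]) (X i @^-1` A i)).
Proof.
move=> mA; apply: fin_bigcap_measurable => // i /= iK.
by rewrite -[X in measurable X]setTI; apply: measurable_funPT => //; exact: mA.
Qed.

Section finite_valued.
Variables (I : finType) (k : R -> I).
Hypothesis mk : forall i, measurable (k @^-1` [set i]).

(** A function of [k (X n w)] is a finite combination of indicators of level sets, whatever [v]
    is. *)
Lemma bounded_rv_finite (v : I -> R) n : bounded_rv (fun w => v (k (X n w))).
Proof.
have -> : (fun w => v (k (X n w))) =
    (fun w => \sum_i v i * \1_(X n @^-1` (k @^-1` [set i])) w).
  apply/funext => w; rewrite (bigD1 (k (X n w)))//= big1 ?addr0.
    by rewrite indicE mem_set// mulr1.
  move=> i ik; rewrite indicE memNset ?mulr0//= => E.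
  by rewrite E eqxx in ik.
apply: bounded_rv_sum => i _; apply/bounded_rvZ/bounded_rv_indic.
by rewrite -[X in measurable X]setTI; exact: measurable_funPT.
Qed.

Lemma bounded_rv_finite_sum (v : I -> R) (s : seq nat) :
  bounded_rv (fun w => \sum_(j <- s) v (k (X j w))).
Proof. by apply: bounded_rv_sum => j _; exact: bounded_rv_finite. Qed.

Definition locally_bounded (psi : R -> R) :=
  forall M, exists C, forall x, `|x| <= M -> `|psi x| <= C.

(* Conditioning on the value of [k (X j)] removes one summand at a time, so
   that only the product rule for events is needed. *)
Lemma indep_event_sum (v : I -> R) (s : seq nat) (K : {fset nat})
    (A : nat -> set R) (psi : R -> R) :
  uniq s -> (forall i, i \in K -> i \notin s) ->
  (forall i, i \in K -> measurable (A i)) ->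
  measurable_fun [set: R] psi -> locally_bounded psi ->
  \int[P]_w (\1_(\bigcap_(i in [set` K]) (X i @^-1` A i)) w *
             psi (\sum_(j <- s) v (k (X j w)))) =
  fine (P (\bigcap_(i in [set` K]) (X i @^-1` A i))) *
  \int[P]_w psi (\sum_(j <- s) v (k (X j w))).
Proof.
elim: s K A psi => [|j s IH] K A psi us Ks mA mpsi bpsi.
  under eq_Rintegral do rewrite big_nil mulrC.
  under [in RHS]eq_Rintegral do rewrite big_nil.
  rewrite mean_cst meanZ ?mean_indic 1?mulrC//; first exact: measurable_bigcap.
  exact/bounded_rv_indic/measurable_bigcap.
move: us => /= /andP[js us].
set E := \bigcap_(i in [set` K]) _.
pose B i := X j @^-1` (k @^-1` [set i]).
have mB i : measurable (B i).
  by rewrite -[X in measurable X]setTI; exact: measurable_funPT.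
pose psi' i x := psi (v i + x).
have mpsi' i : measurable_fun [set: R] (psi' i).
  by apply: measurableT_comp => //; exact: measurable_funD.
have bpsi' i : locally_bounded (psi' i).
  move=> M; have [C HC] := bpsi (`|v i| + M); exists C => x xM.
  by apply: HC; rewrite (le_trans (ler_normD _ _))// lerD2l.
have psiE w : psi (\sum_(j <- j :: s) v (k (X j w))) =
    \sum_i \1_(B i) w * psi' i (\sum_(j <- s) v (k (X j w))).
  rewrite [RHS](bigD1 (k (X j w)))//= [X in _ = _ + X]big1 ?addr0.
    by rewrite indicE mem_set// mul1r /psi' big_cons.
  move=> i ik; rewrite indicE memNset ?mul0r//= => Ei.
  by rewrite Ei eqxx in ik.
have bT i : bounded_rv (fun w => psi' i (\sum_(j <- s) v (k (X j w)))).
  by apply: (bounded_rv_comp (mpsi' i) (bpsi' i)); exact: bounded_rv_finite_sum.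
have b1 i : bounded_rv (\1_(B i) : T -> R) by exact: bounded_rv_indic.
have mE : measurable E by exact: measurable_bigcap.
have PB i : \int[P]_w (\1_(B i) w * psi' i (\sum_(j <- s) v (k (X j w)))) =
    fine (P (B i)) * \int[P]_w psi' i (\sum_(j <- s) v (k (X j w))).
  have := IH [fset j]%fset (fun=> k @^-1` [set i]) (psi' i).
  rewrite set_fset1 bigcap_set1; apply => //.
  by move=> l; rewrite inE => /eqP ->.
have PEB i : \int[P]_w (\1_E w * (\1_(B i) w * psi' i (\sum_(j <- s) v (k (X j w))))) =
    fine (P E) * (fine (P (B i)) * \int[P]_w psi' i (\sum_(j <- s) v (k (X j w)))).
  pose A' l := if l == j then k @^-1` [set i] else A l.
  have jK : j \notin K by apply/negP => /Ks; rewrite in_cons eqxx.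
  have A'K l : l \in K -> A' l = A l.
    by move=> lK; rewrite /A'; case: eqP => // lj; rewrite -lj lK in jK.
  have capE : \bigcap_(l in [set` (j |` K)%fset]) (X l @^-1` A' l) = B i `&` E.
    rewrite set_fsetU1 bigcap_setU1 /A' eqxx; congr (_ `&` _).
    by apply: eq_bigcapr => l /A'K; rewrite /A' => ->.
  have mA' l : l \in (j |` K)%fset -> measurable (A' l).
    rewrite !inE /A' => /orP[/eqP ->|lK]; first by rewrite eqxx.
    by case: eqP => // _; exact: mA.
  have := IH (j |` K)%fset A' (psi' i) us.
  rewrite capE => IH'.
  have -> : fine (P E) * (fine (P (B i)) *
      \int[P]_w psi' i (\sum_(j0 <- s) v (k (X j0 w)))) =
    fine (P (B i `&` E)) * \int[P]_w psi' i (\sum_(j0 <- s) v (k (X j0 w))).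
    rewrite mulrA; congr (_ * _).
    rewrite -capE indepX// big_fsetU1//= /A' eqxx -/(B i).
    have -> : (\prod_(l <- K) P (X l @^-1` (if l == j then k @^-1` [set i] else A l)))%E = P E.
      rewrite /E indepX//; apply: eq_big_seq => l lK.
      by rewrite -[if _ then _ else _]/(A' l) A'K.
    by rewrite fineM ?fin_num_measure// mulrC.
  rewrite -IH'//; last first.
    move=> l; rewrite !inE => /orP[/eqP ->//|/Ks].
    by rewrite in_cons negb_or => /andP[].
  by apply: eq_Rintegral => w _; rewrite indicI/= mulrA [\1_E w * _]mulrC.
under eq_Rintegral do rewrite psiE mulr_sumr.
under [in RHS]eq_Rintegral do rewrite psiE.
rewrite !mean_sum; last 2 first.
- by move=> i _; exact: bounded_rvM.
- move=> i _; apply: bounded_rvM; first exact: bounded_rv_indic.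
  exact: bounded_rvM.
by rewrite mulr_sumr; apply: eq_bigr => i _; rewrite PEB PB.
Qed.

(** Expanding [u] over the level sets of [k (X n)] reduces this to [indep_event_sum] with one index.
    It is the form that the leave-one-out argument uses: one summand against a function of the sum
    of the others. *)
Lemma indep_mean (u v : I -> R) (n : nat) (s : seq nat) (psi : R -> R) :
  uniq s -> n \notin s ->
  measurable_fun [set: R] psi -> locally_bounded psi ->
  \int[P]_w (u (k (X n w)) * psi (\sum_(j <- s) v (k (X j w)))) =
  \int[P]_w u (k (X n w)) * \int[P]_w psi (\sum_(j <- s) v (k (X j w))).
Proof.
move=> us ns mpsi bpsi.
pose B i := X n @^-1` (k @^-1` [set i]).
have mB i : measurable (B i).
  by rewrite -[X in measurable X]setTI; exact: measurable_funPT.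
have uE w : u (k (X n w)) = \sum_i u i * \1_(B i) w.
  rewrite (bigD1 (k (X n w)))//= big1 ?addr0.
    by rewrite indicE mem_set// mulr1.
  move=> i ik; rewrite indicE memNset ?mulr0//= => E.
  by rewrite E eqxx in ik.
have b1 i : bounded_rv (\1_(B i) : T -> R) by exact: bounded_rv_indic.
have bT : bounded_rv (fun w => psi (\sum_(j <- s) v (k (X j w)))).
  by apply: bounded_rv_comp => //; exact: bounded_rv_finite_sum.
under eq_Rintegral do rewrite uE mulr_suml.
under [X in _ = X * _]eq_Rintegral do rewrite uE.
rewrite !mean_sum; last 2 first.
- by move=> i _; exact: bounded_rvZ.
- by move=> i _; apply: bounded_rvM => //; exact: bounded_rvZ.
rewrite mulr_suml; apply: eq_bigr => i _.
rewrite meanZ// mean_indic//.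
have := @indep_event_sum v s [fset n]%fset (fun=> k @^-1` [set i]) psi us.
rewrite set_fset1 bigcap_set1 => IH.
rewrite -mulrA -IH//.
  rewrite -meanZ; last by apply: bounded_rvM; [exact: (b1 i)|exact: bT].
  by apply: eq_Rintegral => w _; rewrite mulrA.
by move=> l; rewrite inE => /eqP ->.
Qed.

Lemma indep_mean2 (u v : I -> R) (m n : nat) : m != n ->
  \int[P]_w (u (k (X m w)) * v (k (X n w))) =
  \int[P]_w u (k (X m w)) * \int[P]_w v (k (X n w)).
Proof.
move=> mn; have -> : \int[P]_w (u (k (X m w)) * v (k (X n w))) =
    \int[P]_w (u (k (X m w)) * id (\sum_(j <- [:: n]) v (k (X j w)))).
  by apply: eq_Rintegral => w _; rewrite big_seq1.
rewrite (@indep_mean u v m [:: n] id)//; last 2 first.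
- by rewrite inE.
- by move=> M; exists M.
by congr (_ * _); apply: eq_Rintegral => w _; rewrite big_seq1.
Qed.

Lemma mean_sqr_sum (u : I -> R) (n : nat) (s2 : R) :
  (forall i, (i < n)%N -> \int[P]_w u (k (X i w)) = 0) ->
  (forall i, (i < n)%N -> \int[P]_w (u (k (X i w)) ^+ 2) = s2) ->
  \int[P]_w ((\sum_(i < n) u (k (X i w))) ^+ 2) = n%:R * s2.
Proof.
move=> u0 u2.
have bu i : bounded_rv (fun w => u (k (X i w))) by exact: bounded_rv_finite.
have -> : \int[P]_w ((\sum_(i < n) u (k (X i w))) ^+ 2) =
  \int[P]_w (\sum_(i < n) \sum_(j < n) u (k (X i w)) * u (k (X j w))).
  apply: eq_Rintegral => w _; rewrite expr2 mulr_suml.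
  by apply: eq_bigr => i _; rewrite mulr_sumr.
rewrite mean_sum; last first.
  by move=> i _; apply: bounded_rv_sum => j _; exact: bounded_rvM.
have -> : n%:R * s2 = \sum_(i < n) s2 by rewrite sumr_const card_ord mulr_natl.
apply: eq_bigr => i _.
rewrite mean_sum; last by move=> j _; exact: bounded_rvM.
rewrite (bigD1 i)//= big1 ?addr0.
  by rewrite -(u2 i)//; apply: eq_Rintegral => w _; rewrite expr2.
by move=> j ji; rewrite indep_mean2 1?eq_sym// u0// mul0r.
Qed.

End finite_valued.
End independence.

(** * Stein's equation *)

Section calculus.
Context {R : realType}.
Implicit Types (f : R -> R) (a b : R).

Lemma is_derive_MVT f (f' : R -> R) a b : a <= b ->
  (forall x : R, a <= x <= b -> is_derive x 1 f (f' x)) ->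
  exists2 c, a <= c <= b & f b - f a = f' c * (b - a).
Proof.
move=> ab df.
have dfi x : x \in `]a, b[ -> is_derive x 1 f (f' x).
  by rewrite in_itv/= => /andP[h1 h2]; apply: df; rewrite !ltW.
have cf : {within `[a, b], continuous f}.
  apply: derivable_within_continuous => x; rewrite in_itv/= => xab.
  exact: (@ex_derive _ _ _ _ _ _ _ (df x xab)).
have [c + E] := MVT_segment ab dfi cf.
by rewrite in_itv/= => cab; exists c.
Qed.

Lemma is_derive_nondecreasing f (f' : R -> R) a b : a <= b ->
  (forall x : R, a <= x <= b -> is_derive x 1 f (f' x)) ->
  (forall x, a <= x <= b -> 0 <= f' x) -> f a <= f b.
Proof.
move=> ab df f'0; have [c cab E] := is_derive_MVT ab df.
by rewrite -subr_ge0 E mulr_ge0 ?f'0// subr_ge0.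
Qed.

Lemma is_derive_lipschitz f (f' : R -> R) a b C x y :
  (forall x : R, a <= x <= b -> is_derive x 1 f (f' x)) ->
  (forall x, a <= x <= b -> `|f' x| <= C) ->
  a <= x <= b -> a <= y <= b -> `|f x - f y| <= C * `|x - y|.
Proof.
move=> df f'C; wlog yx : x y / y <= x => [hw xab yab|/andP[ax xb] /andP[ay yb]].
  have [/hw->//|/ltW /hw] := leP y x.
  by rewrite distrC [X in _ * X]distrC; apply.
have [z /andP[yz zx]|z /andP[yz zx] ->] := @is_derive_MVT f f' y x yx.
  by apply: df; rewrite (le_trans ay)//= (le_trans zx).
by rewrite normrM ler_wpM2r// f'C// (le_trans ay)//= (le_trans zx).
Qed.

Lemma is_derive_continuous f (df x : R) : is_derive x 1 f df -> {for x, continuous f}.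
Proof. by move=> [h _]; apply: differentiable_continuous; apply/derivable1_diffP. Qed.

End calculus.

Section stein.
Context {R : realType}.
Variables (s : R) (h : R -> R).
Hypothesis s_gt0 : 0 < s.
Hypothesis h_continuous : continuous h.
Hypothesis h01 : forall x, 0 <= h x <= 1.

Local Notation mu := lebesgue_measure.
Local Notation p := (normal_pdf 0 s).
Let c := \int[mu]_x (h x * p x).
Let phi x := (h x - c) * p x.
Let H x := \int[mu]_(t in `]-oo, x]) phi t.

Let s_neq0 : s != 0. Proof. by rewrite gt_eqF. Qed.

Let p_gt0 x : 0 < p x.
Proof.
rewrite normal_pdfE//= mulr_gt0 ?normal_peak_gt0//; exact: expR_gt0.
Qed.

Let p_derive (x : R) : is_derive x 1 p (- x / s ^+ 2 * p x).
Proof.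
rewrite normal_pdfE//.
have -> : (fun x0 => normal_peak s * normal_fun 0 s x0) =
  (fun x0 => normal_peak s * expR (- (s ^+ 2 *+ 2)^-1 * x0 ^+ 2)).
  by apply/funext => y; rewrite /normal_fun subr0; congr (_ * expR _); rewrite mulrC mulrN mulNr.
have -> : - x / s ^+ 2 * (normal_peak s * normal_fun 0 s x) =
  normal_peak s *: (expR (- (s ^+ 2 *+ 2)^-1 * x ^+ 2) * (- (s ^+ 2 *+ 2)^-1 *: (2 * x))).
  rewrite /normal_fun subr0 /GRing.scale/=.
  have -> : - x ^+ 2 / (s ^+ 2 *+ 2) = - (s ^+ 2 *+ 2)^-1 * x ^+ 2.
    by rewrite mulrC mulrN mulNr.
  rewrite -mulr_natr; field.
  by rewrite s_neq0.
apply: is_deriveZ.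
apply: is_derive1_comp.
apply: is_deriveZ.
apply: is_derive_eq.
by rewrite /GRing.scale/= mulr1 mulr_natl.
Qed.

Let mp : measurable_fun [set: R] p.
Proof. exact: measurable_normal_pdf. Qed.

Let mh : measurable_fun [set: R] h.
Proof. exact: continuous_measurable_fun. Qed.

Let dom_integrable (g : R -> R) C D : measurable D -> measurable_fun [set: R] g ->
  (forall x, `|g x| <= C) -> mu.-integrable D (EFin \o (fun x => g x * p x)).
Proof.
move=> mD mg gC.
apply: (integrableS measurableT) => //.
apply: (@le_integrable _ _ R mu setT measurableT _ (fun x : R => C%:E * (p x)%:E)%E).
- by apply/measurable_EFinP; exact: measurable_funM.
- move=> x _; rewrite -EFinM /= lee_fin !normrM ler_wpM2r// (le_trans (gC x))//.
  exact: ler_norm.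
- by apply: integrableZl => //; exact: integrable_normal_pdf.
Qed.

Let int_p : \int[mu]_x p x = 1.
Proof. by rewrite /Rintegral integral_normal_pdf. Qed.

Let hp_integrable : mu.-integrable setT (EFin \o (fun x => h x * p x)).
Proof.
apply: (@dom_integrable h 1) => // x.
by have /andP[h0 h1] := h01 x; rewrite ger0_norm.
Qed.

Let c01 : 0 <= c <= 1.
Proof.
apply/andP; split.
  by apply: Rintegral_ge0 => x _; have /andP[h0 _] := h01 x; rewrite mulr_ge0// ltW.
rewrite -int_p; apply: le_Rintegral => //.
  exact: (integrable_normal_pdf 0 s).
by move=> x _; have /andP[_ h1] := h01 x; rewrite ler_piMl// ltW.
Qed.

Let hc1 x : `|h x - c| <= 1.
Proof.
have /andP[h0 h1] := h01 x; have /andP[c0 c1] := c01.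
by rewrite ler_norml; apply/andP; split; lra.
Qed.

Let phi_integrable D : measurable D -> mu.-integrable D (EFin \o phi).
Proof.
by move=> mD; apply: (@dom_integrable (fun x => h x - c) 1) => //; apply: measurable_funB; [exact: mh|exact: measurable_cst].
Qed.

Let phiE : phi = (fun x => h x * p x - c * p x).
Proof. by apply/funext => x; rewrite /phi mulrBl. Qed.

Let int_phi : \int[mu]_x phi x = 0.
Proof.
have ip := integrable_normal_pdf 0 s.
rewrite phiE RintegralB//.
  by rewrite (RintegralZl _ measurableT ip) int_p mulr1 subrr.
by apply: (@dom_integrable (fun=> c) `|c|).
Qed.

Let H_derive (x : R) : is_derive x 1 H (phi x).
Proof.
have [||||dH HE] := @continuous_FTC1 R phi -oo%O x (x + 1).
- by rewrite ltrDl.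
- exact: phi_integrable.
- by rewrite ltNyr.
- apply: cvgM; first by apply: cvgB; [exact: h_continuous|exact: cvg_cst].
  exact: continuous_normal_pdf.
apply: DeriveDef; [exact: dH|by rewrite -derive1E; exact: HE].
Qed.

Let nuE A : measurable A -> fine (normal_prob 0 s A) = \int[mu]_(t in A) p t.
Proof. by []. Qed.

Let H_le A : measurable A ->
  `|\int[mu]_(t in A) phi t| <= fine (normal_prob 0 s A).
Proof.
move=> mA; rewrite nuE//.
apply: le_trans (le_normr_Rintegral _ _) _ => //; first exact: phi_integrable.
apply: le_Rintegral => //.
- have := phi_integrable mA => /integrable_norm.
  by [].
- by apply: (integrableS measurableT) => //; exact: integrable_normal_pdf.
- by move=> x _; rewrite normrM (gtr0_norm (p_gt0 x)) ler_piMl// ltW.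
Qed.

(** As a random variable under the normal law, the identity gives access to the limits of
    distribution functions at the infinities, hence to the tails of the normal density. *)
Let idTR : measurableTypeR R -> R := idfun.

#[local] HB.instance Definition _ :=
  @isMeasurableFun.Build _ _ _ _ idTR (@measurable_id _ _ setT).

Let nu : probability (measurableTypeR R) R := normal_prob 0 s.

Let H_Ny (e : R) : 0 < e -> exists M, forall x, x <= M -> `|H x| <= e.
Proof.
move=> e0.
have /fine_cvgP[_ /cvgrPdist_le /(_ _ e0) [M [_ hM]]] :=
  cvg_cdfNy0 (idTR : {RV nu >-> R}).
exists (M - 1) => x xM.
have xM' : x < M by rewrite (le_lt_trans xM)// gtrBl.
have := hM _ xM'; rewrite /= sub0r normrN.
apply: le_trans.
apply: le_trans (H_le (measurable_itv _)) _.
apply: le_trans (ler_norm _).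
by rewrite /cdf /distribution/= /pushforward preimage_id.
Qed.

(** [c] is the normal mean of [h], so [phi] has total integral 0 and its left primitive is minus its
    right one. This is why [H] vanishes at both infinities. *)
Let HE x : H x = - \int[mu]_(t in `]x, +oo[) phi t.
Proof.
have := @Rintegral_itvB R phi -oo%O +oo%O x.
rewrite set_itvNyy => /(_ (phi_integrable measurableT)).
rewrite int_phi sub0r => <- //.
by rewrite opprK.
Qed.

Let H_y (e : R) : 0 < e -> exists M, forall x, M <= x -> `|H x| <= e.
Proof.
move=> e0.
have /fine_cvgP[_ /cvgrPdist_le /(_ _ e0) [M [_ hM]]] :=
  cvg_cdfy1 (idTR : {RV nu >-> R}).
exists (M + 1) => x xM.
have xM' : M < x by rewrite (lt_le_trans _ xM)// ltrDl.
have := hM _ xM'; rewrite /= .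
apply: le_trans.
rewrite HE normrN.
apply: le_trans (H_le (measurable_itv _)) _.
apply: le_trans (ler_norm _).
rewrite /cdf /distribution/= /pushforward preimage_id.
have -> : (`]x, +oo[ : set R)%classic = ~` (`]-oo, x]%classic).
  by rewrite setCitvl.
have := probability_setC nu (measurable_itv `]-oo, x]).
rewrite /nu /= => ->.
rewrite fineB//=.
exact: (fin_num_measure nu).
Qed.

Let tail_derive (e x : R) : x != 0 ->
  is_derive x 1 (fun y => s ^+ 2 * p y / y + e * H y)
    (- p x - s ^+ 2 * p x / x ^+ 2 + e * phi x).
Proof.
move=> x0.
have dV : is_derive x 1 (fun y : R => y^-1) (- x ^- 2).
  have := @is_deriveV R id x 1 1 x0 (is_derive_id _ _).
  by rewrite /GRing.scale/= mulr1.
have -> : - p x - s ^+ 2 * p x / x ^+ 2 + e * phi x =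
  (s ^+ 2 * p x) *: (- x ^- 2) + x^-1 *: (s ^+ 2 *: (- x / s ^+ 2 * p x)) + e *: phi x.
  rewrite /GRing.scale/=; field.
  by rewrite s_neq0.
apply: is_deriveD; last exact: is_deriveZ.
apply: is_deriveM; exact: is_deriveZ.
Qed.

(* Compares [H] with the Mills-ratio bound [s^2 p(x)/|x|]: both vanish at the
   infinities, and their derivatives are ordered. *)
Let H_tail (x : R) : x != 0 -> `|H x| <= s ^+ 2 * p x / `|x|.
Proof.
move=> x0.
have phip y : `|phi y| <= p y.
  by rewrite normrM (gtr0_norm (p_gt0 y)) ler_piMl// ltW.
(* [e] is a sign: 1 and -1 give the two sides of the absolute value. For [x < 0], where [|x| = - x],
   the comparison below is run with [- e] and the opposite overall sign. *)
suff K e : `|e| = 1 -> 0 <= s ^+ 2 * p x / `|x| + e * H x.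
  rewrite ler_norml; apply/andP; split.
    have := K 1; rewrite normr1 mul1r => /(_ erefl).
    by rewrite -lerBlDr sub0r lerNl.
  have := K (-1); rewrite normrN normr1 mulN1r => /(_ erefl).
  by rewrite subr_ge0.
move=> e1.
have pt y : 0 <= s ^+ 2 * p y by rewrite mulr_ge0 ?sqr_ge0// ltW.
have ephi y : `|e * phi y| <= p y by rewrite normrM e1 mul1r.
apply/ler_addgt0Pr => eps eps0; rewrite -lerBlDr sub0r.
have [x_gt0|x_lt0|] := ltgtP 0 x; last by move=> x00; rewrite -x00 eqxx in x0.
- have [M HM] := H_y eps0.
  pose y := Num.max x M.
  have xy : x <= y by rewrite le_max lexx.
  have HMy : `|H y| <= eps by apply: HM; rewrite le_max lexx orbT.
  have y0 : 0 < y by rewrite (lt_le_trans x_gt0).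
  rewrite (gtr0_norm x_gt0).
  apply: (@le_trans _ _ (s ^+ 2 * p y / y + e * H y)).
    apply: (@le_trans _ _ (e * H y)).
      have : `|e * H y| <= eps by rewrite normrM e1 mul1r.
      by rewrite ler_norml => /andP[].
    by rewrite lerDr divr_ge0// ltW.
  rewrite -lerN2.
  apply: (@is_derive_nondecreasing R (fun y => - (s ^+ 2 * p y / y + e * H y))
    (fun x => - (- p x - s ^+ 2 * p x / x ^+ 2 + e * phi x))); first exact: xy.
    move=> z /andP[xz zy]; apply: is_deriveN; apply: tail_derive.
    by rewrite gt_eqF// (lt_le_trans x_gt0).
  move=> z _; rewrite oppr_ge0.
  have := ephi z; rewrite ler_norml => /andP[_ h2].
  have : 0 <= s ^+ 2 * p z / z ^+ 2 by rewrite divr_ge0// sqr_ge0.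
  lra.
- have [M HM] := H_Ny eps0.
  pose y := Num.min x M.
  have xy : y <= x by rewrite ge_min lexx.
  have HMy : `|H y| <= eps by apply: HM; rewrite ge_min lexx orbT.
  have y0 : y < 0 by rewrite (le_lt_trans xy).
  rewrite (ltr0_norm x_lt0).
  have K1 : - eps <= - (s ^+ 2 * p y / y + (- e) * H y).
    apply: (@le_trans _ _ (e * H y)).
      have : `|e * H y| <= eps by rewrite normrM e1 mul1r.
      by rewrite ler_norml => /andP[].
    rewrite opprD mulNr opprK lerDr -mulrN -invrN divr_ge0//.
    by rewrite oppr_ge0 ltW.
  apply: (le_trans K1).
  have -> : s ^+ 2 * p x / - x + e * H x = - (s ^+ 2 * p x / x + - e * H x).
    by rewrite invrN; ring.
  apply: (@is_derive_nondecreasing R (fun y => - (s ^+ 2 * p y / y + (- e) * H y))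
    (fun x => - (- p x - s ^+ 2 * p x / x ^+ 2 + (- e) * phi x))); first exact: xy.
    move=> z /andP[xz zy]; apply: is_deriveN; apply: tail_derive.
    by rewrite lt_eqF// (le_lt_trans zy).
  move=> z _; rewrite oppr_ge0.
  have := ephi z; rewrite ler_norml => /andP[h1 _].
  have : 0 <= s ^+ 2 * p z / z ^+ 2 by rewrite divr_ge0// sqr_ge0.
  lra.
Qed.

(** Since [p' = - x / s ^+ 2 * p], multiplying the equation by [p] turns it into
    [(s ^+ 2 * p * f)' = phi], whence [f = H / (s ^+ 2 * p)]. The tail bound on [H] says exactly
    that [|x * f x| <= 1]. The equation then bounds [f']; [f] itself is at most 1 for [|x| >= 1] and
    is bounded from [f 0] by its slope elsewhere. *)
Lemma stein_solution : exists (f f' : R -> R) (C : R),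
  [/\ forall x : R, is_derive x 1 f (f' x), continuous f',
      forall x, `|f x| <= C /\ `|f' x| <= C &
      forall x, s ^+ 2 * f' x - x * f x = h x - c].
Proof.
pose f x := H x / (s ^+ 2 * p x).
pose f' x := (h x - c + x * f x) / s ^+ 2.
have s2 : s ^+ 2 != 0 by rewrite expf_neq0.
have sp x : s ^+ 2 * p x != 0 by rewrite mulf_neq0// gt_eqF.
have df (x : R) : is_derive x 1 f (f' x).
  have dV : is_derive x 1 (fun y => (s ^+ 2 * p y)^-1)
      (- (s ^+ 2 * p x) ^- 2 *: (s ^+ 2 *: (- x / s ^+ 2 * p x))).
    by apply: is_deriveV => //; apply: is_deriveZ.
  have -> : f' x = H x *: (- (s ^+ 2 * p x) ^- 2 *: (s ^+ 2 *: (- x / s ^+ 2 * p x)))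
     + (s ^+ 2 * p x)^-1 *: phi x.
    rewrite /f' /f /phi /GRing.scale/=; field.
    by rewrite s_neq0 gt_eqF.
  exact: is_deriveM.
have fc : continuous f by move=> x; exact: is_derive_continuous (df x).
have f'c : continuous f'.
  move=> x; apply: cvgM; last exact: cvg_cst.
  apply: cvgD; first by apply: cvgB; [exact: h_continuous|exact: cvg_cst].
  by apply: cvgM; [exact: cvg_id|exact: fc].
have xf x : `|x * f x| <= 1.
  have [->|x0] := eqVneq x 0; first by rewrite mul0r normr0.
  rewrite /f mulrA normrM normrV ?unitfE// (ger0_norm (mulr_ge0 (sqr_ge0 s) (ltW (p_gt0 x)))).
  rewrite ler_pdivrMr ?mulr_gt0 ?exprn_gt0// mul1r normrM mulrC -ler_pdivlMr ?normr_gt0//.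
  exact: H_tail.
have f'C x : `|f' x| <= 2 / s ^+ 2.
  rewrite /f' normrM normrV ?unitfE// (ger0_norm (sqr_ge0 s)) ler_wpM2r ?invr_ge0 ?sqr_ge0//.
  rewrite (le_trans (ler_normD _ _))//.
  by have := hc1 x; have := xf x; lra.
have fC x : `|f x| <= `|f 0| + 2 / s ^+ 2 + 1.
  have s20 : 0 <= 2 / s ^+ 2 by rewrite divr_ge0// sqr_ge0.
  have [x1|x1] := leP 1 `|x|.
    have : `|f x| <= 1.
      by have := xf x; rewrite normrM; apply: le_trans; rewrite ler_peMl.
    by have := normr_ge0 (f 0); lra.
  have x1' : -1 <= x <= 1 by rewrite -ler_norml ltW.
  have : `|f x - f 0| <= 2 / s ^+ 2 * `|x - 0|.
    apply: (@is_derive_lipschitz R f f' (-1) 1) => //.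
    by apply/andP; split; lra.
  rewrite subr0 => K.
  have K2 : 2 / s ^+ 2 * `|x| <= 2 / s ^+ 2 by rewrite ler_piMr// ltW.
  have := ler_normD (f x - f 0) (f 0); rewrite subrK.
  lra.
exists f, f', (`|f 0| + 2 / s ^+ 2 + 1); split=> //.
  move=> x; split=> //; apply: (le_trans (f'C x)).
  by have := normr_ge0 (f 0); lra.
by move=> x; rewrite /f' mulrCA divff// mulr1 addrK.
Qed.

Lemma normal_prob_le_mean b : (forall x, x <= b -> h x = 1) ->
  (normal_prob 0 s `]-oo, b] <= c%:E)%E.
Proof.
move=> hb.
rewrite /c /Rintegral fineK; last exact: (integrable_fin_num measurableT hp_integrable).
rewrite /normal_prob [leLHS]integral_mkcond.
apply: ge0_le_integral => //=.
- move=> x _; rewrite patchE; case: ifPn => // _; by rewrite lee_fin ltW.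
- apply/(measurable_restrictT _ _).1 => //.
  by apply: measurable_funTS; apply/measurable_EFinP.
- by apply/measurable_EFinP; exact: measurable_funM.
- move=> x _; rewrite patchE; case: ifPn => [|_].
    by rewrite inE/= in_itv/= => /hb ->; rewrite mul1r.
  by rewrite lee_fin mulr_ge0 ?(ltW (p_gt0 _))//; have /andP[] := h01 x.
Qed.

Lemma mean_le_normal_prob b : (forall x, b < x -> h x = 0) ->
  (c%:E <= normal_prob 0 s `]-oo, b])%E.
Proof.
move=> hb.
rewrite /c /Rintegral fineK; last exact: (integrable_fin_num measurableT hp_integrable).
rewrite /normal_prob [leRHS]integral_mkcond.
apply: ge0_le_integral => //=.
- by move=> x _; rewrite lee_fin mulr_ge0 ?(ltW (p_gt0 _))//; have /andP[] := h01 x.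
- by apply/measurable_EFinP; exact: measurable_funM.
- apply/(measurable_restrictT _ _).1 => //.
  by apply: measurable_funTS; apply/measurable_EFinP.
- move=> x _; rewrite patchE; case: ifPn => [_|].
    by rewrite lee_fin ler_piMl ?(ltW (p_gt0 _))//; have /andP[] := h01 x.
  by rewrite notin_setE/= in_itv/= => /negP; rewrite -ltNge => /hb ->; rewrite mul0r.
Qed.

End stein.

(** * Central limit theorem for bounded triangular arrays *)

Section normal_law.
Context {R : realType}.
Local Notation mu := lebesgue_measure.

(** The mean of [h] under [normal_law 0 V], with the same separate branch for the point mass at
    0. *)
Definition normal_mean (V : R) (h : R -> R) : R :=
  if V == 0 then h 0 else \int[mu]_x (h x * normal_pdf 0 (Num.sqrt V) x).

(** Lipschitz substitute for the indicator of []-oo, x]]: 1 up to [x], 0 from [x + e] on, affine in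
    between. *)
Definition ramp (x e y : R) : R := Num.max 0 (Num.min 1 ((x + e - y) / e)).

Lemma ramp01 x e y : 0 <= ramp x e y <= 1.
Proof. by rewrite /ramp le_max lexx/= ge_max ler01 ge_min lexx. Qed.

Lemma ramp_eq1 x e y : 0 < e -> y <= x -> ramp x e y = 1.
Proof.
move=> e0 yx; rewrite /ramp (min_idPl _) ?(max_idPr _)//.
by rewrite ler_pdivlMr// mul1r; lra.
Qed.

Lemma ramp_eq0 x e y : 0 < e -> x + e < y -> ramp x e y = 0.
Proof.
move=> e0 xy; rewrite /ramp; apply/max_idPl; rewrite ge_min; apply/orP; right.
by rewrite pmulr_lle0 ?invr_gt0//; lra.
Qed.

Lemma ramp_lipschitz x e y z : 0 < e -> `|ramp x e y - ramp x e z| <= e^-1 * `|y - z|.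
Proof.
move=> e0.
have maxL (u v : R) : `|Num.max 0 u - Num.max 0 v| <= `|u - v|.
  have [u0|u0] := leP 0 u; have [v0|v0] := leP 0 v => //.
  - by rewrite subr0 ger0_norm// (le_trans _ (ler_norm _)); lra.
  - by rewrite sub0r normrN ger0_norm// distrC (le_trans _ (ler_norm _)); lra.
  - by rewrite subrr normr0.
have minL (u v : R) : `|Num.min 1 u - Num.min 1 v| <= `|u - v|.
  have [u0|u0] := leP 1 u; have [v0|v0] := leP 1 v => //.
  - by rewrite subrr normr0.
  - by rewrite gtr0_norm ?subr_gt0// (le_trans _ (ler_norm _)); lra.
  - by rewrite distrC gtr0_norm ?subr_gt0// distrC (le_trans _ (ler_norm _)); lra.
apply: le_trans (maxL _ _) _; apply: le_trans (minL _ _) _.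
rewrite -mulrBl normrM mulrC normfV (gtr0_norm e0).
apply: ler_wpM2l; first by rewrite invr_ge0 ltW.
have -> : x + e - y - (x + e - z) = - (y - z) by ring.
by rewrite normrN.
Qed.

Lemma lipschitz_continuous (h : R -> R) (L : R) :
  (forall y z, `|h y - h z| <= L * `|y - z|) -> continuous h.
Proof.
move=> hL y; apply/cvgrPdist_le => e e0.
have L0 : 0 < `|L| + 1 by rewrite ltr_wpDl.
near=> z; rewrite (le_trans (hL _ _))//.
apply: (@le_trans _ _ ((`|L| + 1) * `|y - z|)).
  by rewrite ler_wpM2r// (le_trans (ler_norm _))// lerDl.
rewrite mulrC -ler_pdivlMr//.
near: z; apply: cvgr_dist_le; first exact: cvg_id.
by rewrite divr_gt0.
Unshelve. all: by end_near. Qed.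

Lemma normal_law_le_mean (V x e : R) : 0 <= V -> 0 < e ->
  fine (normal_law 0 V `]-oo, x]%classic) <= normal_mean V (ramp x e).
Proof.
move=> V0 e0; rewrite /normal_law /normal_mean; have [_|Vn0] := eqVneq V 0.
  apply: (@le_trans _ _ ((0 : R) \in `]-oo, x]%classic)%:R); first exact: lexx.
  have [|_] := boolP (0 \in _).
    by rewrite inE/= in_itv/= => x0; rewrite ramp_eq1.
  by have /andP[] := ramp01 x e 0.
have V_gt0 : 0 < V by rewrite lt_neqAle eq_sym Vn0.
have sV : 0 < Num.sqrt V by rewrite sqrtr_gt0.
have hc := lipschitz_continuous (fun y z => ramp_lipschitz x y z e0).
rewrite -lee_fin fineK ?fin_num_measure//.
apply: (normal_prob_le_mean sV) => // [y|y yx].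
  exact: ramp01.
exact: ramp_eq1.
Qed.

Lemma normal_mean_le_law (V x e : R) : 0 <= V -> 0 < e ->
  normal_mean V (ramp x e) <= fine (normal_law 0 V `]-oo, (x + e)%R]%classic).
Proof.
move=> V0 e0; rewrite /normal_law /normal_mean; have [_|Vn0] := eqVneq V 0.
  apply: (@le_trans _ _ ((0 : R) \in `]-oo, (x + e)%R]%classic)%:R); last exact: lexx.
  have [_|] := boolP (0 \in _).
    by have /andP[] := ramp01 x e 0.
  rewrite notin_setE/= in_itv/= => /negP; rewrite -ltNge => x0.
  by rewrite ramp_eq0.
have V_gt0 : 0 < V by rewrite lt_neqAle eq_sym Vn0.
have sV : 0 < Num.sqrt V by rewrite sqrtr_gt0.
have hc := lipschitz_continuous (fun y z => ramp_lipschitz x y z e0).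
rewrite -lee_fin [leRHS]fineK ?fin_num_measure//.
apply: (mean_le_normal_prob sV) => // [y|y yx].
  exact: ramp01.
exact: ramp_eq0.
Qed.

End normal_law.

Section central_limit.
Context d (T : measurableType d) (R : realType) (P : probability T R).
Variable X : nat -> {RV P >-> R}.
Hypothesis indepX : mutually_independent X.

Definition normalized_sum (I : finType) (k : R -> I) (v : I -> R) n w : R :=
  (\sum_(i < n) v (k (X i w))) / Num.sqrt n%:R.

Section fixed_n.
Variables (I : finType) (k : R -> I).
Hypothesis mk : forall i, measurable (k @^-1` [set i]).
Variables (v : I -> R) (n : nat) (B s2 : R).
Hypothesis n_gt0 : (0 < n)%N.
Hypothesis vB : forall i, `|v i| <= B.
Hypothesis v0 : forall i, (i < n)%N -> \int[P]_w v (k (X i w)) = 0.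
Hypothesis v2 : forall i, (i < n)%N -> \int[P]_w (v (k (X i w)) ^+ 2) = s2.

Let r := Num.sqrt n%:R : R.
Let r_gt0 : 0 < r. Proof. by rewrite sqrtr_gt0 ltr0n. Qed.
Let rr : r * r = n%:R. Proof. by rewrite -expr2 sqr_sqrtr. Qed.

Local Notation W := (normalized_sum k v n).

Let xi i w := v (k (X i w)).
Let bxi i : bounded_rv (xi i). Proof. exact: (@bounded_rv_finite _ _ _ _ X _ _ mk). Qed.

Lemma bounded_rv_normalized_sum : bounded_rv W.
Proof.
have := bounded_rvZ (r^-1) (bounded_rv_sum (index_enum 'I_n) (Q := xpredT) (F := fun i => xi i) (fun i _ => bxi i)).
by congr bounded_rv; apply/funext => w; rewrite /normalized_sum mulrC.
Qed.

Lemma mean_sqr_normalized_sum : \int[P]_w (W w ^+ 2) = s2.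
Proof.
have bS : bounded_rv (fun w => \sum_(i < n) v (k (X i w))).
  by apply: bounded_rv_sum => i _; exact: bxi.
under eq_Rintegral do rewrite /normalized_sum exprMn mulrC.
rewrite meanZ; last exact: bounded_rv_sqr.
rewrite (mean_sqr_sum indepX mk v0 v2) exprVn expr2 rr mulKf//.
by rewrite pnatr_eq0 -lt0n.
Qed.

Lemma variance_le_sqr : s2 <= B ^+ 2.
Proof.
rewrite -(v2 n_gt0) -(mean_cst P (B ^+ 2)); apply: ler_mean.
- exact: (bounded_rv_sqr (bxi 0)).
- exact: bounded_rv_cst.
- move=> w; rewrite -[leLHS]real_normK ?num_real//.
  by rewrite ler_sqr ?nnegrE// (le_trans _ (vB (k (X 0 w)))).
Qed.

(** Without its term of index [i], [W] is independent of that term: [f] there contributes mean 0,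
    and from [f'] there the factor [s2] splits off. The mean value theorem expresses the difference
    through [f'] at points within [B / r] of [W]. Comparing two such values through [f' (W w)] costs
    [2 * D], whence [2 * B ^+ 2]; going back from the reduced sum to [W] inside [f'] costs [s2]. *)
Lemma stein_error (f f' : R -> R) (C K eta : R) :
  (forall x : R, is_derive x 1 f (f' x)) -> measurable_fun [set: R] f' ->
  (forall x, `|f x| <= C /\ `|f' x| <= C) -> 0 < K -> 0 <= eta ->
  (forall x y, `|x| <= K -> `|x - y| <= B / r -> `|f' x - f' y| <= eta) ->
  `|\int[P]_w (W w * f (W w)) - s2 * \int[P]_w f' (W w)| <=
  (2 * B ^+ 2 + s2) * (eta + 2 * C * (s2 / K ^+ 2)).
Proof.
move=> df mf' fC K0 eta0 f'eta.
have mf : measurable_fun [set: R] f.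
  by apply: continuous_measurable_fun => x; exact: is_derive_continuous (df x).
have C0 : 0 <= C by rewrite (le_trans _ (fC 0).1).
have B0 : 0 <= B by rewrite (le_trans _ (vB (k 0))).
have lf : locally_bounded f by move=> M; exists C => x _; exact: (fC x).1.
have lf' : locally_bounded f' by move=> M; exists C => x _; exact: (fC x).2.
have bW := bounded_rv_normalized_sum.
have bfW : bounded_rv (fun w => f (W w)) by exact: (bounded_rv_comp mf lf).
have bf'W : bounded_rv (fun w => f' (W w)) by exact: (bounded_rv_comp mf' lf').
(* Random modulus of [f'] around [W]: [eta] while [|W| < K], and the trivial [2 * C] added
   otherwise, on an event of probability at most [s2 / K ^+ 2] by Chebyshev's inequality. *)
pose D w := eta + 2 * C * \1_[set w | K ^+ 2 <= `|W w| ^+ 2] w.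
have mA : measurable [set w | K ^+ 2 <= `|W w| ^+ 2].
  apply: measurable_ler; have := bounded_rv_sqr (bounded_rv_norm bW).
  by case.
have bD : bounded_rv D.
  apply: bounded_rvD; first exact: bounded_rv_cst.
  exact/bounded_rvZ/bounded_rv_indic.
have D0 w : 0 <= D w.
  by rewrite addr_ge0// mulr_ge0 ?mulr_ge0//.
have ED : \int[P]_w D w <= eta + 2 * C * (s2 / K ^+ 2).
  rewrite meanD; [|exact: bounded_rv_cst|exact/bounded_rvZ/bounded_rv_indic].
  rewrite mean_cst meanZ ?mean_indic//; last exact: bounded_rv_indic.
  rewrite lerD2l ler_wpM2l ?mulr_ge0//.
  have -> : [set w | K ^+ 2 <= `|W w| ^+ 2] = [set w | K <= `|W w|].
    by apply/seteqP; split => w /=; rewrite ler_sqr ?nnegrE// ltW.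
  by rewrite -mean_sqr_normalized_sum; exact: chebyshev_bounded.
have f'D w y : `|W w - y| <= B / r -> `|f' (W w) - f' y| <= D w.
  move=> Wy; rewrite /D indicE; have [_|] := boolP (w \in _).
    rewrite mulr1 (le_trans (ler_normB _ _))// (le_trans (lerD (fC _).2 (fC _).2))//.
    by rewrite -mulr2n mulr_natl lerDr.
  rewrite notin_setE/= mulr0 addr0 => /negP; rewrite -ltNge => WK; apply: f'eta => //.
  by move: WK; rewrite ltr_sqr ?nnegrE ?normr_ge0 ?(ltW K0)// => /ltW.
pose s i := rem i (iota 0 n).
pose Wi i w := (\sum_(j <- s i) xi j w) / r.
have WE i w : (i < n)%N -> W w = Wi i w + xi i w / r.
  move=> i_n; rewrite /normalized_sum /Wi -/r -mulrDl; congr (_ / _).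
  rewrite -(big_mkord xpredT (fun i => v (k (X i w)))) /index_iota subn0.
  by rewrite (big_rem i)/= ?mem_iota//= addrC.
have us i : uniq (s i) by exact/rem_uniq/iota_uniq.
have is_ i : i \notin s i by rewrite mem_rem_uniqF// iota_uniq.
have Wxi i w : (i < n)%N -> `|W w - Wi i w| <= B / r.
  move=> i_n; rewrite (WE i w i_n) addrAC subrr add0r normrM normfV (gtr0_norm r_gt0).
  by rewrite ler_wpM2r ?invr_ge0 ?(ltW r_gt0)//; exact: vB.
have bWi i : bounded_rv (Wi i).
  have := bounded_rvZ (r^-1) (bounded_rv_sum (s i) (Q := xpredT) (F := xi) (fun i _ => bxi i)).
  by congr bounded_rv; apply/funext => w; rewrite /Wi mulrC.
have bfWi i : bounded_rv (fun w => f (Wi i w)) by exact: (bounded_rv_comp mf lf).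
have bf'Wi i : bounded_rv (fun w => f' (Wi i w)) by exact: (bounded_rv_comp mf' lf').
pose psi (g : R -> R) (y : R) := g (y / r).
have mpsi g : measurable_fun [set: R] g -> measurable_fun [set: R] (psi g).
  by move=> mg; apply: measurableT_comp => //; exact: measurable_funM.
have bpsi g : locally_bounded g -> locally_bounded (psi g).
  move=> lg M; have [C1 h] := lg (M / r); exists C1 => y yM; apply: h.
  by rewrite normrM normfV (gtr0_norm r_gt0) ler_wpM2r ?invr_ge0 ?(ltW r_gt0).
have E1 i : (i < n)%N -> \int[P]_w (xi i w * f (Wi i w)) = 0.
  move=> i_n; have := indep_mean indepX mk v v (us i) (is_ i) (mpsi _ mf) (bpsi _ lf).
  by rewrite v0// mul0r.
have E2 i : (i < n)%N ->
    \int[P]_w (xi i w ^+ 2 * f' (Wi i w)) = s2 * \int[P]_w f' (Wi i w).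
  move=> i_n.
  have := indep_mean indepX mk (fun i => v i ^+ 2) v (us i) (is_ i) (mpsi _ mf') (bpsi _ lf').
  by rewrite v2.
have step i : (i < n)%N ->
  `|\int[P]_w (xi i w * f (W w)) - s2 / r * \int[P]_w f' (W w)| <=
    (2 * B ^+ 2 + s2) / r * \int[P]_w D w.
  move=> i_n.
  have K1 : `|\int[P]_w (xi i w * f (W w) - xi i w * f (Wi i w) -
                r^-1 * (xi i w ^+ 2 * f' (Wi i w)))| <=
            \int[P]_w (2 * B ^+ 2 / r * D w).
    apply: ler_norm_mean.
    - apply: bounded_rvB; first by apply: bounded_rvB; exact: bounded_rvM.
      by apply: bounded_rvZ; apply: bounded_rvM => //; exact: bounded_rv_sqr.
    - exact: bounded_rvZ.
    - move=> w.
      have [c cW cE] : exists2 c, `|W w - c| <= B / r & f (W w) - f (Wi i w) = f' c * (xi i w / r).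
        have Wd := Wxi i w i_n.
        have dE : xi i w / r = W w - Wi i w by rewrite (WE i w i_n) addrAC subrr add0r.
        have [WW|/ltW WW] := leP (Wi i w) (W w).
          have [c /andP[c1 c2] cE] := @is_derive_MVT _ f f' _ _ WW (fun x _ => df x).
          exists c; last by rewrite cE dE.
          apply: le_trans Wd; rewrite !ger0_norm ?subr_ge0//.
          by rewrite lerD2l lerN2.
        have [c /andP[c1 c2] cE] := @is_derive_MVT _ f f' _ _ WW (fun x _ => df x).
        exists c; last by rewrite dE -opprB cE -mulrN opprB.
        apply: le_trans Wd; rewrite !ler0_norm ?subr_le0//.
        by rewrite lerN2 lerD2l lerN2.
      have -> : xi i w * f (W w) - xi i w * f (Wi i w) - r^-1 * (xi i w ^+ 2 * f' (Wi i w)) =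
         xi i w ^+ 2 / r * (f' c - f' (Wi i w)).
        by rewrite -mulrBr cE; ring.
      rewrite normrM normrM normrX normfV (gtr0_norm r_gt0).
      have -> : 2 * B ^+ 2 / r * D w = B ^+ 2 / r * (2 * D w) by ring.
      apply: ler_pM => //.
      + by rewrite mulr_ge0 ?invr_ge0 ?(ltW r_gt0).
      + rewrite ler_wpM2r ?invr_ge0 ?(ltW r_gt0)// lerXn2r ?nnegrE//.
        exact: vB.
      + have h1 := f'D w _ cW; have h2 := f'D w _ (Wxi i w i_n).
        have -> : f' c - f' (Wi i w) = (f' (W w) - f' (Wi i w)) - (f' (W w) - f' c) by ring.
        by rewrite (le_trans (ler_normB _ _))//; lra.
  have K2 : `|\int[P]_w (f' (W w) - f' (Wi i w))| <= \int[P]_w D w.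
    apply: ler_norm_mean => //; first exact: bounded_rvB.
    by move=> w; apply: f'D; exact: Wxi.
  have K1E : \int[P]_w (xi i w * f (W w) - xi i w * f (Wi i w) -
                r^-1 * (xi i w ^+ 2 * f' (Wi i w))) =
     \int[P]_w (xi i w * f (W w)) - r^-1 * (s2 * \int[P]_w f' (Wi i w)).
    rewrite meanB; last 2 first.
    - by apply: bounded_rvB; exact: bounded_rvM.
    - by apply: bounded_rvZ; apply: bounded_rvM => //; exact: bounded_rv_sqr.
    rewrite meanB; [|exact: bounded_rvM|exact: bounded_rvM].
    rewrite meanZ; last by apply: bounded_rvM => //; exact: bounded_rv_sqr.
    by rewrite E1// E2// subr0.
  rewrite K1E (meanZ P _ bD) in K1; rewrite meanB// in K2.
  have s20 : 0 <= s2.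
    by rewrite -(v2 i_n); apply: Rintegral_ge0 => w _; exact: sqr_ge0.
  set EA := \int[P]_w (xi i w * f (W w)) in K1 *.
  set EB := \int[P]_w f' (W w) in K2 *; set EC := \int[P]_w f' (Wi i w) in K1 K2.
  have -> : EA - s2 / r * EB = (EA - r^-1 * (s2 * EC)) - s2 / r * (EB - EC) by ring.
  rewrite (le_trans (ler_normB _ _))// normrM (ger0_norm (divr_ge0 s20 (ltW r_gt0))).
  have := ler_wpM2l (divr_ge0 s20 (ltW r_gt0)) K2.
  have -> : (2 * B ^+ 2 + s2) / r * (\int[P]_w D w) =
     2 * B ^+ 2 / r * (\int[P]_w D w) + s2 / r * (\int[P]_w D w) by ring.
  by lra.
have WfE : \int[P]_w (W w * f (W w)) = r^-1 * \sum_(i < n) \int[P]_w (xi i w * f (W w)).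
  rewrite -mean_sum; last by move=> i _; exact: bounded_rvM.
  rewrite -meanZ; last by apply: bounded_rv_sum => i _; exact: bounded_rvM.
  by apply: eq_Rintegral => w _; rewrite {1}/normalized_sum -/r mulrAC mulr_suml mulrC.
have s2E : s2 * \int[P]_w f' (W w) = r^-1 * \sum_(i < n) (s2 / r * \int[P]_w f' (W w)).
  rewrite sumr_const card_ord -mulr_natr -rr; field.
  by rewrite gt_eqF.
rewrite WfE s2E -mulrBr -sumrB normrM normfV (gtr0_norm r_gt0).
rewrite mulrC ler_pdivrMr//.
apply: (@le_trans _ _ (\sum_(i < n) (2 * B ^+ 2 + s2) / r * \int[P]_w D w)).
  by rewrite (le_trans (ler_norm_sum _ _ _))//; apply: ler_sum => i _; exact: step.
rewrite sumr_const card_ord -[X in X <= _]mulr_natr -rr.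
have s20 : 0 <= s2.
  by rewrite -(v2 n_gt0); apply: Rintegral_ge0 => w _; exact: sqr_ge0.
have -> : (2 * B ^+ 2 + s2) / r * \int[P]_w D w * (r * r) =
   (2 * B ^+ 2 + s2) * \int[P]_w D w * r by field; rewrite gt_eqF.
rewrite ler_wpM2r ?(ltW r_gt0)// ler_wpM2l//.
by rewrite addr_ge0// mulr_ge0// sqr_ge0.
Qed.

End fixed_n.

Section triangular_array.
Variables (I : nat -> finType) (k : forall n, R -> I n) (v : forall n, I n -> R).
Arguments k : clear implicits.
Arguments v : clear implicits.
Hypothesis mk : forall n i, measurable (k n @^-1` [set i]).
Variables (B V : R) (s2 : nat -> R) (N0 : nat).
Hypothesis B_gt0 : 0 < B.
Hypothesis vB : forall n, (N0 <= n)%N -> forall i, `|v n i| <= B.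
Hypothesis v0 : forall n, (N0 <= n)%N -> forall i, (i < n)%N -> \int[P]_w v n (k n (X i w)) = 0.
Hypothesis v2 : forall n, (N0 <= n)%N -> forall i, (i < n)%N ->
  \int[P]_w (v n (k n (X i w)) ^+ 2) = s2 n.
Hypothesis s2V : s2 n @[n --> \oo] --> V.

Local Notation W n := (normalized_sum (k n) (v n) n).

Let V_ge0 : 0 <= V.
Proof.
rewrite -(cvg_lim _ s2V)//; apply: limr_ge; first by apply/cvg_ex; exists V.
exists N0.+1 => // n /= Nn.
rewrite -(@v2 n (ltnW Nn) 0%N (leq_trans _ Nn))//; apply: Rintegral_ge0 => w _.
exact: sqr_ge0.
Qed.

(** For [V > 0] the equation is solved once, with the limit variance, so that [f] does not depend on
    [n]; the error is [V - s2 n] times a bounded mean, plus the leave-one-out error with variance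
    [s2 n]. For [V = 0] the second moment tends to 0. *)
Lemma clt_mean (h : R -> R) (L e : R) : (forall x, 0 <= h x <= 1) -> 0 < L ->
  (forall y z, `|h y - h z| <= L * `|y - z|) -> 0 < e ->
  exists N, forall n, (N <= n)%N -> `|\int[P]_w h (W n w) - normal_mean V h| <= e.
Proof.
move=> h01 L0 hL e0.
have hc := lipschitz_continuous hL.
have mh : measurable_fun [set: R] h by exact: continuous_measurable_fun.
have lh : locally_bounded h.
  by move=> M; exists 1 => x _; have /andP[? ?] := h01 x; rewrite ger0_norm.
have bW n : bounded_rv (W n) by exact: (bounded_rv_normalized_sum (@mk n)).
have bhW n : bounded_rv (fun w => h (W n w)) by exact: (bounded_rv_comp mh lh).
rewrite /normal_mean; have [V0|Vn0] := eqVneq V 0.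
  pose eta := e / (2 * L).
  have eta0 : 0 < eta by rewrite divr_gt0// mulr_gt0.
  have e1 : 0 < e * eta / (2 * L) by rewrite divr_gt0// mulr_gt0.
  move: s2V => /cvgrPdist_le /(_ _ e1) [N1 _ HN1].
  exists (maxn N0.+1 N1) => n; rewrite geq_max => /andP[Nn N1n].
  have n0 : (0 < n)%N by rewrite (leq_trans _ Nn).
  have := HN1 n N1n; rewrite /= V0 sub0r normrN => s2e.
  have W2 := mean_sqr_normalized_sum (@mk n) n0 (@v0 n (ltnW Nn)) (@v2 n (ltnW Nn)).
  rewrite -(mean_cst P (h 0)) -meanB//; last exact: bounded_rv_cst.
  (* [|x| <= eta + eta^-1 * x ^+ 2] passes from the first moment to the second; [eta] is such that
     [L * eta = e / 2]. *)
  apply: (@le_trans _ _ (\int[P]_w (L * (eta + eta^-1 * W n w ^+ 2)))).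
    apply: ler_norm_mean.
    - by apply: bounded_rvB => //; exact: bounded_rv_cst.
    - apply: bounded_rvZ; apply: bounded_rvD; first exact: bounded_rv_cst.
      exact/bounded_rvZ/bounded_rv_sqr.
    move=> w; rewrite (le_trans (hL _ _))// subr0 ler_wpM2l ?(ltW L0)//.
    have [We|We] := leP `|W n w| eta.
      by rewrite (le_trans We)// lerDl mulr_ge0 ?sqr_ge0// invr_ge0 ltW.
    apply: (@le_trans _ _ (eta^-1 * W n w ^+ 2)); last by rewrite lerDr ltW.
    rewrite mulrC ler_pdivlMr// -[W n w ^+ 2]real_normK ?num_real// expr2.
    by rewrite ler_wpM2l// ltW.
  rewrite meanZ; last first.
    apply: bounded_rvD; first exact: bounded_rv_cst.
    exact/bounded_rvZ/bounded_rv_sqr.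
  rewrite meanD; [|exact: bounded_rv_cst|exact/bounded_rvZ/bounded_rv_sqr].
  rewrite mean_cst meanZ; last exact: bounded_rv_sqr.
  rewrite W2 mulrDr.
  have -> : L * eta = e / 2 by rewrite /eta; field; rewrite gt_eqF.
  have : L * (eta^-1 * s2 n) <= L * (eta^-1 * (e * eta / (2 * L))).
    rewrite ler_wpM2l ?(ltW L0)// ler_wpM2l ?invr_ge0 ?(ltW eta0)//.
    exact: le_trans (ler_norm _) s2e.
  have -> : L * (eta^-1 * (e * eta / (2 * L))) = e / 2.
    by field; rewrite !gt_eqF.
  by lra.
have V_gt0 : 0 < V by rewrite lt_neqAle eq_sym Vn0.
have sV0 : 0 < Num.sqrt V by rewrite sqrtr_gt0.
have [f [f' [C [df f'c fC fE]]]] := stein_solution sV0 hc h01.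
set c := \int[_]_x _ in fE *.
rewrite sqr_sqrtr ?(ltW V_gt0)// in fE.
have C0 : 0 <= C by rewrite (le_trans _ (fC 0).1).
have mf : measurable_fun [set: R] f.
  by apply: continuous_measurable_fun => x; exact: is_derive_continuous (df x).
have mf' : measurable_fun [set: R] f' by exact: continuous_measurable_fun.
have lf : locally_bounded f by move=> M; exists C => x _; exact: (fC x).1.
have lf' : locally_bounded f' by move=> M; exists C => x _; exact: (fC x).2.
have bfW n : bounded_rv (fun w => f (W n w)) by exact: (bounded_rv_comp mf lf).
have bf'W n : bounded_rv (fun w => f' (W n w)) by exact: (bounded_rv_comp mf' lf').
have fL x y : `|f x - f y| <= C * `|x - y|.
  apply: (@is_derive_lipschitz R f f' (Num.min x y) (Num.max x y)) => //.
  - by move=> z _; exact: (fC z).2.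
  - by rewrite ge_min lexx le_max lexx.
  - by rewrite ge_min lexx le_max lexx !orbT.
(* Makes the contribution [6 * B ^+ 4 * C / K] of the event [K <= |W|] at most [e / 4]. *)
pose K := 1 + 24 * B ^+ 4 * C / e.
have B4 : 0 <= B ^+ 4 by rewrite exprn_even_ge0.
have K24 : 0 <= 24 * B ^+ 4 * C / e.
  apply: divr_ge0; last exact: ltW.
  apply: mulr_ge0; last exact: C0.
  apply: mulr_ge0; last exact: B4.
  exact: ler0n.
have K1 : 1 <= K by rewrite /K lerDl.
have K0 : 0 < K by rewrite (lt_le_trans ltr01).
have KE : K = 1 + 24 * B ^+ 4 * C / e by [].
clearbody K.
(* Lipschitz constant of [f'] from points of size at most [K], read off from the equation:
   [V * f' x] is [h x - c + x * f x], where [h] and [f] are Lipschitz and [f] is bounded. *)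
pose M := (L + K * C + C) / V.
have M0 : 0 < M by rewrite divr_gt0// -addrA ltr_wpDr// addr_ge0// mulr_ge0// ltW.
have f'L x y : `|x| <= K -> `|f' x - f' y| <= M * `|x - y|.
  move=> xK; rewrite /M mulrAC ler_pdivlMr// mulrC.
  rewrite -[in X in X * _](gtr0_norm V_gt0) -normrM mulrBr.
  have -> : V * f' x - V * f' y = (h x - h y) + x * (f x - f y) + (x - y) * f y.
    have := fE x; have := fE y; move: (V * f' x) (V * f' y) => A A' EA EA'.
    by rewrite -[A](subrK (x * f x)) EA' -[A'](subrK (y * f y)) EA; ring.
  have -> : (L + K * C + C) * `|x - y| =
      L * `|x - y| + K * (C * `|x - y|) + C * `|x - y| by ring.
  rewrite (le_trans (ler_normD _ _))// lerD//.
    rewrite (le_trans (ler_normD _ _))// lerD// normrM ler_pM//.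
  by rewrite normrM mulrC ler_wpM2r//; exact: (fC y).1.
pose eta := e / (12 * B ^+ 2).
have B2 : 0 < B ^+ 2 by rewrite exprn_gt0.
have eta0 : 0 < eta by rewrite divr_gt0// mulr_gt0.
have e1 : 0 < e / (4 * (C + 1)) by rewrite divr_gt0// mulr_gt0// ltr_wpDl.
move: s2V => /cvgrPdist_le /(_ _ e1) [N1 _ HN1].
pose N2 := (Num.truncn ((B * M / eta) ^+ 2)).+1.
exists (maxn N0.+1 (maxn N1 N2)) => n; rewrite !geq_max => /and3P[Nn N1n N2n].
have n0 : (0 < n)%N by rewrite (leq_trans _ Nn).
have n0' : 0 < n%:R :> R by rewrite ltr0n.
have rn0 : 0 < Num.sqrt n%:R :> R by rewrite sqrtr_gt0.
have BM0 : 0 <= B * M / eta by apply: divr_ge0; [apply: mulr_ge0; exact: ltW|exact: ltW].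
have Mr : M * (B / Num.sqrt n%:R) <= eta.
  rewrite mulrA ler_pdivrMr// mulrC -ler_pdivrMl// mulrC (mulrC M).
  rewrite [eta^-1 * _]mulrC -(ger0_norm BM0) -sqrtr_sqr ler_sqrt ?(ltW n0')//.
  apply: ltW.
  by rewrite (lt_le_trans (truncnS_gt _))// ler_nat.
have se := stein_error (@mk n) n0 (@vB n (ltnW Nn)) (@v0 n (ltnW Nn)) (@v2 n (ltnW Nn))
  df mf' fC K0 (ltW eta0).
have {}se := se (fun x y xK xy => le_trans (f'L x y xK) (le_trans (ler_wpM2l (ltW M0) xy) Mr)).
have s2B := variance_le_sqr (@mk n) n0 (@vB n (ltnW Nn)) (@v2 n (ltnW Nn)).
have s20 : 0 <= s2 n.
  by rewrite -(@v2 n (ltnW Nn) 0%N n0); apply: Rintegral_ge0 => w _; exact: sqr_ge0.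
have s2d := HN1 n N1n.
have -> : \int[P]_w h (W n w) - c =
    (V - s2 n) * \int[P]_w f' (W n w) -
    (\int[P]_w (W n w * f (W n w)) - s2 n * \int[P]_w f' (W n w)).
  rewrite -[X in _ - X](mean_cst P c) -meanB//; last exact: bounded_rv_cst.
  transitivity (\int[P]_w (V * f' (W n w) - W n w * f (W n w))).
    by apply: eq_Rintegral => w _; rewrite fE.
  rewrite meanB; [|exact: bounded_rvZ|exact: bounded_rvM].
  by rewrite meanZ//; ring.
have Ef' : `|\int[P]_w f' (W n w)| <= C.
  rewrite -(mean_cst P C); apply: ler_norm_mean => //; first exact: bounded_rv_cst.
  by move=> w; exact: (fC _).2.
rewrite (le_trans (ler_normB _ _))// normrM.
have T1 : `|V - s2 n| * `|\int[P]_w f' (W n w)| <= e / 4.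
  apply: (@le_trans _ _ (e / (4 * (C + 1)) * (C + 1))).
    by apply: ler_pM => //; rewrite (le_trans Ef')// lerDl.
  by rewrite le_eqVlt; apply/orP; left; apply/eqP; field; rewrite gt_eqF// ltr_wpDl.
have T2 : (2 * B ^+ 2 + s2 n) * (eta + 2 * C * (s2 n / K ^+ 2)) <= e / 2.
  apply: (@le_trans _ _ (3 * B ^+ 2 * (eta + 2 * C * (B ^+ 2 / K)))).
    apply: ler_pM.
    - by rewrite addr_ge0// mulr_ge0// ltW.
    - apply: addr_ge0; first exact: ltW.
      by apply: mulr_ge0; [exact: mulr_ge0|rewrite divr_ge0 ?sqr_ge0].
    - by lra.
    - rewrite lerD2l; apply: ler_wpM2l; first exact: mulr_ge0.
      apply: ler_pM => //; first by rewrite invr_ge0 sqr_ge0.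
      by rewrite lef_pV2 ?posrE ?exprn_gt0// expr2 ler_peMl// ltW.
  have -> : 3 * B ^+ 2 * (eta + 2 * C * (B ^+ 2 / K)) = e / 4 + 6 * B ^+ 4 * C / K.
    by rewrite /eta; field; rewrite !gt_eqF.
  have : 6 * B ^+ 4 * C / K <= e / 4.
    rewrite ler_pdivrMr// KE mulrDr.
    have -> : e / 4 * (24 * B ^+ 4 * C / e) = 6 * B ^+ 4 * C by field; rewrite gt_eqF.
    by rewrite lerDr mulr1 divr_ge0// ltW.
  by lra.
by have := le_trans se T2; lra.
Qed.

(** Two shifts by [e] are spent on each side, one for the event [e <= |Z - W|] and one for the width
    of the ramp. The limit law is thus evaluated at [x + 2 * e] and [x - 2 * e], where continuity at
    [x] applies. *)
Lemma clt_distribution (Z : nat -> T -> R) :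
  (forall n, measurable_fun [set: T] (Z n)) ->
  (forall e, 0 < e -> fine (P [set w | e <= `|Z n w - W n w|]) @[n --> \oo] --> 0) ->
  cvg_in_distribution P Z (normal_law 0 V).
Proof.
move=> mZ ZW; split=> // x cx.
set G := fun y : R => fine (normal_law 0 V `]-oo, y]%classic).
have bW n : bounded_rv (W n) by exact: (bounded_rv_normalized_sum (@mk n)).
have mle (Y : T -> R) y : measurable_fun [set: T] Y -> measurable [set w | Y w <= y].
  move=> mY; have := mY measurableT _ (measurable_itv `]-oo, y]).
  by rewrite setTI; congr measurable; apply/seteqP; split => w /=; rewrite in_itv/=.
suff H : fine (P [set w | Z n w <= x]) @[n --> \oo] --> G x.
  rewrite -[X in _ --> X]fineK ?fin_num_measure//.
  have -> : (fun n => P [set w | Z n w <= x]) = (fun n => (fine (P [set w | Z n w <= x]))%:E).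
    by apply/funext => n; rewrite fineK// fin_num_measure//; exact: mle.
  by apply/cvg_EFin; [near=> n|exact: H].
apply/cvgrPdist_le => eta eta0.
have : {for x, continuous G}.
  by apply: fine_cvg; rewrite /= fineK ?fin_num_measure.
move=> /cvgrPdist_le /(_ _ (divr_gt0 eta0 (ltr0n R 4))) /nbhs_ballP[e0 /= e00 He0].
pose e := e0 / 3.
have e_gt0 : 0 < e by rewrite divr_gt0.
have Gd y : `|x - y| <= 2 * e -> `|G x - G y| <= eta / 4.
  move=> xy; apply: He0; rewrite /ball/= (le_lt_trans xy)// /e.
  by have := e00 => /= e00'; lra.
have rL z := fun y y' => @ramp_lipschitz R z e y y' e_gt0.
have eV : 0 < e^-1 by rewrite invr_gt0.
have [N1 HN1] := clt_mean (fun y => ramp01 (x + e) e y) eV (rL (x + e)) (divr_gt0 eta0 (ltr0n R 4)).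
have [N2 HN2] := clt_mean (fun y => ramp01 (x - 2 * e) e y) eV (rL (x - 2 * e)) (divr_gt0 eta0 (ltr0n R 4)).
have /cvgrPdist_le /(_ _ (divr_gt0 eta0 (ltr0n R 4)))[N3 _ HN3] := ZW e e_gt0.
exists (maxn N1 (maxn N2 N3)) => // n /=; rewrite !geq_max => /and3P[N1n N2n N3n].
have {HN1}H1 := HN1 n N1n; have {HN2}H2 := HN2 n N2n.
have := HN3 n N3n; rewrite /= sub0r normrN => {HN3} H3.
have mD : measurable [set w | e <= `|Z n w - W n w|].
  apply: measurable_ler; apply: measurableT_comp => //.
  by apply: measurable_funB => //; exact: (bW n).1.
have mh z : measurable_fun [set: R] (ramp z e).
  by apply: continuous_measurable_fun; exact: lipschitz_continuous (rL z).
have bh z : bounded_rv (fun w => ramp z e (W n w)).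
  apply: (bounded_rv_comp (mh z)) => // M; exists 1 => y _.
  by have /andP[? ?] := ramp01 z e y; rewrite ger0_norm.
have p3 : fine (P [set w | e <= `|Z n w - W n w|]) <= eta / 4.
  exact: le_trans (ler_norm _) H3.
have U : fine (P [set w | Z n w <= x]) <= G x + eta.
  apply: (@le_trans _ _ (\int[P]_w ramp (x + e) e (W n w) + eta / 4)).
    apply: (@le_trans _ _ (fine (P ([set w | W n w <= x + e] `|` [set w | e <= `|Z n w - W n w|])))).
      apply: fine_prob_le; [exact: mle|apply: measurableU => //; exact: mle (bW n).1|].
      move=> w /= Zx; have [Wx|Wx] := leP (W n w) (x + e); [by left|right].
      by rewrite distrC (le_trans _ (ler_norm _))//; lra.
    apply: le_trans (fine_prob_setU _ _ _) _ => //; first exact: mle (bW n).1.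
    rewrite lerD// -mean_indic; last exact: mle (bW n).1.
    apply: ler_mean => //; first exact/bounded_rv_indic/mle/(bW n).1.
    move=> w; rewrite indicE; have [|_] := boolP (w \in _).
      by rewrite inE/= => Wx; rewrite ramp_eq1.
    by have /andP[] := ramp01 (x + e) e (W n w).
  have := normal_mean_le_law (x + e) V_ge0 e_gt0; rewrite -/(G _).
  have := Gd (x + e + e).
  have -> : `|x - (x + e + e)| = 2 * e.
    have -> : x - (x + e + e) = - (2 * e) by ring.
    by rewrite normrN gtr0_norm// mulr_gt0.
  move=> /(_ (lexx _)); move: H1; rewrite !ler_norml => /andP[_ h1] /andP[h2 _] h3.
  by lra.
have D : G x - eta <= fine (P [set w | Z n w <= x]).
  apply: (@le_trans _ _ (\int[P]_w ramp (x - 2 * e) e (W n w) - eta / 4)); last first.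
    rewrite lerBlDr.
    apply: (@le_trans _ _ (fine (P ([set w | Z n w <= x] `|` [set w | e <= `|Z n w - W n w|])))); last first.
      apply: le_trans (fine_prob_setU _ _ _) _ => //; first exact: mle.
      by rewrite lerD2l.
    apply: (@le_trans _ _ (fine (P [set w | W n w <= x - e]))).
      rewrite -mean_indic; last exact: mle (bW n).1.
      apply: ler_mean => //; first exact/bounded_rv_indic/mle/(bW n).1.
      move=> w; rewrite indicE; have [_|] := boolP (w \in _).
        by have /andP[] := ramp01 (x - 2 * e) e (W n w).
      rewrite notin_setE/= => /negP; rewrite -ltNge => Wx; rewrite ramp_eq0//.
      by lra.
    apply: fine_prob_le; [exact: mle (bW n).1|by apply: measurableU => //; exact: mle|].
    move=> w /= Wx; have [Zx|Zx] := leP (Z n w) x; [by left|right].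
    by rewrite (le_trans _ (ler_norm _))//; lra.
  have := normal_law_le_mean (x - 2 * e) V_ge0 e_gt0; rewrite -/(G _).
  have := Gd (x - 2 * e).
  have -> : `|x - (x - 2 * e)| = 2 * e.
    have -> : x - (x - 2 * e) = 2 * e by ring.
    by rewrite gtr0_norm// mulr_gt0.
  move=> /(_ (lexx _)); move: H2; rewrite !ler_norml => /andP[h1 _] /andP[_ h2] h3.
  by lra.
by rewrite ler_norml; apply/andP; split; lra.
Unshelve. all: by end_near. Qed.

End triangular_array.
End central_limit.

(** * Weights of the least squares estimator *)

Section lipschitz.
Context {R : realType}.
Variables (a b : R).
Implicit Types rho : R -> R.

Definition itv_lipschitz rho := exists2 C, 0 < C & lipschitz_itv a b C rho.

Lemma itv_lipschitz_cst c : itv_lipschitz (fun=> c).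
Proof.
exists (`|c| + 1); first by rewrite ltr_wpDl.
by split=> [v _|v w _ _]; [rewrite lerDl|rewrite subrr normr0 mulr_ge0// addr_ge0].
Qed.

Lemma itv_lipschitzD rho rho' : itv_lipschitz rho -> itv_lipschitz rho' ->
  itv_lipschitz (fun v => rho v + rho' v).
Proof.
move=> [C C0 [h1 h2]] [D D0 [k1 k2]]; exists (C + D); first exact: addr_gt0.
split=> [v vab|v w vab wab].
  by rewrite (le_trans (ler_normD _ _))// lerD ?h1 ?k1.
have -> : rho v + rho' v - (rho w + rho' w) = (rho v - rho w) + (rho' v - rho' w) by ring.
by rewrite (le_trans (ler_normD _ _))// mulrDl lerD ?h2 ?k2.
Qed.

Lemma itv_lipschitzM rho rho' : itv_lipschitz rho -> itv_lipschitz rho' ->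
  itv_lipschitz (fun v => rho v * rho' v).
Proof.
move=> [C C0 [h1 h2]] [D D0 [k1 k2]].
have CD : 0 < C * D by exact: mulr_gt0.
exists (2 * (C * D)); first by rewrite mulr_gt0.
split=> [v vab|v w vab wab].
  by rewrite normrM (@le_trans _ _ (C * D))//; [rewrite ler_pM ?h1 ?k1|lra].
have -> : rho v * rho' v - rho w * rho' w =
  (rho v - rho w) * rho' v + rho w * (rho' v - rho' w) by ring.
rewrite (le_trans (ler_normD _ _))// !normrM.
have -> : 2 * (C * D) * `|v - w| = (C * `|v - w|) * D + C * (D * `|v - w|) by ring.
by rewrite lerD// ler_pM ?h1 ?h2 ?k1 ?k2.
Qed.

Lemma itv_lipschitz_sum (I : Type) (r : seq I) (Q : pred I) (F : I -> R -> R) :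
  (forall i, itv_lipschitz (F i)) ->
  itv_lipschitz (fun v => \sum_(i <- r | Q i) F i v).
Proof.
move=> FL; elim: r => [|i r IH].
  have := itv_lipschitz_cst 0; congr itv_lipschitz.
  by apply/funext => v; rewrite big_nil.
have [Qi|Qi] := boolP (Q i).
  have := itv_lipschitzD (FL i) IH; congr itv_lipschitz.
  by apply/funext => v; rewrite big_cons Qi.
by move: IH; congr itv_lipschitz; apply/funext => v; rewrite big_cons (negbTE Qi).
Qed.

Lemma itv_lipschitz_derive rho (rho' : R -> R) C : a <= b ->
  (forall v : R, a <= v <= b -> is_derive v 1 rho (rho' v)) ->
  (forall v, a <= v <= b -> `|rho' v| <= C) -> itv_lipschitz rho.
Proof.
move=> ab dr rC.
have aab : a <= a <= b by rewrite lexx.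
have C0 : 0 <= C by rewrite (le_trans _ (rC a aab)).
exists (`|rho a| + C * (b - a) + C + 1).
  by rewrite ltr_wpDl// !addr_ge0// mulr_ge0// subr_ge0.
have L v w : a <= v <= b -> a <= w <= b -> `|rho v - rho w| <= C * `|v - w|.
  exact: is_derive_lipschitz dr rC.
split=> [v vab|v w vab wab].
  have := L v a vab aab.
  have /andP[av vb] := vab.
  rewrite [X in C * X]ger0_norm ?subr_ge0// => K.
  have K2 : C * (v - a) <= C * (b - a) by rewrite ler_wpM2l// lerB.
  have := ler_normD (rho v - rho a) (rho a); rewrite subrK; lra.
rewrite (le_trans (L _ _ vab wab))// ler_wpM2r//.
have : 0 <= C * (b - a) by rewrite mulr_ge0// subr_ge0.
by have := normr_ge0 (rho a); lra.
Qed.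

Lemma itv_lipschitz_cos c : a <= b -> itv_lipschitz (fun v => cos (c * v)).
Proof.
move=> ab; apply: (@itv_lipschitz_derive _ (fun v => - sin (c * v) * c) (`|c|)) => // v _.
  apply: (@is_derive1_comp R cos (fun v => c * v) v).
  apply: is_derive_eq; last by rewrite /GRing.scale/= mulr1.
by rewrite normrM normrN ler_piMl// ler_norml sin_geN1 sin_le1.
Qed.

Lemma itv_lipschitz_sin c : a <= b -> itv_lipschitz (fun v => sin (c * v)).
Proof.
move=> ab; apply: (@itv_lipschitz_derive _ (fun v => cos (c * v) * c) (`|c|)) => // v _.
  apply: (@is_derive1_comp R sin (fun v => c * v) v).
  apply: is_derive_eq; last by rewrite /GRing.scale/= mulr1.
by rewrite normrM ler_piMl// ler_norml cos_geN1 cos_le1.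
Qed.

Lemma itv_lipschitz_ln : 0 < a -> a <= b -> itv_lipschitz (@ln R).
Proof.
move=> a0 ab; apply: (@itv_lipschitz_derive _ (fun v => v^-1) a^-1) => // v /andP[av vb].
  by apply: is_derive1_ln; rewrite (lt_le_trans a0).
have v0 : 0 < v by rewrite (lt_le_trans a0).
by rewrite ger0_norm ?invr_ge0 ?(ltW v0)// lef_pV2.
Qed.

Lemma itv_lipschitz_inv : 0 < a -> a <= b -> itv_lipschitz (fun v => v^-1).
Proof.
move=> a0 ab; apply: (@itv_lipschitz_derive _ (fun v => - v ^- 2) (a ^- 2)) => // v /andP[av vb];
  have v0 : 0 < v by rewrite (lt_le_trans a0).
  have := @is_deriveV R id v 1 1 (lt0r_neq0 v0) (is_derive_id _ _).
  by rewrite /GRing.scale/= mulr1.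
rewrite normrN ger0_norm ?invr_ge0 ?sqr_ge0// lef_pV2 ?posrE ?exprn_gt0//.
by rewrite ler_sqr ?nnegrE// ltW.
Qed.

Lemma itv_lipschitz_regressor j : 0 < a -> a <= b -> itv_lipschitz (regressor j).
Proof.
move=> a0 ab; case: j => [|[|j]]; rewrite /regressor.
- have := itv_lipschitzM (itv_lipschitz_cst (-1)) (itv_lipschitz_ln a0 ab).
  by congr itv_lipschitz; apply/funext => v; rewrite mulN1r.
- exact: itv_lipschitz_cst.
- apply: itv_lipschitzM; first exact: itv_lipschitz_cst.
  exact: itv_lipschitz_cos.
Qed.

End lipschitz.

(** * Convergence of inverse matrices *)

Section matrix_limits.
Context {R : realType}.

Lemma cvg_sum_seq (I : Type) (r : seq I) (Q : pred I) (u : I -> nat -> R) (l : I -> R) :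
  (forall i, u i n @[n --> \oo] --> l i) ->
  (\sum_(i <- r | Q i) u i n) @[n --> \oo] --> \sum_(i <- r | Q i) l i.
Proof.
move=> ul; elim: r => [|i r IH].
  by under eq_fun do rewrite big_nil; rewrite big_nil; exact: cvg_cst.
rewrite big_cons; under eq_fun do rewrite big_cons.
by case: (Q i) => //; apply: cvgD.
Qed.

Lemma cvg_prod_seq (I : Type) (r : seq I) (Q : pred I) (u : I -> nat -> R) (l : I -> R) :
  (forall i, u i n @[n --> \oo] --> l i) ->
  (\prod_(i <- r | Q i) u i n) @[n --> \oo] --> \prod_(i <- r | Q i) l i.
Proof.
move=> ul; elim: r => [|i r IH].
  by under eq_fun do rewrite big_nil; rewrite big_nil; exact: cvg_cst.
rewrite big_cons; under eq_fun do rewrite big_cons.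
by case: (Q i) => //; apply: cvgM.
Qed.

Lemma cvg_det m (A : nat -> 'M[R]_m) (L : 'M[R]_m) :
  (forall i j, A n i j @[n --> \oo] --> L i j) -> \det (A n) @[n --> \oo] --> \det L.
Proof.
move=> AL; rewrite /determinant; apply: cvg_sum_seq => s.
by apply: cvgM; [exact: cvg_cst|apply: cvg_prod_seq => i; exact: AL].
Qed.

Lemma cvg_adj m (A : nat -> 'M[R]_m) (L : 'M[R]_m) i j :
  (forall i j, A n i j @[n --> \oo] --> L i j) -> (\adj (A n)) i j @[n --> \oo] --> (\adj L) i j.
Proof.
move=> AL; rewrite /adjugate mxE; under eq_fun do rewrite mxE.
rewrite /cofactor; apply: cvgM; first exact: cvg_cst.
apply: cvg_det => k l; rewrite !mxE; under eq_fun do rewrite !mxE.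
exact: AL.
Qed.

(** The inverse is the adjugate over the determinant, both polynomial in the entries. A nonzero
    limit determinant makes [A n] invertible from some rank on, and from there [invmx] is given by
    this formula. *)
Lemma invmx_cvg m (A : nat -> 'M[R]_m) (L : 'M[R]_m) :
  (forall i j, A n i j @[n --> \oo] --> L i j) -> L \in unitmx ->
  (exists N, forall n, (N <= n)%N -> A n \in unitmx) /\
  forall i j, invmx (A n) i j @[n --> \oo] --> invmx L i j.
Proof.
move=> AL Lu; have dL := cvg_det AL.
have L0 : \det L != 0 by move: Lu; rewrite unitmxE unitfE.
have [N HN] : exists N, forall n, (N <= n)%N -> A n \in unitmx.
  have L00 : 0 < `|\det L| / 2 by rewrite divr_gt0// normr_gt0.
  move: dL => /cvgrPdist_le /(_ _ L00)[N _ HN].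
  exists N => n Nn; rewrite unitmxE unitfE; apply/eqP => A0.
  have := HN n Nn; rewrite /= A0 subr0 leNgt => /negP; apply.
  by rewrite ltr_pdivrMr// ltr_pMr ?normr_gt0// ltr1n.
split; first by exists N.
move=> i j.
have -> : invmx L i j = (\det L)^-1 * (\adj L) i j by rewrite /invmx Lu mxE.
have K : (\det (A n))^-1 * (\adj (A n)) i j @[n --> \oo] --> (\det L)^-1 * (\adj L) i j.
  by apply: cvgM; [apply: cvgV|exact: cvg_adj].
apply: cvg_trans K; apply: near_eq_cvg; exists N => // n /= Nn.
by rewrite /invmx (HN n Nn) [RHS]mxE.
Qed.

End matrix_limits.

Section estimator.
Context {R : realType}.
Variables (a b : R) (pt : nat) (wt : R -> R).
Hypotheses (a_gt0 : 0 < a) (a_lt_b : a < b) (wt_int : riemann_integrable wt a b).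
Hypothesis M_unit : limit_mx a b pt wt \in unitmx.

Local Notation Xn n := (design_mx a b pt n).
Local Notation Wn n := (weight_mx a b wt n).
Local Notation node := (node a).
Local Notation nb_obs := (nb_obs a b).

Definition gram_mx n : 'M[R]_pt.+2 := (Xn n)^T *m Wn n *m Xn n.

(** Entry [i] of the row [e1' (X'WX)^-1 X'W], which makes the estimator linear in the log quantiles.
    It is the counterpart at finite [n] of [weight_kernel / n]. *)
Definition wls_weight n (i : nat) : R :=
  wt (node n i) * \sum_(k < pt.+2) invmx (gram_mx n) ord0 k * regressor k (node n i).

Lemma gram_mxE n i j : gram_mx n i j =
  \sum_(l < nb_obs n) wt (node n l) * (regressor i (node n l) * regressor j (node n l)).
Proof.
rewrite /gram_mx mul_mx_diag !mxE; apply: eq_bigr => l _; rewrite !mxE.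
by rewrite -mulrA [_ * regressor j _]mulrC !mulrA; ring.
Qed.

Lemma wls_estimatorE x n : wls_estimator a b pt wt x n =
  \sum_(i < nb_obs n) wls_weight n i * ln (empirical_quantile x n (1 - node n i)).
Proof.
rewrite /wls_estimator -/(gram_mx n) mxE; apply: eq_bigr => i _.
rewrite [response _ _ _ _ _ _]mxE; congr (_ * _).
rewrite mul_mx_diag !mxE /wls_weight mulrC; congr (_ * _).
apply: eq_bigr => k _; rewrite !mxE; congr (_ * _).
rewrite (bigD1 ord0)//= !mxE eqxx mul1r big1 ?addr0// => l l0.
by rewrite !mxE (negbTE l0) mul0r.
Qed.

(** The row of weights times the design matrix is the first unit row, the Gram matrix cancelling
    against its inverse. A log quantile in the span of the regressors is therefore fitted without
    bias at finite [n]. *)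
Lemma wls_weight_exact n (beta : 'I_pt.+2 -> R) : gram_mx n \in unitmx ->
  \sum_(i < nb_obs n) wls_weight n i * \sum_(j < pt.+2) beta j * regressor j (node n i) =
  beta ord0.
Proof.
move=> Gu.
have : (invmx (gram_mx n) *m gram_mx n *m (\col_j beta j)) ord0 ord0 = beta ord0.
  by rewrite mulVmx// mul1mx mxE.
move=> <-; rewrite -mulmxA mxE.
under [RHS]eq_bigr => k _ do rewrite mxE mulr_sumr.
under [RHS]eq_bigr => k _ do under eq_bigr => j _ do
  rewrite gram_mxE mxE mulr_suml mulr_sumr.
rewrite /wls_weight.
under [LHS]eq_bigr => i _ do rewrite -mulrA mulr_suml mulr_sumr.
rewrite [LHS]exchange_big/=; apply: eq_bigr => k _.
under [LHS]eq_bigr => i _ do rewrite !mulr_sumr.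
rewrite exchange_big/=; apply: eq_bigr => j _; apply: eq_bigr => i _.
by ring.
Qed.

Let ab : a <= b := ltW a_lt_b.

Lemma gram_mx_cvg i j : (n%:R^-1 *: gram_mx n) i j @[n --> \oo] --> limit_mx a b pt wt i j.
Proof.
have [C C0 LC] := itv_lipschitzM (itv_lipschitz_regressor i a_gt0 ab)
                                (itv_lipschitz_regressor j a_gt0 ab).
rewrite [X in _ --> X]mxE.
have -> : riemann_integral (fun u => regressor i u * regressor j u * wt u) a b =
    riemann_integral (fun u => wt u * (regressor i u * regressor j u)) a b.
  by apply: eq_riemann_integral => // u _; rewrite mulrC.
apply/cvgrPdist_le => e e0.
have [N HN] := node_sum_uniform a_lt_b a_gt0 wt_int C0 e0.
exists N => // n /= Nn; rewrite distrC mxE gram_mxE mulr_sumr.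
have := HN n Nn _ LC; congr (`|_ - _| <= _).
by apply: eq_bigr => l _; rewrite mulrC.
Qed.

Lemma gram_mx_unit : exists N, forall n, (N <= n)%N -> gram_mx n \in unitmx.
Proof.
have [[N HN] _] := invmx_cvg gram_mx_cvg M_unit.
exists N.+1 => n Nn; have := HN n (ltnW Nn).
have n0 : n%:R != 0 :> R by rewrite pnatr_eq0 -lt0n (leq_trans _ Nn).
by rewrite unitmxZ// unitfE invr_eq0.
Qed.

(** [n] times the inverse Gram matrix is the inverse of the Gram matrix over [n], whose entries
    converge. There are finitely many entries in a row and the regressors are bounded on [[a, b]],
    so the convergence is uniform over the nodes. *)
Lemma wls_weight_cvg e : 0 < e -> exists N, forall n, (N <= n)%N ->
  forall i, (i < nb_obs n)%N ->
  `|n%:R * wls_weight n i - weight_kernel a b pt wt (node n i)| <= e.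
Proof.
move=> e0.
have [B B0 wB] := riemann_integrable_bounded a_lt_b wt_int.
have /choice[C HC] : forall k : 'I_pt.+2, exists C, 0 < C /\ lipschitz_itv a b C (regressor k).
  by move=> k; have [C] := itv_lipschitz_regressor k a_gt0 ab; exists C.
pose S := \sum_k C k.
have S0 : 0 < S.
  rewrite /S (bigD1 ord0)//= ltr_wpDr ?(HC ord0).1//.
  by apply: sumr_ge0 => k _; exact/ltW/(HC k).1.
pose eta := e / (B * S).
have eta0 : 0 < eta by rewrite divr_gt0// mulr_gt0.
have [[N1 HN1] Ac] := invmx_cvg gram_mx_cvg M_unit.
have /choice[N HN] : forall k : 'I_pt.+2, exists N, forall n, (N <= n)%N ->
    `|invmx (limit_mx a b pt wt) ord0 k - invmx (n%:R^-1 *: gram_mx n) ord0 k| <= eta.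
  move=> k; have /cvgrPdist_le /(_ _ eta0)[N _ HN] := Ac ord0 k.
  by exists N => n Nn; exact: HN.
exists (maxn 1 (maxn N1 (\max_k N k)))%N => n; rewrite !geq_max => /and3P[n0 N1n Nn] i i_n.
have n0' : n%:R != 0 :> R by rewrite pnatr_eq0 -lt0n.
have nV : (n%:R^-1 : R) \is a GRing.unit by rewrite unitfE invr_eq0.
have iE k : n%:R * invmx (gram_mx n) ord0 k = invmx (n%:R^-1 *: gram_mx n) ord0 k.
  by rewrite invmxZ ?invrK ?mxE//; have := HN1 n N1n; rewrite unitmxZ.
have sab : a <= node n i <= b by rewrite node_ge// node_le.
rewrite /wls_weight /weight_kernel mulrCA -mulrBr mulr_sumr -sumrB normrM.
apply: (@le_trans _ _ (B * (eta * S))); last first.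
  rewrite /eta le_eqVlt; apply/orP; left; apply/eqP; field.
  by rewrite !gt_eqF.
rewrite ler_pM// ?wB// (le_trans (ler_norm_sum _ _ _))// /S mulr_sumr.
apply: ler_sum => k _; rewrite mulrA iE -mulrBl normrM ler_pM//.
  rewrite distrC; apply: HN; apply: leq_trans Nn.
  exact: (leq_bigmax k).
exact: (HC k).2.1.
Qed.

End estimator.

(** * The quantile function and the density *)

Section derivatives.
Context {R : realType}.

Lemma is_derive_approx (f : R -> R) (x l e : R) : is_derive x 1 f l -> 0 < e ->
  exists2 del, 0 < del &
  forall y, `|y - x| < del -> `|f y - f x - l * (y - x)| <= e * `|y - x|.
Proof.
move=> [dx dl] e0; move: dx => /cvg_ex[l' cl'].
have ll' : l' = l by rewrite -dl; apply/esym/cvg_lim.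
move: cl'; rewrite ll' => /cvgrPdist_le /(_ _ e0).
move=> /nbhs_ballP[del /= del0 H].
exists del => // y yx; have [->|yx0] := eqVneq y x.
  by rewrite !subrr mulr0 subr0 normr0 mulr0.
have h0 : y - x != 0 by rewrite subr_eq0.
have := H (y - x); rewrite /ball/= sub0r normrN => /(_ yx h0).
rewrite /GRing.scale/= mulr1 subrK => K.
have -> : f y - f x - l * (y - x) = - ((l - (y - x)^-1 * (f y - f x)) * (y - x)).
  by field.
by rewrite normrN normrM ler_wpM2r.
Qed.

(** Where the difference quotient has no limit the derivative takes the default value 0, so a
    nonzero value certifies differentiability. *)
Lemma derive1_neq0 (f : R -> R) (x : R) : f^`()%classic x != 0 ->
  is_derive x 1 f (f^`()%classic x).
Proof.
move=> f0; have dx : derivable f x 1; last by apply: DeriveDef => //; rewrite derive1E.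
apply: contrapT => ndx; move: f0; rewrite derive1E /derive => /eqP; apply.
by rewrite dvgP.
Qed.

Lemma is_derive_sum_seq (I : Type) (r : seq I) (h : I -> R -> R) (dh : I -> R) (x : R) :
  (forall i, is_derive x 1 (h i) (dh i)) ->
  is_derive x 1 (fun s => \sum_(i <- r) h i s) (\sum_(i <- r) dh i).
Proof.
move=> H; elim: r => [|i r IH].
  rewrite big_nil; under eq_fun do rewrite big_nil.
  exact: is_derive_cst.
rewrite big_cons; under eq_fun do rewrite big_cons.
exact: is_deriveD.
Qed.

End derivatives.

Section log_quantile.
Context {R : realType}.
Variables (alpha : R) (p : nat) (theta : nat -> R).

Definition log_quantile (s : R) : R :=
  - alpha * ln s + theta 0%N + 2 * \sum_(1 <= k < p.+1) theta k * cos (2 * pi * k%:R * s).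

Definition log_quantile' (s : R) : R :=
  - alpha * s^-1 +
  2 * \sum_(1 <= k < p.+1) theta k * (- sin (2 * pi * k%:R * s) * (2 * pi * k%:R)).

Lemma is_derive_log_quantile (s : R) : 0 < s ->
  is_derive s 1 log_quantile (log_quantile' s).
Proof.
move=> s0; rewrite /log_quantile /log_quantile'.
have d1 : is_derive s 1 (fun s : R => - alpha * ln s) (- alpha * s^-1).
  by apply: is_deriveZ; exact: is_derive1_ln.
have d2 : is_derive s 1 (fun s : R => \sum_(1 <= k < p.+1) theta k * cos (2 * pi * k%:R * s))
   (\sum_(1 <= k < p.+1) theta k * (- sin (2 * pi * k%:R * s) * (2 * pi * k%:R))).
  apply: is_derive_sum_seq => k; apply: is_deriveZ.
  apply: (@is_derive1_comp R cos (fun v => 2 * pi * k%:R * v) s).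
  by apply: is_derive_eq; rewrite /GRing.scale/= mulr1.
have d3 := is_deriveD (is_deriveD d1 (is_derive_cst (theta 0%N) s 1)) (is_deriveZ 2 d2).
by rewrite addr0 in d3; exact: d3.
Qed.

Lemma itv_lipschitz_log_quantile' (a b : R) : 0 < a -> a <= b ->
  itv_lipschitz a b log_quantile'.
Proof.
move=> a0 ab; apply: itv_lipschitzD.
  apply: itv_lipschitzM; first exact: itv_lipschitz_cst.
  exact: itv_lipschitz_inv.
apply: itv_lipschitzM; first exact: itv_lipschitz_cst.
apply: itv_lipschitz_sum => k.
apply: itv_lipschitzM; first exact: itv_lipschitz_cst.
apply: itv_lipschitzM; last exact: itv_lipschitz_cst.
have := itv_lipschitzM (itv_lipschitz_cst a b (-1)) (itv_lipschitz_sin (2 * pi * k%:R) ab).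
by congr itv_lipschitz; apply/funext => v; rewrite mulN1r.
Qed.

Lemma log_quantile_regression pt (s : R) : (p < pt)%N ->
  log_quantile s = \sum_(j < pt.+2)
    (if (j : nat) is j'.+1 then (if (j' <= p)%N then theta j' else 0) else alpha) * regressor j s.
Proof.
move=> ppt; rewrite big_ord_recl/= big_ord_recl/= /log_quantile /regressor/=.
rewrite mulr1 mulrN mulNr -!addrA; congr (_ + (_ + _)).
rewrite mulr_sumr -(big_mkord xpredT (fun i => (if (i.+1 <= p)%N then theta i.+1 else 0) *
  (2 * cos (2 * pi * i.+1%:R * s)))).
rewrite [RHS](@big_cat_nat _ _ _ p)//= 1?ltnW// [X in _ = _ + X]big_nat_cond.
rewrite [X in _ = _ + X]big1 ?addr0; last first.
  by move=> i; rewrite andbT => /andP[pi' _]; rewrite ltnNge pi'/= mul0r.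
rewrite big_add1/= big_nat_cond [RHS]big_nat_cond; apply: eq_bigr => i.
by rewrite andbT => /= ->; rewrite mulrCA.
Qed.

End log_quantile.

Section quantile.
Context {R : realType}.
Variables (F g g1 : R -> R) (a b : R).
Hypotheses (a_gt0 : 0 < a) (ab : a < b) (b_lt1 : b < 1).
Hypothesis F_nd : {homo F : x y / x <= y}.
Hypothesis F_rc : forall x, F y @[y --> x^'+] --> F x.
Hypothesis Qg : forall s : R, 0 < s < 1 -> quantile F (1 - s) = (expR (g s))%:E.
Hypothesis dg : forall s : R, 0 < s -> is_derive s 1 g (g1 s).
Hypothesis g1_lip : forall c e : R, 0 < c -> c <= e -> itv_lipschitz c e g1.
Hypothesis density_neq0 : forall s : R, a <= s <= b -> density_quantile F (1 - s) != 0.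

Let QE (s : R) : 0 < s < 1 ->
  ereal_inf [set x%:E | x in [set x | 1 - s <= F x]] = (expR (g s))%:E.
Proof.
move=> s01; rewrite -Qg// /quantile; case: eqP => // s1.
by exfalso; move: s01 => /andP[? ?]; lra.
Qed.

Lemma cdf_lt_quantile (s x : R) : 0 < s < 1 -> x < expR (g s) -> F x < 1 - s.
Proof.
move=> s01 xg; rewrite ltNge; apply/negP => Fx.
have : (ereal_inf [set x%:E | x in [set x | (1 - s <= F x)%R]] <= x%:E)%E.
  by apply: ereal_inf_lbound; exists x.
by rewrite QE// lee_fin leNgt xg.
Qed.

(** Right continuity: the infimum defining the quantile is attained. *)
Lemma cdf_quantile_ge (s : R) : 0 < s < 1 -> 1 - s <= F (expR (g s)).
Proof.
move=> s01; rewrite leNgt; apply/negP => Fx.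
set x := expR (g s) in Fx *.
have e0 : 0 < (1 - s - F x) / 2 by rewrite divr_gt0// subr_gt0.
have /cvgrPdist_le /(_ _ e0) := @F_rc x.
rewrite /at_right near_withinE => /nbhs_ballP[del /= del0 H].
have : (ereal_inf [set x%:E | x in [set x | (1 - s <= F x)%R]] < (x + del)%:E)%E.
  by rewrite QE// lte_fin ltrDl.
move=> /ereal_inf_lt[_ [y /= Fy <-]]; rewrite lte_fin => yx.
have [xy|yx'] := ltP x y; last first.
  by have := F_nd yx'; lra.
have := H y; rewrite /ball/= distrC gtr0_norm ?subr_gt0// ltrBlDl => /(_ yx xy).
by rewrite ler_norml; lra.
Qed.

Let dE (s : R) : a <= s <= b -> is_derive (expR (g s)) 1 F (density_quantile F (1 - s)).
Proof.
move=> sab; have [A0 AB B1] := And3 a_gt0 ab b_lt1.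
have := density_neq0 sab; rewrite /density_quantile Qg/=; last first.
  by move: sab => /andP[? ?]; apply/andP; split; lra.
exact: derive1_neq0.
Qed.

Let lin_bound (s : R) : a <= s <= b -> exists2 L, 0 < L & exists2 del, 0 < del &
  forall y, `|y - expR (g s)| < del -> `|F y - F (expR (g s))| <= L * `|y - expR (g s)|.
Proof.
move=> sab; set f := density_quantile F (1 - s).
have [del del0 H] := is_derive_approx (dE sab) ltr01.
exists (`|f| + 1); first by rewrite ltr_wpDl.
exists del => // y /H; set x := expR (g s) => K.
have -> : F y - F x = (F y - F x - f * (y - x)) + f * (y - x) by ring.
by rewrite (le_trans (ler_normD _ _))// mulrDl mul1r addrC normrM lerD2l -(mul1r `|y - x|).
Qed.

(** The derivative at the quantile excludes a jump: if [F] exceeded [1 - s] there, the linear bound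
    would keep it at or above [1 - s] slightly to the left, against the infimum. *)
Let cdf_quantile_ab (s : R) : a <= s <= b -> F (expR (g s)) = 1 - s.
Proof.
move=> sab; have [A0 AB B1] := And3 a_gt0 ab b_lt1.
have s01 : 0 < s < 1 by move: sab => /andP[? ?]; apply/andP; split; lra.
apply/eqP; rewrite eq_le cdf_quantile_ge// andbT leNgt; apply/negP => Fx.
have [L L0 [del del0 H]] := lin_bound sab.
set x := expR (g s) in Fx H.
pose t := Num.min (del / 2) ((F x - (1 - s)) / L).
have t0 : 0 < t by rewrite lt_min !divr_gt0// subr_gt0.
have tdel : t < del by rewrite gt_min ltr_pdivrMr// ltr_pMr// ltr1n.
have tL : L * t <= F x - (1 - s).
  by rewrite mulrC -ler_pdivlMr// ge_min lexx orbT.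
have := H (x - t); rewrite addrAC subrr add0r normrN gtr0_norm// => /(_ tdel).
rewrite ler_norml => /andP[h1 _].
have : F (x - t) < 1 - s by apply: cdf_lt_quantile => //; rewrite -/x gtrBl.
by lra.
Qed.

Let dphi (s : R) : 0 < s -> is_derive s 1 (expR \o g) (expR (g s) * g1 s).
Proof. by move=> s0; apply: is_derive1_comp; exact: dg. Qed.

(** If [g1 s >= 0], passing from [s] to [s - h] raises the quantile by at most [h / (2 * L)], hence
    [F] by at most [h / 2] through its linear bound, although [F] must rise by at least [h]. *)
Lemma log_quantile'_lt0 (s : R) : a <= s <= b -> g1 s < 0.
Proof.
move=> sab; have [A0 AB B1] := And3 a_gt0 ab b_lt1.
have /andP[as_ sb] := sab; have s0 : 0 < s by lra.
rewrite ltNge; apply/negP => g1s.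
have [L L0 [del del0 H]] := lin_bound sab.
have e0 : 0 < (2 * L)^-1 by rewrite invr_gt0 mulr_gt0.
have [del2 del20 H2] := is_derive_approx (dphi s0) e0.
pose h := Num.min (s / 2) (Num.min (del2 / 2) (del * L)).
have h0 : 0 < h by rewrite !lt_min !divr_gt0// mulr_gt0.
have hs : h <= s / 2 by rewrite ge_min lexx.
have hd2 : h <= del2 / 2 by rewrite !ge_min lexx !orbT.
have hd : h <= del * L by rewrite !ge_min lexx !orbT.
have u01 : 0 < s - h < 1 by apply/andP; split; lra.
have := H2 (s - h).
have -> : s - h - s = - h by ring.
rewrite normrN gtr0_norm//= => /(_ ltac:(lra)).
rewrite ler_norml => /andP[_ k1].
have Fu := cdf_quantile_ge u01.
have Fs := cdf_quantile_ab sab.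
set x := expR (g s) in Fs H k1; set y := expR (g (s - h)) in Fu k1.
have xy : x < y.
  by rewrite ltNge; apply/negP => /F_nd; lra.
have gx : 0 <= x * g1 s * h by rewrite !mulr_ge0 ?expR_ge0// ltW.
have k2 : y - x <= (2 * L)^-1 * h by lra.
have k3 : (2 * L)^-1 * h < del.
  have -> : (2 * L)^-1 * h = h / L / 2 by field; rewrite gt_eqF.
  have : h / L <= del by rewrite ler_pdivrMr.
  by lra.
have := H y; rewrite gtr0_norm ?subr_gt0// => /(_ (le_lt_trans k2 k3)).
rewrite ler_norml => /andP[_ k4].
have : L * (y - x) <= h / 2.
  apply: (@le_trans _ _ (L * ((2 * L)^-1 * h))); first by rewrite ler_wpM2l// ltW.
  by rewrite le_eqVlt; apply/orP; left; apply/eqP; field; rewrite gt_eqF.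
by lra.
Qed.

(** Lipschitz continuity of [g1] carries its sign at [a] and at [b] a little beyond these points.
    There the strict monotonicity of [g], instead of the derivative of [F], excludes jumps. *)
Lemma log_quantile_neighbourhood : exists a' b' C,
  [/\ 0 < a', a' < a, b < b', b' < 1 & 0 < C] /\
  [/\ lipschitz_itv a' b' C g1, forall s, a' <= s <= b' -> g1 s < 0 &
      forall s, a' <= s <= b' -> F (expR (g s)) = 1 - s].
Proof.
have [A0 AB B1] := And3 a_gt0 ab b_lt1.
have aab : a <= a <= b by rewrite lexx ltW.
have bab : a <= b <= b by rewrite lexx ltW.
have a20 : 0 < a / 2 by rewrite divr_gt0.
have ab2 : a / 2 <= (1 + b) / 2 by lra.
have [C C0 [gC gL]] := g1_lip a20 ab2.
have ga := log_quantile'_lt0 aab; have gb := log_quantile'_lt0 bab.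
pose eta := Num.min (- g1 a) (- g1 b).
have eta0 : 0 < eta by rewrite lt_min !oppr_gt0 ga gb.
have etaa : eta <= - g1 a by rewrite ge_min lexx.
have etab : eta <= - g1 b by rewrite ge_min lexx orbT.
pose del := Num.min (eta / (2 * C)) (Num.min (a / 2) ((1 - b) / 2)).
have del0 : 0 < del.
  by rewrite !lt_min !divr_gt0//= ?mulr_gt0// subr_gt0.
have d1 : C * del < eta.
  have : del <= eta / (2 * C) by rewrite ge_min lexx.
  rewrite ler_pdivlMr ?mulr_gt0//; lra.
have d2 : del <= a / 2 by rewrite !ge_min lexx !orbT.
have d3 : del <= (1 - b) / 2 by rewrite !ge_min lexx !orbT.
have neg s : a - del <= s <= b + del -> g1 s < 0.
  move=> /andP[s1 s2]; have [as_|sa] := leP a s; last first.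
    have := gL s a ltac:(apply/andP; split; lra) ltac:(apply/andP; split; lra).
    rewrite ler_norml => /andP[_ K].
    have : C * `|s - a| <= C * del.
      by rewrite ler_wpM2l ?(ltW C0)// ler_norml; apply/andP; split; lra.
    by lra.
  have [sb|bs] := leP s b; first by apply: log_quantile'_lt0; rewrite as_.
  have := gL s b ltac:(apply/andP; split; lra) ltac:(apply/andP; split; lra).
  rewrite ler_norml => /andP[_ K].
  have : C * `|s - b| <= C * del.
    by rewrite ler_wpM2l ?(ltW C0)// ler_norml; apply/andP; split; lra.
  by lra.
have dec s t : a - del <= s -> s < t -> t <= b + del -> g t < g s.
  move=> s1 st t1.
  have [|c /andP[c1 c2] cE] := @is_derive_MVT R g g1 s t (ltW st).
    by move=> x /andP[x1 x2]; apply: dg; lra.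
  rewrite -subr_lt0 cE pmulr_llt0 ?subr_gt0//; apply: neg.
  by apply/andP; split; lra.
(* Half of the left margin is kept in reserve: [F (expR (g s)) = 1 - s] is proved by looking at
   [s - h] with [h <= del / 2]. *)
exists (a - del / 2), (b + del), C; split; first by split=> //; lra.
split.
- split=> [v /andP[v1 v2]|v w /andP[v1 v2] /andP[w1 w2]].
    by apply: gC; apply/andP; split; lra.
  by apply: gL; apply/andP; split; lra.
- by move=> s /andP[s1 s2]; apply: neg; apply/andP; split; lra.
- move=> s /andP[s1 s2]; have s01 : 0 < s < 1 by apply/andP; split; lra.
  apply/eqP; rewrite eq_le cdf_quantile_ge// andbT leNgt; apply/negP => Fx.
  pose h := Num.min (del / 2) (F (expR (g s)) - (1 - s)).
  have h0 : 0 < h by rewrite lt_min divr_gt0// subr_gt0.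
  have h1 : h <= del / 2 by rewrite ge_min lexx.
  have h2 : h <= F (expR (g s)) - (1 - s) by rewrite ge_min lexx orbT.
  have t01 : 0 < s - h < 1 by apply/andP; split; lra.
  have : g s < g (s - h) by apply: dec; lra.
  rewrite -ltr_expR => /(cdf_lt_quantile t01); lra.
Qed.

(** Chain rule for [F (expR (g s)) = 1 - s]. As [expR (g s)] is [Q (1 - s)], it identifies [- g1 s]
    with [1 / (Q (1 - s) * fQ (1 - s))], the factor that occurs in the variance. *)
Lemma density_quantileE (s : R) : a <= s <= b ->
  density_quantile F (1 - s) * expR (g s) * g1 s = -1.
Proof.
move=> sab; have [A0 AB B1] := And3 a_gt0 ab b_lt1.
have /andP[as_ sb] := sab; have s0 : 0 < s by lra.
have [a' [b' [C [[a'0 a'a bb' b'1 C0] [_ _ FE]]]]] := log_quantile_neighbourhood.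
set L := _ * _ * _.
have dF : is_derive s 1 (F \o (expR \o g)) L.
  by rewrite /L -mulrA; apply: is_derive1_comp; [exact: dE|exact: dphi].
apply/eqP; rewrite -subr_eq0 opprK -normr_le0; apply/ler_addgt0Pr => e e0; rewrite add0r.
have [del del0 H] := is_derive_approx dF e0.
pose h := Num.min (del / 2) (a - a').
have h0 : 0 < h by rewrite lt_min divr_gt0// subr_gt0.
have h1 : h <= del / 2 by rewrite ge_min lexx.
have h2 : h <= a - a' by rewrite ge_min lexx orbT.
have := H (s - h).
have -> : s - h - s = - h by ring.
rewrite normrN gtr0_norm//= => /(_ ltac:(lra)).
rewrite !FE; [|by apply/andP; split; lra|by apply/andP; split; lra].
have -> : 1 - (s - h) - (1 - s) - L * - h = (L + 1) * h by ring.
by rewrite normrM (gtr0_norm h0) ler_pM2r.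
Qed.

End quantile.

(** * Order statistics and grids *)

Section order_statistics.
Context {R : realType}.
Implicit Types (x : nat -> R) (y : R) (n j : nat).

Lemma sorted_nth_le (s : seq R) k y : sorted <=%R s -> (k < size s)%N ->
  (nth 0 s k <= y) = (count (fun z => (y < z)%R) s <= size s - k.+1)%N.
Proof.
move=> ss ks.
have countE (r : seq R) : count (fun z => (y < z)%R) r = (size r - count (fun z => (z <= y)%R) r)%N.
  rewrite -(count_predC (fun z => z <= y) r) addKn.
  by apply: eq_count => z /=; rewrite ltNge.
have [ky|ky] := leP (nth 0 s k) y; apply/esym.
  rewrite -{1}(cat_take_drop k.+1 s) count_cat.
  have -> : count (fun z => y < z) (take k.+1 s) = 0%N.
    apply/eqP; rewrite -leqn0 leqNgt -has_count; apply/hasPn => z /(nthP 0)[i].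
    rewrite size_take_min => ik <-.
    have ik1 : (i < k.+1)%N by apply: leq_trans ik (geq_minl _ _).
    rewrite nth_take// -leNgt; apply: le_trans ky.
    by apply: (sorted_leq_nth le_trans le_refl) => //; rewrite inE ?(leq_ltn_trans _ ks).
  by rewrite add0n (leq_trans (count_size _ _))// size_drop.
apply/negbTE; rewrite -ltnNge -{2}(cat_take_drop k s) count_cat.
have -> : count (fun z => y < z) (drop k s) = size (drop k s).
  apply/eqP; rewrite -all_count; apply/allP => z /(nthP 0)[i].
  rewrite size_drop => ik <-; rewrite nth_drop.
  apply: (lt_le_trans ky); apply: (sorted_leq_nth le_trans le_refl) => //.
  - by rewrite inE -ltn_subRL.
  - exact: leq_addr.
by rewrite size_drop; lia.
Qed.

(** Turns an event on an order statistic into one on a sum of indicators; both the measurability of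
    the estimator and the analysis of the remainder go through this form. *)
Lemma order_stat_le x n j y : (j < n)%N ->
  (order_stat x n (n - j) <= y) = (\sum_(i < n) (y < x i)%R <= j)%N.
Proof.
move=> jn; rewrite /order_stat sorted_nth_le.
- rewrite size_sort size_mkseq (permP (permEl (perm_sort _ _))).
  have -> : (n - (n - j).-1.+1 = j)%N by lia.
  congr (_ <= _)%N; rewrite /mkseq count_map -sum1_count big_mkcond/=.
  by rewrite -{1}(subn0 n) -/(index_iota 0 n) big_mkord; apply: eq_bigr => i _; case: ifP.
- by apply: sort_sorted; exact: le_total.
- by rewrite size_sort size_mkseq; lia.
Qed.

(** The level [1 - j / n] is [(n - j) / n], the closed right end of its cell, so the ordinal picked
    is [n - j - 1] and the default value 0 is not reached. *)
Lemma empirical_quantileE x n j : (j < n)%N ->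
  empirical_quantile x n (1 - j%:R / n%:R) = order_stat x n (n - j).
Proof.
move=> jn; have n0 : 0 < n%:R :> R by rewrite ltr0n (leq_ltn_trans _ jn).
have E : 1 - j%:R / n%:R = (n - j)%:R / n%:R :> R.
  by rewrite natrB ?(ltnW jn)// mulrBl divff// gt_eqF.
rewrite /empirical_quantile E; case: pickP => [k|].
  rewrite ltr_pM2r ?invr_gt0// ler_pM2r ?invr_gt0// ltr_nat ler_nat => /andP[k1 k2].
  by congr order_stat; apply/eqP; rewrite eqn_leq k1 k2.
have kn : ((n - j).-1 < n)%N by lia.
move=> /(_ (Ordinal kn))/=.
rewrite ltr_pM2r ?invr_gt0// ler_pM2r ?invr_gt0// ltr_nat ler_nat.
have -> : ((n - j).-1 < n - j)%N by lia.
by have -> : (n - j <= (n - j).-1.+1)%N by lia.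
Qed.

End order_statistics.

(** * Distances measured by counting grid points *)

Section grid.
Context {R : realType}.
Variable del : R.
Hypothesis del_gt0 : 0 < del.

(** For [y >= 0], the integer part of [y / del] capped at [L], written as a sum of indicators so
    that two values differ by at most the number of grid points separating the arguments. *)
Let cnt L (y : R) := (\sum_(m < L) (m.+1%:R * del <= y)%R)%N.

Let cnt_le L y : (cnt L y <= L)%N.
Proof.
apply: (@leq_trans (\sum_(m < L) 1)%N); last by rewrite sum1_card card_ord.
by apply: leq_sum => m _; case: (_ <= _).
Qed.

Let cnt_full L y : L%:R * del <= y -> cnt L y = L.
Proof.
move=> Ly; transitivity (\sum_(m < L) 1)%N; last by rewrite sum1_card card_ord.
apply: eq_bigr => m _.
by rewrite (le_trans _ Ly)// ler_wpM2r ?(ltW del_gt0)// ler_nat.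
Qed.

Let cntS L y : cnt L.+1 y = (cnt L y + (L.+1%:R * del <= y)%R)%N.
Proof. by rewrite /cnt big_ord_recr. Qed.

Let cnt_upper L y : 0 <= y -> (cnt L y)%:R * del <= y.
Proof.
move=> y0; elim: L => [|L IH]; first by rewrite /cnt big_ord0 mul0r.
rewrite cntS; have [Ly|_] := leP (L.+1%:R * del) y; last by rewrite addn0.
by rewrite (le_trans _ Ly)// ler_wpM2r ?(ltW del_gt0)// ler_nat addn1 ltnS cnt_le.
Qed.

Let cnt_lower L y : y <= L%:R * del -> y <= (cnt L y).+1%:R * del.
Proof.
elim: L => [|L IH] yL.
  by rewrite (le_trans yL)// ler_wpM2r ?(ltW del_gt0)// ler_nat.
have [/IH yL'|/ltW Ly] := leP y (L%:R * del).
  rewrite (le_trans yL')// ler_wpM2r ?(ltW del_gt0)// ler_nat cntS ltnS.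
  exact: leq_addr.
rewrite (le_trans yL)// ler_wpM2r ?(ltW del_gt0)// ler_nat cntS cnt_full// ltnS.
exact: leq_addr.
Qed.

(** Each point lies between [cnt] and [cnt + 1] steps, so the distance is at most one step more than
    the difference of counts. This converts mismatches between events into a distance. *)
Lemma grid_distance L (y z : R) : 0 <= y <= L%:R * del -> 0 <= z <= L%:R * del ->
  `|y - z| <= del * (1 + \sum_(m < L) ((m.+1%:R * del <= y) != (m.+1%:R * del <= z))%:R).
Proof.
move=> /andP[y0 yL] /andP[z0 zL].
have K : `|(cnt L y)%:R - (cnt L z)%:R : R| <=
    \sum_(m < L) ((m.+1%:R * del <= y) != (m.+1%:R * del <= z))%:R.
  rewrite /cnt !natr_sum -sumrB (le_trans (ler_norm_sum _ _ _))//.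
  apply: ler_sum => m _.
  by case: (_ <= y); case: (_ <= z); rewrite ?subrr ?normr0 ?subr0 ?sub0r ?normrN ?normr1.
have := cnt_upper L y0; have := cnt_lower yL; have := cnt_upper L z0; have := cnt_lower zL.
rewrite -!natr1 => h1 h2 h3 h4.
have d0 := del_gt0.
apply: (@le_trans _ _ (del * (1 + `|(cnt L y)%:R - (cnt L z)%:R|))); last first.
  by rewrite ler_wpM2l ?(ltW d0)// lerD2l.
have E : del * `|(cnt L y)%:R - (cnt L z)%:R| = `|(cnt L y)%:R * del - (cnt L z)%:R * del|.
  by rewrite -mulrBl normrM (gtr0_norm d0) mulrC.
rewrite mulrDr mulr1 E; move: h1 h2 h3 h4; rewrite !mulrDl !mul1r.
move: ((cnt L y)%:R * del) ((cnt L z)%:R * del) => A B h1 h2 h3 h4.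
have := ler_norm (A - B); have := ler_norm (- (A - B)); rewrite normrN => k1 k2.
by rewrite ler_norml; apply/andP; split; lra.
Qed.

Lemma grid_count L (c r : R) : 0 <= r ->
  \sum_(m < L) (`|m.+1%:R * del - c| <= r)%R%:R <= 2 * r / del + 1.
Proof.
move=> r0; have d0 := del_gt0.
pose S := (\sum_(m < L) (`|m.+1%:R * del - c| <= r)%R)%N.
rewrite -natr_sum -/S.
(* [i] and [j] are the first and last multiples counted so far; [S <= j - i + 1] is stated without
   natural-number subtraction. *)
have : S = 0%N \/ exists i j, [/\ (j <= L)%N, (S + i <= j + 1)%N,
    `|i%:R * del - c| <= r & `|j%:R * del - c| <= r].
  rewrite /S; elim: L {S} => [|L IH]; first by left; rewrite big_ord0.
  rewrite big_ord_recr/=; have [Lc|Lc] := boolP (`|L.+1%:R * del - c| <= r); last first.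
    rewrite addn0; case: IH => [->|[i [j [h1 h2 h3 h4]]]]; [by left|right].
    by exists i, j; split=> //; rewrite leqW.
  right; case: IH => [->|[i [j [h1 h2 h3 h4]]]].
    by exists L.+1, L.+1; split=> //; rewrite addnC.
  exists i, L.+1; split=> //; move: h1 h2.
  by set S' := (\sum_(_ < _) _)%N; rewrite /= => h1 h2; lia.
case=> [->|[i [j [_ h2 h3 h4]]]].
  by rewrite addr_ge0// divr_ge0 ?mulr_ge0// ltW.
move: h2; rewrite -(ler_nat R) !natrD => h2.
have : (j%:R - i%:R) * del <= 2 * r.
  rewrite mulrBl; move: h3 h4; rewrite !ler_norml => /andP[? ?] /andP[? ?]; lra.
rewrite -ler_pdivlMr//; lra.
Qed.

End grid.

(** * Bahadur representation *)

Section empirical.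
Context d (T : measurableType d) (R : realType) (P : probability T R).
Variables (X : nat -> {RV P >-> R}) (F g : R -> R) (a' b' : R).
Hypothesis indepX : mutually_independent X.
Hypothesis distX : forall i x, cdf (X i) x = (F x)%:E.
Hypothesis Fg : forall s : R, a' <= s <= b' -> F (expR (g s)) = 1 - s.
Hypothesis g_dec : forall s t : R, a' <= s -> s < t -> t <= b' -> g t < g s.

(** The pattern of thresholds passed by an observation. It is the finite-valued function to which
    the independence lemmas are applied. *)
Definition exceedances m (s : 'I_m -> R) (x : R) : {ffun 'I_m -> bool} :=
  [ffun l => expR (g (s l)) < x].

Lemma measurable_exceedances m (s : 'I_m -> R) (B : {ffun 'I_m -> bool}) :
  measurable (exceedances s @^-1` [set B]).
Proof.
have -> : exceedances s @^-1` [set B] =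
    \bigcap_(l in [set: 'I_m]) [set x | (expR (g (s l)) < x) = B l].
  apply/seteqP; split=> [x /= <- l _|x /= xB]; first by rewrite /= ffunE.
  by apply/ffunP => l; rewrite ffunE; exact: xB.
apply: fin_bigcap_measurable => // l _; case: (B l).
  have := measurable_itv `]expR (g (s l)), +oo[; congr measurable.
  by apply/seteqP; split => x /=; rewrite in_itv/= andbT.
have := measurable_itv `]-oo, expR (g (s l))]; congr measurable.
apply/seteqP; split => x /=; rewrite in_itv/=.
  by rewrite leNgt => /negbTE.
by move=> /negbT; rewrite -leNgt.
Qed.

Let exceed i t w : R := (expR (g t) < X i w)%R%:R.

Let exceedE i t : exceed i t = \1_(X i @^-1` `]expR (g t), +oo[).
Proof.
by apply/funext => w; rewrite indicE /exceed; congr ((_ : bool)%:R);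
  apply/idP/idP; rewrite inE/= in_itv/= andbT.
Qed.

Let mX i t : measurable (X i @^-1` `]expR (g t), +oo[).
Proof. by rewrite -[X in measurable X]setTI; exact: measurable_funPT. Qed.

Let mean_exceed i t : a' <= t <= b' -> \int[P]_w exceed i t w = t.
Proof.
move=> tab; rewrite exceedE mean_indic//.
have -> : X i @^-1` `]expR (g t), +oo[ = ~` (X i @^-1` `]-oo, expR (g t)]).
  by rewrite preimage_setC setCitvl.
rewrite fine_probC; last by rewrite -[X in measurable X]setTI; exact: measurable_funPT.
have := distX i (expR (g t)); rewrite /cdf /distribution/= /pushforward => ->.
by rewrite /= Fg//; ring.
Qed.

(** The thresholds are nested because [g] decreases, so the product of two indicators is the one at
    the smaller level. *)
Let mean_exceed2 i s t : a' <= s <= b' -> a' <= t <= b' ->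
  \int[P]_w (exceed i s w * exceed i t w) = Num.min s t.
Proof.
wlog st : s t / s <= t => [hw sab tab|sab tab].
  have [st|/ltW ts] := leP s t; first by rewrite hw// (min_idPl st).
  by under eq_Rintegral do rewrite mulrC; rewrite hw// (min_idPl ts).
rewrite (min_idPl st) -[RHS](mean_exceed i sab); apply: eq_Rintegral => w _.
rewrite /exceed; have [sX|] := boolP (expR (g s) < X i w); last by rewrite mul0r.
rewrite mul1r; suff -> : expR (g t) < X i w by [].
apply: le_lt_trans sX; rewrite ler_expR.
move: st; rewrite le_eqVlt => /orP[/eqP ->//|st].
by apply/ltW/g_dec => //; [case/andP: sab|case/andP: tab].
Qed.

(** Contribution of one observation, known by its pattern, to the combination with coefficients [c]
    of the deviations at the levels [s]. *)
Definition threshold_score m (s c : 'I_m -> R) (B : {ffun 'I_m -> bool}) : R :=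
  \sum_l c l * ((B l)%:R - s l).

Lemma threshold_scoreE m (s c : 'I_m -> R) i w :
  threshold_score s c (exceedances s (X i w)) = \sum_l c l * (exceed i (s l) w - s l).
Proof. by apply: eq_bigr => l _; rewrite ffunE. Qed.

Let bexceed i t : bounded_rv (exceed i t).
Proof. by rewrite exceedE; exact: bounded_rv_indic. Qed.

Let bcentered i t : bounded_rv (fun w => exceed i t w - t).
Proof. by apply: bounded_rvB => //; exact: bounded_rv_cst. Qed.

Lemma mean_threshold_score m (s c : 'I_m -> R) i : (forall l, a' <= s l <= b') ->
  \int[P]_w threshold_score s c (exceedances s (X i w)) = 0.
Proof.
move=> sab; under eq_Rintegral do rewrite threshold_scoreE.
rewrite mean_sum; last by move=> l _; exact: bounded_rvZ.
rewrite big1// => l _; rewrite meanZ// meanB//; last exact: bounded_rv_cst.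
by rewrite mean_exceed// mean_cst subrr mulr0.
Qed.

Lemma mean_sqr_threshold_score m (s c : 'I_m -> R) i : (forall l, a' <= s l <= b') ->
  \int[P]_w (threshold_score s c (exceedances s (X i w)) ^+ 2) =
  \sum_l \sum_k c l * c k * (Num.min (s l) (s k) - s l * s k).
Proof.
move=> sab.
have -> : \int[P]_w (threshold_score s c (exceedances s (X i w)) ^+ 2) =
  \int[P]_w (\sum_l \sum_k c l * c k *
     ((exceed i (s l) w - s l) * (exceed i (s k) w - s k))).
  apply: eq_Rintegral => w _; rewrite threshold_scoreE expr2 mulr_suml.
  apply: eq_bigr => l _; rewrite mulr_sumr; apply: eq_bigr => k _; ring.
have bp l k : bounded_rv (fun w => (exceed i (s l) w - s l) * (exceed i (s k) w - s k)).
  exact: bounded_rvM.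
rewrite mean_sum; last by move=> l _; apply: bounded_rv_sum => k _; exact: bounded_rvZ.
apply: eq_bigr => l _; rewrite mean_sum; last by move=> k _; exact: bounded_rvZ.
apply: eq_bigr => k _; rewrite meanZ//; congr (_ * _).
have -> : \int[P]_w ((exceed i (s l) w - s l) * (exceed i (s k) w - s k)) =
  \int[P]_w ((exceed i (s l) w * exceed i (s k) w - s k * exceed i (s l) w) -
             s l * (exceed i (s k) w - s k)).
  by apply: eq_Rintegral => w _; ring.
rewrite meanB; last 2 first.
- by apply: bounded_rvB; [exact: bounded_rvM|exact: bounded_rvZ].
- exact: bounded_rvZ.
rewrite meanB; [|exact: bounded_rvM|exact: bounded_rvZ].
rewrite !meanZ// meanB//; last exact: bounded_rv_cst.
by rewrite mean_exceed2// !mean_exceed// mean_cst; ring.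
Qed.

Definition empirical_deviation n (t : R) w : R :=
  (\sum_(i < n) ((expR (g t) < X i w)%R%:R - t)) / n%:R.

Local Notation D := empirical_deviation.

Lemma bounded_empirical_deviation n t : bounded_rv (D n t).
Proof.
have := bounded_rvZ (n%:R^-1) (bounded_rv_sum (index_enum 'I_n) (Q := xpredT)
  (F := fun i w => exceed i t w - t) (fun i _ => bcentered i t)).
by congr bounded_rv; apply/funext => w; rewrite /empirical_deviation mulrC.
Qed.

Lemma mean_sqr_deviations n m (s c : 'I_m -> R) : (0 < n)%N ->
  (forall l, a' <= s l <= b') ->
  \int[P]_w ((\sum_l c l * D n (s l) w) ^+ 2) =
  (\sum_l \sum_k c l * c k * (Num.min (s l) (s k) - s l * s k)) / n%:R.
Proof.
move=> n0 sab; have n0' : n%:R != 0 :> R by rewrite pnatr_eq0 -lt0n.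
have DE w : \sum_l c l * D n (s l) w =
    n%:R^-1 * \sum_(i < n) threshold_score s c (exceedances s (X i w)).
  under [in RHS]eq_bigr do rewrite threshold_scoreE.
  rewrite exchange_big/= mulr_sumr; apply: eq_bigr => l _.
  by rewrite /empirical_deviation -mulr_sumr /exceed; ring.
under eq_Rintegral do rewrite DE exprMn.
rewrite meanZ; last first.
  apply: bounded_rv_sqr; apply: bounded_rv_sum => i _.
  exact: (@bounded_rv_finite _ _ _ _ X _ _ (@measurable_exceedances m s)).
rewrite (mean_sqr_sum indepX (@measurable_exceedances m s)
  (s2 := \sum_l \sum_k c l * c k * (Num.min (s l) (s k) - s l * s k))).
- by field.
- by move=> i _; exact: mean_threshold_score.
- by move=> i _; exact: mean_sqr_threshold_score.
Qed.

Lemma mean_sqr_deviation n t : (0 < n)%N -> 0 <= a' -> b' <= 1 -> a' <= t <= b' ->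
  \int[P]_w (D n t w ^+ 2) <= n%:R^-1.
Proof.
move=> n0 a0 b1 tab.
have := @mean_sqr_deviations n 1 (fun=> t) (fun=> 1) n0 (fun=> tab).
rewrite !big_ord1 !mulr1 mul1r minxx => E.
have -> : \int[P]_w (D n t w ^+ 2) = (t - t * t) / n%:R.
  by rewrite -E; apply: eq_Rintegral => w _; rewrite big_ord1 mul1r.
rewrite -[leRHS]mul1r ler_wpM2r ?invr_ge0//.
have /andP[t0 t1] := tab.
have : 0 <= t * t by exact: sqr_ge0.
by lra.
Qed.

(** The coefficients 1 and -1 in [mean_sqr_deviations] give the exact value
    [(|t - u| - (t - u) ^+ 2) / n]. *)
Lemma mean_sqr_deviation_diff n t u : (0 < n)%N -> a' <= t <= b' -> a' <= u <= b' ->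
  \int[P]_w ((D n t w - D n u w) ^+ 2) <= `|t - u| / n%:R.
Proof.
move=> n0 tab uab.
pose s (l : 'I_2) := if l == ord0 then t else u.
pose c (l : 'I_2) : R := if l == ord0 then 1 else -1.
have sab l : a' <= s l <= b' by rewrite /s; case: ifP.
have := @mean_sqr_deviations n 2 s c n0 sab.
rewrite !big_ord_recl !big_ord0 /s /c/= !addr0 !minxx => E.
have -> : \int[P]_w ((D n t w - D n u w) ^+ 2) =
    (t + u - 2 * Num.min t u - (t - u) ^+ 2) / n%:R.
  transitivity (\int[P]_w (\sum_l c l * D n (s l) w) ^+ 2).
    by apply: eq_Rintegral => w _; rewrite !big_ord_recl big_ord0 /s /c/=; ring.
  rewrite E [Num.min u t]minC; ring.
rewrite ler_wpM2r ?invr_ge0//.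
have : 0 <= (t - u) ^+ 2 by exact: sqr_ge0.
by have [tu|tu] := leP t u => ?; [rewrite ler0_norm ?subr_le0//|rewrite gtr0_norm ?subr_gt0//]; lra.
Qed.

End empirical.

(** * Deterministic bound on the remainder *)

Section bahadur.
Context {R : realType}.
Variables (g g1 : R -> R) (a b a' b' C : R).
Hypotheses (a'_gt0 : 0 < a') (a'a : a' < a) (ab : a < b) (bb' : b < b') (b'_lt1 : b' < 1).
Hypotheses (C_gt0 : 0 < C) (g1L : lipschitz_itv a' b' C g1).
Hypothesis dg : forall s : R, a' <= s <= b' -> is_derive s 1 g (g1 s).
Hypothesis g1_lt0 : forall s : R, a' <= s <= b' -> g1 s < 0.

Let eta := Num.min (a - a') (b' - b).
Let C2 := C + 2 * C / eta.

Let eta_gt0 : 0 < eta.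
Proof. by rewrite lt_min !subr_gt0 a'a. Qed.

Lemma log_quantile_decreasing (s t : R) : a' <= s -> s < t -> t <= b' -> g t < g s.
Proof.
move=> s1 st t1; have [|c /andP[c1 c2] cE] := @is_derive_MVT R g g1 s t (ltW st).
  by move=> x /andP[x1 x2]; apply: dg; rewrite (le_trans s1)//= (le_trans x2).
rewrite -subr_lt0 cE pmulr_llt0 ?subr_gt0//; apply: g1_lt0.
by rewrite (le_trans s1)//= (le_trans c2).
Qed.

Let g_lip (s t : R) : a' <= s <= b' -> a' <= t <= b' -> `|g s - g t| <= C * `|s - t|.
Proof. by apply: is_derive_lipschitz dg _ => x; exact: g1L.1. Qed.

Let ab' : a' < b'.
Proof. by rewrite (lt_trans a'a)// (lt_trans ab). Qed.

Let clamp (v : R) := Num.max a' (Num.min b' v).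

Let clamp_itv v : a' <= clamp v <= b'.
Proof. by rewrite /clamp le_max lexx/= ge_max (ltW ab') ge_min lexx. Qed.

Let le_clamp t v : a' < t -> t <= b' -> (t <= clamp v) = (t <= v).
Proof. by move=> t1 t2; rewrite /clamp le_max le_min t2 [t <= a']leNgt t1. Qed.

Let clamp_dist u v : a' <= u <= b' -> `|clamp v - u| <= `|v - u|.
Proof.
move=> /andP[u1 u2]; rewrite /clamp; have h := ab'.
have [vb|bv] := leP b' v.
  rewrite (max_idPr (ltW h)) ger0_norm ?subr_ge0// ger0_norm ?subr_ge0 ?(le_trans u2)//.
  by rewrite lerB.
have [va|av] := leP a' v => //.
rewrite ler0_norm ?subr_le0// ler0_norm ?subr_le0 ?(le_trans (ltW av))//.
by rewrite lerN2 lerB// ltW.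
Qed.

(** For [|Z| < eta] the clamp is inactive, and the mean value theorem with Lipschitz [g1] gives
    [C * Z ^+ 2]. For larger [Z] both terms are at most [C * |Z|], and [|Z| <= Z ^+ 2 / eta], whence
    the part [2 * C / eta] of [C2]. The bound is thus quadratic for all [Z]. *)
Lemma taylor_remainder (u Z : R) : a <= u <= b ->
  `|g (clamp (u - Z)) - g u + g1 u * Z| <= C2 * Z ^+ 2.
Proof.
move=> /andP[au ub].
have uab' : a' <= u <= b' by rewrite (le_trans (ltW a'a))//= (le_trans ub)// ltW.
have C0 := C_gt0; have e0 := eta_gt0.
have Z2 : Z ^+ 2 = `|Z| * `|Z| by rewrite -expr2 real_normK ?num_real.
have C2E : C2 * Z ^+ 2 = C * (`|Z| * `|Z|) + 2 * C / eta * (`|Z| * `|Z|).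
  by rewrite /C2 mulrDl Z2.
have ZZ : 0 <= `|Z| * `|Z| by rewrite mulr_ge0.
have [Ze|Ze] := ltP `|Z| eta.
  have vab : a' <= u - Z <= b'.
    move: Ze; rewrite /eta lt_min !ltr_norml => /andP[/andP[z1 z2] /andP[z3 z4]].
    by apply/andP; split; lra.
  have -> : clamp (u - Z) = u - Z.
    move/andP: vab => [v1 v2]; rewrite /clamp (min_idPr v2); exact/max_idPr.
  have bound x : a' <= x <= b' -> `|x - u| <= `|Z| -> `|(g1 u - g1 x) * Z| <= C * (`|Z| * `|Z|).
    move=> xab xu; rewrite normrM mulrA ler_wpM2r//.
    rewrite (le_trans (g1L.2 _ _ uab' xab))// ler_wpM2l ?(ltW C0)//.
    by rewrite distrC.
  rewrite C2E (@le_trans _ _ (C * (`|Z| * `|Z|)))//; last first.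
    by rewrite lerDl mulr_ge0// divr_ge0 ?mulr_ge0// ltW.
  have [Z0|Z0] := leP 0 Z.
    have le : u - Z <= u by rewrite gerBl.
    have [|c /andP[c1 c2] cE] := @is_derive_MVT R g g1 _ _ le.
      move=> x /andP[x1 x2]; apply: dg; case/andP: vab => v1 v2.
      by rewrite (le_trans v1)//= (le_trans x2)//; case/andP: uab'.
    have -> : g (u - Z) - g u + g1 u * Z = (g1 u - g1 c) * Z.
      by rewrite -[g (u - Z) - g u]opprB cE; ring.
    apply: bound; first by case/andP: vab => v1 v2; rewrite (le_trans v1)//= (le_trans c2)//; case/andP: uab'.
    by rewrite (ger0_norm Z0) ler0_norm ?subr_le0//; lra.
  have le : u <= u - Z by rewrite lerBrDl gerDr ltW.
  have [|c /andP[c1 c2] cE] := @is_derive_MVT R g g1 _ _ le.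
    move=> x /andP[x1 x2]; apply: dg; case/andP: vab => v1 v2.
    by rewrite (le_trans _ x1) ?(le_trans x2)//; case/andP: uab'.
  have -> : g (u - Z) - g u + g1 u * Z = (g1 u - g1 c) * Z.
    by rewrite cE; ring.
  apply: bound; first by case/andP: vab => v1 v2; rewrite (le_trans _ c1) ?(le_trans c2)//; case/andP: uab'.
  by rewrite (ltr0_norm Z0) ger0_norm ?subr_ge0//; lra.
have h1 : `|g (clamp (u - Z)) - g u| <= C * `|Z|.
  rewrite (le_trans (g_lip (clamp_itv _) uab'))// ler_wpM2l ?(ltW C0)//.
  have := clamp_dist (u - Z) uab'.
  have -> : u - Z - u = - Z by ring.
  by rewrite normrN.
have h2 : `|g1 u * Z| <= C * `|Z| by rewrite normrM ler_wpM2r// g1L.1.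
have h3 : 2 * C * `|Z| <= 2 * C / eta * (`|Z| * `|Z|).
  by rewrite mulrA ler_wpM2r// mulrAC ler_pdivlMr// ler_wpM2l// ?mulr_ge0// ltW.
have h4 : 0 <= C * (`|Z| * `|Z|) by rewrite mulr_ge0// ltW.
rewrite C2E (le_trans (ler_normD _ _))//; lra.
Qed.

Variables (L : nat) (K : R).
Hypotheses (L_gt0 : (0 < L)%N) (K_ge1 : 1 <= K).

Let del := (b' - a') / L%:R.
Let node m := a' + m.+1%:R * del.

Let del_gt0 : 0 < del.
Proof. by rewrite divr_gt0 ?subr_gt0 ?ltr0n. Qed.

(* Bounds the number of grid nodes [t] on which [t + D t <= u] and [t <= u - D u]
   disagree, that is [|t - (u - D u)| <= |D t - D u|]: at most 3 lie within [del]
   of [u - D u]; the others have [del < |D t - D u|], and if moreover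
   [2 |D u| < |t - u|] then [|t - u| <= 2 |D t - D u|]. The last term counts the
   nodes with [K del < |t - u| <= 2 |D u|]. *)
Definition mismatch_bound (D : R -> R) (u : R) : R :=
  3 + \sum_(m < L) (if `|node m - u| <= K * del then (D (node m) - D u) ^+ 2 / del ^+ 2
                    else 4 * (D (node m) - D u) ^+ 2 / (node m - u) ^+ 2)
  + 12 * D u ^+ 2 / (K * del ^+ 2).

(** [y] is written [g U], where [U] is the level at which [t + D t] passes [u]; smallness of [D] at
    [a'] and [b'] puts [y] between [g b'] and [g a'], so that [U] exists. Were [D] constant near
    [u], [U] would be [V = u - D u]. The distance from [U] to the clamped [V] is measured by the
    grid nodes that separate them, and the passage from [V] to the linear term is Taylor's
    formula. *)
Lemma bahadur_remainder (D : R -> R) (y u : R) : a <= u <= b ->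
  (forall t, a' <= t <= b' -> (y <= g t) = (t + D t <= u)) ->
  `|D a'| < eta -> `|D b'| < eta ->
  `|y - g u + g1 u * D u| <= C * (del * (1 + mismatch_bound D u)) + C2 * D u ^+ 2.
Proof.
move=> uab yg Da Db; have /andP[au ub] := uab; have d0 := del_gt0.
have [A' [AB [C0 e0]]] : 0 < a' /\ a' < b' /\ 0 < C /\ 0 < eta.
  by rewrite a'_gt0 C_gt0 ab' eta_gt0.
have K0 : 0 < K by rewrite (lt_le_trans ltr01).
have aab : a' <= a' <= b' by rewrite lexx ltW.
have bab : a' <= b' <= b' by rewrite lexx ltW.
have yga : y <= g a'.
  rewrite yg//; move: Da; rewrite /eta lt_min => /andP[+ _].
  by rewrite ltr_norml => /andP[_]; lra.
have ygb : g b' <= y.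
  apply: ltW; rewrite ltNge yg// -ltNge; move: Db; rewrite /eta lt_min => /andP[_].
  by rewrite ltr_norml => /andP[+ _]; lra.
have [U Uab gU] : exists2 U, a' <= U <= b' & g U = y.
  have cg : {within `[a', b'], continuous g}.
    apply: derivable_within_continuous => x; rewrite in_itv/= => xab.
    exact: (@ex_derive _ _ _ _ _ _ _ (dg xab)).
  have := @IVT R g a' b' y (ltW AB) cg.
  rewrite (minEle (g a')) (maxEle (g a')).
  have -> : (g a' <= g b') = false.
    by apply/negbTE; rewrite -ltNge; apply: log_quantile_decreasing.
  rewrite ygb yga => /(_ isT)[U]; rewrite in_itv/= => UU gU; by exists U.
pose V := u - D u.
have UN t : a' <= t <= b' -> (t <= U) = (t + D t <= u).
  move=> tab; rewrite -yg// -gU; have [tU|Ut] := leP t U.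
    move: tU; rewrite le_eqVlt => /orP[/eqP ->|tU]; first by rewrite lexx.
    apply/esym/ltW/log_quantile_decreasing => //; [by case/andP: tab|by case/andP: Uab].
  apply/esym/negbTE; rewrite -ltNge; apply: log_quantile_decreasing => //.
    by case/andP: Uab.
  by case/andP: tab.
have Ldel : L%:R * del = b' - a' by rewrite mulrC divfK// pnatr_eq0 -lt0n.
have nodeI (m : 'I_L) : a' < node m /\ node m <= b'.
  split; first by rewrite ltrDl mulr_gt0// ltr0n.
  by rewrite -lerBrDl -Ldel ler_wpM2r ?(ltW d0)// ler_nat.
have UcV : `|U - clamp V| <= del * (1 + mismatch_bound D u).
  have -> : U - clamp V = (U - a') - (clamp V - a') by ring.
  have /andP[c1 c2] := clamp_itv V; have /andP[U1 U2] := Uab.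
  have := @grid_distance R del d0 L (U - a') (clamp V - a').
  rewrite Ldel !subr_ge0 U1 c1 !lerB// => /(_ isT isT) /le_trans; apply.
  rewrite ler_wpM2l ?(ltW d0)// lerD2l.
  pose far (m : 'I_L) := ~~ (`|node m - u| <= K * del) && (`|node m - u| <= 2 * `|D u|).
  apply: (@le_trans _ _ (\sum_(m < L) ((`|m.+1%:R * del - (V - a')| <= del)%R%:R +
     (if `|node m - u| <= K * del then (D (node m) - D u) ^+ 2 / del ^+ 2
      else 4 * (D (node m) - D u) ^+ 2 / (node m - u) ^+ 2) + (far m)%:R))).
    apply: ler_sum => m _; have [n1 n2] := nodeI m.
    have nab : a' <= node m <= b' by rewrite (ltW n1).
    have E1 : (m.+1%:R * del <= U - a') = (node m + D (node m) <= u).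
      by rewrite -UN// lerBrDl.
    (* The nodes lie in []a', b']], where clamping does not affect comparisons. *)
    have E2 : (m.+1%:R * del <= clamp V - a') = (node m <= V).
      by rewrite -(le_clamp V n1 n2) lerBrDl.
    rewrite E1 E2.
    have p0 : 0 <= (if `|node m - u| <= K * del then (D (node m) - D u) ^+ 2 / del ^+ 2
      else 4 * (D (node m) - D u) ^+ 2 / (node m - u) ^+ 2).
      by case: ifP => _; apply: divr_ge0; rewrite ?sqr_ge0// mulr_ge0 ?sqr_ge0.
    have [_|] := eqVneq (node m + D (node m) <= u) (node m <= V).
      by rewrite addr_ge0// addr_ge0.
    move=> mm; have AV : `|node m - V| <= `|D (node m) - D u|.
      rewrite /V; move: mm; rewrite /V; have [h1|h1] := leP (node m + D (node m)) u;
        have [h2|h2] := leP (node m) (u - D u) => // _.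
        by rewrite gtr0_norm ?subr_gt0// -normrN (le_trans _ (ler_norm _))//; lra.
      by rewrite ler0_norm ?subr_le0// (le_trans _ (ler_norm _))//; lra.
    have -> : m.+1%:R * del - (V - a') = node m - V by rewrite /node; ring.
    have [_|nV] := leP `|node m - V| del; first by rewrite /= -addrA lerDl addr_ge0.
    rewrite /= add0r /far; case: ifPn => [nu|nu] /=.
      rewrite addr0 ler_pdivlMr ?exprn_gt0// mul1r -[leRHS]real_normK ?num_real//.
      by rewrite ler_sqr ?nnegrE ?(ltW d0)// (le_trans (ltW nV)).
    have [//|uD] := leP `|node m - u| (2 * `|D u|).
      by rewrite lerDr; move: p0; rewrite (negbTE nu).
    rewrite addr0; have n0 : node m - u != 0.
      apply/eqP => n0; move: nu; rewrite n0 normr0 => /negP; apply.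
      by rewrite mulr_ge0// ltW.
    have n00 : 0 < (node m - u) ^+ 2 by rewrite exprn_even_gt0.
    rewrite ler_pdivlMr// mul1r.
    have -> : 4 * (D (node m) - D u) ^+ 2 = (2 * `|D (node m) - D u|) ^+ 2.
      by rewrite exprMn real_normK ?num_real//; ring.
    rewrite -[leLHS]real_normK ?num_real// ler_sqr ?nnegrE ?mulr_ge0//.
    have : `|node m - u| <= `|node m - V| + `|D u|.
      have -> : node m - u = (node m - V) - D u by rewrite /V; ring.
      exact: ler_normB.
    lra.
  rewrite !big_split/= /mismatch_bound; apply: lerD.
    rewrite lerD2r; apply: le_trans (grid_count d0 L (V - a') (ltW d0)) _.
    rewrite mulfK ?gt_eqF//; lra.
  have [DK|DK] := leP (2 * `|D u|) (K * del).
    rewrite big1.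
      by apply: divr_ge0; apply: mulr_ge0; rewrite ?sqr_ge0// ltW.
    move=> m _; rewrite /far; have [//|h1] := leP `|node m - u| (K * del).
    by have [h2|//] := leP `|node m - u| (2 * `|D u|); lra.
  apply: (@le_trans _ _ (\sum_(m < L) (`|m.+1%:R * del - (u - a')| <= 2 * `|D u|)%R%:R)).
    apply: ler_sum => m _; rewrite /far.
    have -> : m.+1%:R * del - (u - a') = node m - u by rewrite /node; ring.
    by rewrite ler_nat; case: (_ <= K * _) => //=.
  (* With [z = |D u|], at most [4 * z / del + 1 <= 6 * z / del] nodes lie within [2 * z] of [u]. The
     factor [2 * z / (K * del)], at least 1 in this case, makes the bound quadratic in [z] and
     yields the constant 12. *)
  have D0 : 0 <= 2 * `|D u| by rewrite mulr_ge0.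
  apply: le_trans (grid_count d0 L (u - a') D0) _.
  set z := `|D u| in DK D0 *.
  have Kd0 : 0 < K * del by exact: mulr_gt0.
  have z1 : 1 <= 2 * z / (K * del) by rewrite (ler_pdivlMr _ _ Kd0) mul1r ltW.
  have z2 : 1 <= 2 * z / del.
    by rewrite (ler_pdivlMr _ _ d0) mul1r (le_trans _ (ltW DK))// ler_peMl// ltW.
  apply: (@le_trans _ _ (6 * z / del * 1)); first by lra.
  have -> : 12 * D u ^+ 2 / (K * del ^+ 2) = 6 * z / del * (2 * z / (K * del)).
    by rewrite -[D u ^+ 2]real_normK ?num_real// -/z; field; rewrite !gt_eqF.
  apply: ler_wpM2l z1; apply: divr_ge0; last exact: ltW.
  by apply: mulr_ge0 => //; exact: normr_ge0.
have -> : y - g u + g1 u * D u = (g U - g (clamp V)) + (g (clamp V) - g u + g1 u * D u).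
  by rewrite gU; ring.
rewrite (le_trans (ler_normD _ _))// lerD//.
  by rewrite (le_trans (g_lip Uab (clamp_itv _)))// ler_wpM2l// ltW.
exact: taylor_remainder.
Qed.

End bahadur.

(** * Mean of the remainder bound *)

Section bahadur_mean.
Context d (T : measurableType d) (R : realType) (P : probability T R).
Variables (X : nat -> {RV P >-> R}) (F g g1 : R -> R) (a b a' b' C : R).
Hypothesis indepX : mutually_independent X.
Hypothesis distX : forall i x, cdf (X i) x = (F x)%:E.
Hypothesis Fg : forall s : R, a' <= s <= b' -> F (expR (g s)) = 1 - s.
Hypotheses (a'_gt0 : 0 < a') (a'a : a' < a) (ab : a < b) (bb' : b < b') (b'_lt1 : b' < 1).
Hypotheses (C_gt0 : 0 < C) (g1L : lipschitz_itv a' b' C g1).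
Hypothesis dg : forall s : R, a' <= s <= b' -> is_derive s 1 g (g1 s).
Hypothesis g1_lt0 : forall s : R, a' <= s <= b' -> g1 s < 0.

Local Notation D := (empirical_deviation X g).

Let ab' : a' < b'.
Proof. by rewrite (lt_trans a'a)// (lt_trans ab). Qed.

Let g_dec (s t : R) : a' <= s -> s < t -> t <= b' -> g t < g s.
Proof. exact: (log_quantile_decreasing dg g1_lt0). Qed.

Let bD n t : bounded_rv (D n t).
Proof. exact: bounded_empirical_deviation. Qed.

(** A node within [K * del] contributes at most [K / (n * del)], and there are at most [2 * K + 1]
    of these. A farther one contributes at most [4 / (n * |t - u|) <= 4 / (n * K * del)]; since
    [L * del < 1], all of them give at most [4 / (n * K * del ^+ 2)]. The term in [D u] adds 12 to
    this 4. *)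
Lemma mean_mismatch_bound n L (K u : R) (del := (b' - a') / L%:R) :
  (0 < n)%N -> (0 < L)%N -> 1 <= K -> a <= u <= b ->
  bounded_rv (fun w => mismatch_bound a' b' L K (fun t => D n t w) u) /\
  \int[P]_w mismatch_bound a' b' L K (fun t => D n t w) u <=
    3 + (2 * K + 1) * K / (n%:R * del) + 16 / (n%:R * K * del ^+ 2).
Proof.
move=> n0 L0 K1 /andP[au ub]; have h := ab'.
have uab : a' <= u <= b' by rewrite (le_trans (ltW a'a))//= (le_trans ub)// ltW.
have d0 : 0 < del by rewrite divr_gt0 ?subr_gt0 ?ltr0n.
have K0 : 0 < K by rewrite (lt_le_trans ltr01).
have nn0 : 0 < n%:R :> R by rewrite ltr0n.
have Ldel : L%:R * del = b' - a' by rewrite mulrC divfK// pnatr_eq0 -lt0n.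
pose t (m : 'I_L) := a' + m.+1%:R * del.
have tab m : a' <= t m <= b'.
  rewrite /t lerDl mulr_ge0 ?(ltW d0)//= -lerBrDl -Ldel ler_wpM2r ?(ltW d0)// ler_nat.
  exact: ltn_ord.
pose near m := `|t m - u| <= K * del.
pose Y m w := if near m then (D n (t m) w - D n u w) ^+ 2 / del ^+ 2
  else 4 * (D n (t m) w - D n u w) ^+ 2 / (t m - u) ^+ 2.
pose k m := if near m then (del ^+ 2)^-1 else 4 / (t m - u) ^+ 2.
have YE m w : Y m w = k m * (D n (t m) w - D n u w) ^+ 2.
  by rewrite /Y /k; case: ifP => _; ring.
have bS m : bounded_rv (fun w => (D n (t m) w - D n u w) ^+ 2).
  exact/bounded_rv_sqr/bounded_rvB.
have bY m : bounded_rv (Y m).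
  by have := bounded_rvZ (k m) (bS m); congr bounded_rv; apply/funext => w; rewrite YE.
have bsum : bounded_rv (fun w => \sum_m Y m w) by exact: bounded_rv_sum.
have bE : bounded_rv (fun w => 12 / (K * del ^+ 2) * D n u w ^+ 2).
  exact/bounded_rvZ/bounded_rv_sqr.
have ME : (fun w => mismatch_bound a' b' L K (fun t => D n t w) u) =
    (fun w => 3 + \sum_m Y m w + 12 / (K * del ^+ 2) * D n u w ^+ 2).
  by apply/funext => w; rewrite /mismatch_bound -/del [12 * _ / _]mulrAC.
clearbody del.
have b3 : bounded_rv (fun w => 3 + \sum_m Y m w) by apply: bounded_rvD => //; exact: bounded_rv_cst.
split; first by rewrite ME; exact: bounded_rvD.
under eq_Rintegral do rewrite (congr1 (fun h => h _) ME).
rewrite meanD// meanD//; last exact: bounded_rv_cst.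
rewrite mean_cst meanZ; last exact: bounded_rv_sqr.
rewrite mean_sum//.
have ED : \int[P]_w (D n u w ^+ 2) <= n%:R^-1.
  by apply: (mean_sqr_deviation indepX distX Fg g_dec n0 (ltW a'_gt0) (ltW b'_lt1)).
have EY m : \int[P]_w Y m w <= K / (n%:R * del) * (near m)%:R + 4 / (n%:R * K * del).
  under eq_Rintegral do rewrite YE.
  rewrite meanZ//.
  have := mean_sqr_deviation_diff indepX distX Fg g_dec n0 (tab m) uab.
  have q0 : 0 <= 4 / (n%:R * K * del) by rewrite divr_ge0// !mulr_ge0// ltW.
  rewrite /k; case: ifPn => [nr|]; last rewrite /near -ltNge => fr.
    move=> /(@ler_wpM2l _ (del ^+ 2)^-1); rewrite invr_ge0 sqr_ge0 => /(_ isT) /le_trans; apply.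
    rewrite mulr1 -[leLHS]addr0 lerD//.
    have -> : K / (n%:R * del) = (del ^+ 2)^-1 * (K * del / n%:R).
      by field; rewrite !gt_eqF.
    by rewrite ler_wpM2l ?invr_ge0 ?sqr_ge0// ler_wpM2r// invr_ge0 ltW.
  have tu0 : 0 < `|t m - u| by rewrite (lt_trans _ fr)// mulr_gt0.
  move=> /(@ler_wpM2l _ (4 / (t m - u) ^+ 2)); rewrite divr_ge0 ?sqr_ge0// => /(_ isT) /le_trans; apply.
  rewrite mulr0 add0r -[(t m - u) ^+ 2]real_normK ?num_real//.
  have -> : 4 / `|t m - u| ^+ 2 * (`|t m - u| / n%:R) = 4 / n%:R / `|t m - u|.
    by field; rewrite !gt_eqF.
  have -> : 4 / (n%:R * K * del) = 4 / n%:R / (K * del) by field; rewrite !gt_eqF.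
  rewrite ler_wpM2l ?divr_ge0 ?(ltW nn0)// lef_pV2 ?posrE ?mulr_gt0//; exact: ltW.
have S1 : \sum_m \int[P]_w Y m w <=
    (2 * K + 1) * K / (n%:R * del) + 4 / (n%:R * K * del ^+ 2).
  rewrite (le_trans (ler_sum _ (fun m _ => EY m)))// big_split/= -mulr_sumr.
  rewrite sumr_const card_ord -[_ *+ L]mulr_natl lerD//.
    rewrite mulrC -[leRHS]mulrA; apply: ler_wpM2r.
      by rewrite divr_ge0 ?mulr_ge0 ?ltW.
    have -> : \sum_m (near m)%:R = \sum_(m < L) (`|m.+1%:R * del - (u - a')| <= K * del)%R%:R :> R.
      by apply: eq_bigr => m _; rewrite /near /t; congr (_ <= _)%R%:R; congr `|_|; ring.
    apply: le_trans (grid_count d0 L (u - a') _) _; first by rewrite mulr_ge0 ?ltW.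
    by rewrite mulrA mulfK ?gt_eqF.
  have -> : L%:R * (4 / (n%:R * K * del)) = (b' - a') * (4 / (n%:R * K * del ^+ 2)).
    by rewrite -Ldel; field; rewrite !gt_eqF.
  rewrite ler_piMl ?divr_ge0 ?mulr_ge0 ?sqr_ge0 ?ltW//.
  have := a'_gt0; have := b'_lt1; lra.
have S2 : 12 / (K * del ^+ 2) * \int[P]_w (D n u w ^+ 2) <= 12 / (n%:R * K * del ^+ 2).
  apply: (@le_trans _ _ (12 / (K * del ^+ 2) * n%:R^-1)).
    by rewrite ler_wpM2l// divr_ge0// mulr_ge0 ?sqr_ge0 ?ltW.
  by rewrite le_eqVlt; apply/orP; left; apply/eqP; field; rewrite !gt_eqF.
have -> : 16 / (n%:R * K * del ^+ 2) = 4 / (n%:R * K * del ^+ 2) + 12 / (n%:R * K * del ^+ 2).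
  by rewrite -mulrDl; congr (_ / _); ring.
lra.
Qed.

Let mismatch_bound_ge0 L (K u : R) D' : 0 <= K -> 0 <= mismatch_bound a' b' L K D' u.
Proof.
move=> K0; apply: addr_ge0; last by rewrite divr_ge0// mulr_ge0// sqr_ge0.
apply: addr_ge0 => //; apply: sumr_ge0 => m _.
by case: ifP => _; apply: divr_ge0; rewrite ?sqr_ge0// mulr_ge0// sqr_ge0.
Qed.

Let eta := Num.min (a - a') (b' - b).
Let C2 := C + 2 * C / eta.

Let eta_gt0 : 0 < eta.
Proof. by rewrite lt_min !subr_gt0 a'a. Qed.

(** [Y u] does not depend on [y]. With [S = sqrt n], its mean times [S] is at most
    [4 * C * (S * del)], plus a term of order [1 / S], plus [16 * C / (K * (S * del))]. Hence the
    order of choices: [e1], the size of [S * del], for the first term; then [K], given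
    [S * del >= e1 / 2], for the last; then [n]. *)
Lemma bahadur_mean e : 0 < e -> exists N, forall n, (N <= n)%N ->
  exists Y : R -> T -> R, forall u, a <= u <= b ->
  [/\ bounded_rv (Y u), forall w, 0 <= Y u w, Num.sqrt n%:R * \int[P]_w Y u w <= e &
      forall w y, `|D n a' w| < eta -> `|D n b' w| < eta ->
      (forall t, a' <= t <= b' -> (y <= g t) = (t + D n t w <= u)) ->
      `|y - g u + g1 u * D n u w| <= Y u w].
Proof.
move=> e0; have C0 := C_gt0; have h := ab'; have et0 := eta_gt0.
have C20 : 0 < C2 by rewrite addr_gt0// divr_gt0// mulr_gt0.
pose e1 := e / (16 * (C + 1)).
have e10 : 0 < e1 by rewrite divr_gt0// mulr_gt0// addr_gt0.
pose K := 1 + 128 * C / (e * e1).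
have K1 : 1 <= K by rewrite lerDl divr_ge0// mulr_ge0// ltW.
have K0 : 0 < K by rewrite (lt_le_trans ltr01).
pose M := Num.max (e1 / (b' - a')) (Num.max 1 (4 * (C * ((2 * K + 1) * K) + C2) / e)).
exists (Num.truncn (M ^+ 2)).+1 => n Nn.
have M1 : 1 <= M by rewrite !le_max lexx orbT.
pose S := Num.sqrt n%:R : R.
have MS : M <= S.
  rewrite -[M]gtr0_norm ?(lt_le_trans ltr01)// -sqrtr_sqr ler_wsqrtr//.
  rewrite ltW// (lt_le_trans (Num.Theory.truncnS_gt _))// ler_nat//.
have S1 : 1 <= S by rewrite (le_trans M1).
have S0 : 0 < S by rewrite (lt_le_trans ltr01).
have SS : S ^+ 2 = n%:R by rewrite sqr_sqrtr.
have n0 : (0 < n)%N by apply: leq_trans Nn.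
(* The number of cells aimed at: [L] lies between [x] and [2 * x], which puts [S * del] between
   [e1 / 2] and [e1]. *)
pose x := S * (b' - a') / e1.
have x1 : 1 <= x.
  rewrite ler_pdivlMr// mul1r -ler_pdivrMr ?subr_gt0//.
  by rewrite (le_trans _ MS)// le_max lexx.
pose L := (Num.truncn x).+1.
have Lx : x < L%:R by exact: Num.Theory.truncnS_gt.
have xL : L%:R <= 2 * x.
  rewrite /L -natr1; have : (Num.truncn x)%:R <= x by rewrite truncn_le// (le_trans _ x1).
  lra.
have L0 : (0 < L)%N by [].
have LR : 0 < L%:R :> R by rewrite ltr0n.
pose del := (b' - a') / L%:R.
have d0 : 0 < del by rewrite divr_gt0 ?subr_gt0.
have xE : S * (b' - a') = x * e1 by rewrite divfK ?gt_eqF.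
have Sdel1 : S * del <= e1.
  rewrite /del mulrA ler_pdivrMr// xE mulrC ler_wpM2l ?ltW//.
have Sdel2 : e1 / 2 <= S * del.
  rewrite /del mulrA ler_pdivlMr// xE; have := ler_wpM2l (ltW e10) xL; lra.
exists (fun u w => C * (del * (1 + mismatch_bound a' b' L K (fun t => D n t w) u))
   + C2 * D n u w ^+ 2) => u uab.
have [bm Em] := mean_mismatch_bound n0 L0 K1 uab.
have uab' : a' <= u <= b'.
  by case/andP: uab => au ub; rewrite (le_trans (ltW a'a))//= (le_trans ub)// ltW.
have ED : \int[P]_w (D n u w ^+ 2) <= n%:R^-1.
  by apply: (mean_sqr_deviation indepX distX Fg g_dec n0 (ltW a'_gt0) (ltW b'_lt1)).
have bm1 : bounded_rv (fun w => 1 + mismatch_bound a' b' L K (fun t => D n t w) u).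
  by apply: bounded_rvD => //; exact: bounded_rv_cst.
have bD2 : bounded_rv (fun w => D n u w ^+ 2) by exact: bounded_rv_sqr.
split.
- by apply: bounded_rvD; [apply: bounded_rvZ; exact: bounded_rvZ|exact: bounded_rvZ].
- move=> w; rewrite addr_ge0// mulr_ge0 ?(ltW C0) ?(ltW C20) ?sqr_ge0//.
  by rewrite mulr_ge0 ?(ltW d0)// addr_ge0// mismatch_bound_ge0// ltW.
- rewrite meanD; [|by apply: bounded_rvZ; exact: bounded_rvZ|exact: bounded_rvZ].
  rewrite !meanZ//; last exact: bounded_rvZ.
  rewrite meanD//; last exact: bounded_rv_cst.
  rewrite mean_cst -/S.
  apply: (@le_trans _ _ (S * (C * (del * (1 + (3 + (2 * K + 1) * K / (n%:R * del) +
      16 / (n%:R * K * del ^+ 2)))) + C2 * n%:R^-1))).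
    rewrite ler_wpM2l ?(ltW S0)// lerD// ler_wpM2l ?(ltW C0) ?(ltW C20)//.
    by rewrite ler_wpM2l ?(ltW d0)// lerD2l.
  have -> : S * (C * (del * (1 + (3 + (2 * K + 1) * K / (n%:R * del) +
      16 / (n%:R * K * del ^+ 2)))) + C2 * n%:R^-1) =
      4 * C * (S * del) + (C * ((2 * K + 1) * K) + C2) / S + 16 * C / (K * (S * del)).
    by rewrite -SS; field; rewrite !gt_eqF.
  have t1 : 4 * C * (S * del) <= e / 4.
    apply: (@le_trans _ _ (4 * C * e1)); first by rewrite ler_wpM2l// mulr_ge0// ltW.
    have E1 : e1 * (16 * (C + 1)) = e by rewrite divfK// gt_eqF// mulr_gt0// addr_gt0.
    rewrite -E1 ler_pdivlMr//.
    by lra.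
  have t2 : (C * ((2 * K + 1) * K) + C2) / S <= e / 4.
    rewrite ler_pdivrMr// mulrAC ler_pdivlMr//.
    have : 4 * (C * ((2 * K + 1) * K) + C2) / e <= S.
      by rewrite (le_trans _ MS)// !le_max lexx !orbT.
    by rewrite ler_pdivrMr//; lra.
  have t3 : 16 * C / (K * (S * del)) <= e / 4.
    have KS0 : 0 < K * (S * del) by apply: mulr_gt0 => //; exact: mulr_gt0.
    rewrite (ler_pdivrMr _ _ KS0).
    apply: (@le_trans _ _ (e / 4 * (K * (e1 / 2)))); last first.
      rewrite ler_wpM2l ?divr_ge0 ?(ltW e0)//.
      by rewrite ler_wpM2l ?(ltW K0).
    have -> : e / 4 * (K * (e1 / 2)) = e * e1 / 8 + 16 * C.
      by rewrite /K; field; rewrite !gt_eqF.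
    by rewrite lerDr divr_ge0// mulr_ge0// ltW.
  lra.
- move=> w y Da Db yg.
  exact: (bahadur_remainder a'_gt0 a'a ab bb' C_gt0 g1L dg g1_lt0 L0 K1).
Qed.

End bahadur_mean.

(** * Limit of the variance *)

Section covariance_limit.
Context {R : realType}.
Variables (a b : R).
Hypotheses (a_gt0 : 0 < a) (ab : a < b) (b_lt1 : b < 1).

Lemma nb_obs_le n : (0 < n)%N -> (nb_obs a b n <= n)%N.
Proof.
move=> n0; have n0' : 0 < n%:R :> R by rewrite ltr0n.
have b0 : 0 < b by rewrite (lt_trans a_gt0).
suff : (last_index b n < n)%N by rewrite /nb_obs => h; rewrite (leq_trans (leq_subr _ _)).
rewrite -(ltr_nat R) /last_index natr_absz ger0_norm ?floor_ge0 ?mulr_ge0 ?ltW//.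
rewrite (le_lt_trans (floor_le _))// -[ltRHS]mulr1 ltr_pM2l//.
Qed.

Local Notation kappa s t := (Num.min s t - s * t).

Let kappa_le1 (s t : R) : a <= s <= b -> a <= t <= b -> `|kappa s t| <= 1.
Proof.
move=> /andP[s1 s2] /andP[t1 t2]; have a0 := a_gt0; have b1 := b_lt1.
have st0 : 0 <= s * t by rewrite mulr_ge0//; lra.
have st1 : s * t <= s by rewrite ler_piMr//; lra.
have st2 : s * t <= t by rewrite ler_piMl//; lra.
by rewrite ger0_norm; have [] := leP s t => ?; lra.
Qed.

Let kappaC (s t : R) : kappa s t = kappa t s.
Proof. by rewrite minC mulrC. Qed.

Let kappa_lip (s t t' : R) : a <= s <= b -> `|kappa s t - kappa s t'| <= 2 * `|t - t'|.
Proof.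
move=> /andP[s1 s2]; have a0 := a_gt0; have b1 := b_lt1.
have -> : kappa s t - kappa s t' = (Num.min s t - Num.min s t') - s * (t - t') by ring.
rewrite (le_trans (ler_normB _ _))// mulrDl mul1r lerD//; last first.
  by rewrite normrM ger0_norm ?ler_piMl//; lra.
have key (x y : R) : x <= y -> `|Num.min s x - Num.min s y| <= `|x - y|.
  move=> xy; rewrite (ler0_norm (x := x - y)) ?subr_le0//.
  by have [sx|sx] := leP s x; have [sy|sy] := leP s y; rewrite ler_norml; apply/andP; split; lra.
have [tt|/ltW tt] := leP t t'; first exact: key.
by rewrite distrC [leRHS]distrC; exact: key.
Qed.

Lemma covariance_kernel_lipschitz C (h : R -> R) s : 0 < C -> lipschitz_itv a b C h ->
  a <= s <= b -> lipschitz_itv a b (3 * C) (fun t => h t * kappa s t).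
Proof.
move=> C0 hC sab; split=> [t tab|t t' tab tab'].
    have := ler_pM (normr_ge0 _) (normr_ge0 _) (hC.1 t tab) (kappa_le1 sab tab).
    by rewrite normrM mulr1 => /le_trans; apply; lra.
  have -> : h t * kappa s t - h t' * kappa s t' =
      (h t - h t') * kappa s t + h t' * (kappa s t - kappa s t') by ring.
  rewrite (le_trans (ler_normD _ _))// !normrM.
  have := ler_pM (normr_ge0 _) (normr_ge0 _) (hC.2 t t' tab tab') (kappa_le1 sab tab).
  have := ler_pM (normr_ge0 _) (normr_ge0 _) (hC.1 t' tab') (kappa_lip t t' sab).
  by lra.
Qed.

(** Three errors of [e / 4]: coefficients against [f * h / n], inner sum against its integral [J],
    outer sum against its integral. The inner multiplier changes with the outer node, so the second
    step rests on uniformity over Lipschitz multipliers; the third rests on [J] being Lipschitz. *)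
Lemma covariance_form_cvg (f h : R -> R) (c : nat -> nat -> R) :
  riemann_integrable f a b -> itv_lipschitz a b h ->
  (forall e, 0 < e -> exists N, forall n, (N <= n)%N -> forall l, (l < nb_obs a b n)%N ->
     `|n%:R * c n l - f (node a n l) * h (node a n l)| <= e) ->
  \sum_(l < nb_obs a b n) \sum_(k < nb_obs a b n)
    c n l * c n k * kappa (node a n l) (node a n k) @[n --> \oo] -->
  riemann_integral (fun s => f s *
    (h s * riemann_integral (fun t => f t * (h t * kappa s t)) a b)) a b.
Proof.
move=> fi [C C0 hC] cE; have [B B0 fB] := riemann_integrable_bounded ab fi.
have h3 : 0 < 3 * C by rewrite mulr_gt0.
have inner s sab := covariance_kernel_lipschitz (s := s) C0 hC sab.
set J := fun s => riemann_integral (fun t => f t * (h t * kappa s t)) a b.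
have Jlip s s' : a <= s <= b -> a <= s' <= b -> `|J s - J s'| <= 2 * B * C * `|s - s'|.
  move=> sab sab'.
  have := @riemann_integral_dist _ a b ab f B (3 * C) _ _ (2 * C * `|s - s'|) fi h3 fB (inner s sab) (inner s' sab').
  move=> /(_ _)/le_trans; apply.
    move=> v vab; rewrite -mulrBr normrM mulrAC mulrC.
    rewrite ler_pM//; last exact: hC.1.
    by rewrite kappaC [kappa s' v]kappaC kappa_lip.
  have BC0 : 0 <= 2 * B * C * `|s - s'| by rewrite !mulr_ge0// ltW.
  have a0 := a_gt0; have b1 := b_lt1.
  have -> : B * (2 * C * `|s - s'|) * (b - a) = 2 * B * C * `|s - s'| * (b - a) by ring.
  by rewrite ler_piMr//; lra.
have aab : a <= a <= b by rewrite lexx ltW.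
pose CJ := `|J a| + 2 * B * C.
have BC0 : 0 < 2 * B * C by rewrite !mulr_gt0.
have CJ0 : 0 < CJ by rewrite ltr_wpDl.
have JL : lipschitz_itv a b CJ J.
  split=> [s sab|s s' sab sab']; last first.
    by rewrite (le_trans (Jlip _ _ sab sab'))// ler_wpM2r// lerDr.
  rewrite -[J s](subrK (J a)) addrC (le_trans (ler_normD _ _))// lerD2l.
  rewrite (le_trans (Jlip _ _ sab aab))// ler_piMr ?ltW//.
  by case/andP: sab => s1 s2; have a0 := a_gt0; have b1 := b_lt1; rewrite ger0_norm; lra.
have [CO CO0 OL] : itv_lipschitz a b (fun s => h s * J s).
  by apply: itv_lipschitzM; [exists C|exists CJ].
apply/cvgrPdist_le => e e0.
have e40 : 0 < e / 4 by rewrite divr_gt0.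
pose Q := B * C.
have Q0 : 0 < Q by rewrite mulr_gt0.
(* A product of two coefficients, each within [e1] of a limit of size at most [Q], is off by at most
   [e1 * (Q + e1) + Q * e1], hence by at most [e1 * (2 * Q + 1)] as [e1 <= 1]. *)
pose e1 := Num.min 1 (e / (4 * (2 * Q + 1))).
have e10 : 0 < e1 by rewrite lt_min ltr01/= divr_gt0// mulr_gt0// addr_gt0// mulr_gt0.
have e11 : e1 <= 1 by rewrite ge_min lexx.
have e12 : e1 * (2 * Q + 1) <= e / 4.
  have Q1 : 0 < 2 * Q + 1 by rewrite addr_gt0// mulr_gt0.
  rewrite -ler_pdivlMr// /e1 ge_min; apply/orP; right.
  by rewrite -mulrA -invfM.
pose e2 := e / (4 * Q).
have e20 : 0 < e2 by rewrite divr_gt0// mulr_gt0.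
have [N1 H1] := cE e1 e10.
have [N2 H2] := node_sum_uniform ab a_gt0 fi h3 e20.
have [N3 H3] := node_sum_uniform ab a_gt0 fi CO0 e40.
exists (maxn 1 (maxn N1 (maxn N2 N3))) => // n /=; rewrite !geq_max => /and4P[n0 n1 n2 n3].
have nn0 : 0 < n%:R :> R by rewrite ltr0n.
set m := nb_obs a b n.
have mn : m%:R <= n%:R :> R by rewrite ler_nat nb_obs_le.
have sab (l : 'I_m) : a <= node a n l <= b by rewrite node_ge// node_le.
pose q l := f (node a n l) * h (node a n l).
have qQ (l : 'I_m) : `|q l| <= Q by rewrite normrM ler_pM ?fB ?hC.1.
have avg (z : 'I_m -> R) (r : R) : 0 <= r -> (forall l, `|z l| <= r) -> `|\sum_l z l / n%:R| <= r.
  move=> r0 zr; rewrite (le_trans (ler_norm_sum _ _ _))//.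
  apply: (@le_trans _ _ (\sum_(l < m) r / n%:R)).
    by apply: ler_sum => l _; rewrite normrM (ger0_norm (x := n%:R^-1)) ?invr_ge0// ler_wpM2r ?invr_ge0.
  rewrite sumr_const card_ord -[_ *+ m]mulr_natr -mulrA mulrC.
  by rewrite ler_piMl// mulrC ler_pdivrMr// mul1r.
have e4 : 0 <= e / 4 by exact: ltW.
have cq (l : 'I_m) : `|n%:R * c n l - q l| <= e1 by exact: H1.
have cQ (l : 'I_m) : `|n%:R * c n l| <= Q + e1.
  rewrite -[n%:R * c n l](subrK (q l)) (le_trans (ler_normD _ _))// addrC lerD//.
set S := \sum_l \sum_k _.
have SE : S = \sum_(l < m) (\sum_(k < m)
    ((n%:R * c n l) * (n%:R * c n k) * kappa (node a n l) (node a n k)) / n%:R) / n%:R.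
  apply: eq_bigr => l _; rewrite mulr_suml; apply: eq_bigr => k _.
  by field; rewrite gt_eqF.
have step1 : `|S - \sum_(l < m) (\sum_(k < m)
    (q l * q k * kappa (node a n l) (node a n k)) / n%:R) / n%:R| <= e / 4.
  rewrite SE -sumrB.
  under eq_bigr do rewrite -mulrBl -sumrB.
  apply: (avg) => // l; under eq_bigr do rewrite -mulrBl.
  apply: (avg) => // k; apply: le_trans e12.
  rewrite -mulrBl normrM.
  have -> : n%:R * c n l * (n%:R * c n k) - q l * q k =
    (n%:R * c n l - q l) * (n%:R * c n k) + q l * (n%:R * c n k - q k) by ring.
  have k1 := kappa_le1 (sab l) (sab k).
  rewrite (le_trans (ler_piMr _ k1))// (le_trans (ler_normD _ _))//.
  rewrite [X in X + _ <= _]normrM [X in _ + X <= _]normrM.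
  have := ler_pM (normr_ge0 _) (normr_ge0 _) (cq l) (cQ k).
  have := ler_pM (normr_ge0 _) (normr_ge0 _) (qQ l) (cq k).
  have : e1 * e1 <= e1 by rewrite ler_piMr// ltW.
  by lra.
have step2 : `|\sum_(l < m) (\sum_(k < m)
    (q l * q k * kappa (node a n l) (node a n k)) / n%:R) / n%:R -
    \sum_(l < m) (q l * J (node a n l)) / n%:R| <= e / 4.
  rewrite -sumrB; under eq_bigr do rewrite -mulrBl.
  apply: (avg) => // l.
  have -> : \sum_(k < m) q l * q k * kappa (node a n l) (node a n k) / n%:R =
    q l * \sum_(k < m) f (node a n k) * (h (node a n k) * kappa (node a n l) (node a n k)) / n%:R.
    by rewrite mulr_sumr; apply: eq_bigr => k _; rewrite /q; ring.
  rewrite -mulrBr normrM.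
  have := ler_pM (normr_ge0 _) (normr_ge0 _) (qQ l) (H2 n n2 _ (inner _ (sab l))).
  move=> /le_trans; apply.
  by rewrite /e2 le_eqVlt; apply/orP; left; apply/eqP; field; rewrite gt_eqF.
have step3 := H3 n n3 _ OL.
have S3E : \sum_(l < m) (q l * J (node a n l)) / n%:R =
    \sum_(i < m) f (node a n i) * (h (node a n i) * J (node a n i)) / n%:R.
  by apply: eq_bigr => l _; rewrite /q; ring.
rewrite S3E in step2; rewrite distrC.
have := ler_normD (S - \sum_(l < m) (\sum_(k < m)
    (q l * q k * kappa (node a n l) (node a n k)) / n%:R) / n%:R)
  (\sum_(l < m) (\sum_(k < m)
    (q l * q k * kappa (node a n l) (node a n k)) / n%:R) / n%:R -
   \sum_(i < m) f (node a n i) * (h (node a n i) * J (node a n i)) / n%:R).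
rewrite addrA subrK => T1.
have := ler_normD (S - \sum_(i < m) f (node a n i) * (h (node a n i) * J (node a n i)) / n%:R)
  (\sum_(i < m) f (node a n i) * (h (node a n i) * J (node a n i)) / n%:R -
   riemann_integral (fun s => f s * (h s * J s)) a b).
by rewrite addrA subrK => T2; lra.
Qed.

(** As [- g1] is [1 / (Q * fQ)], the product [wt * h] is [G_R] over [Q * fQ]. Splitting off the
    merely integrable [wt] from the Lipschitz [h] gives the integral the form of the limit in
    [covariance_form_cvg]. *)
Lemma asymptotic_varianceE (pt : nat) (wt F g g1 : R -> R)
  (h := fun u => - (g1 u * \sum_(j < pt.+2) invmx (limit_mx a b pt wt) ord0 j * regressor j u)) :
  riemann_integrable wt a b -> itv_lipschitz a b g1 ->
  (forall s, a <= s <= b -> quantile F (1 - s) = (expR (g s))%:E) ->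
  (forall s, a <= s <= b -> density_quantile F (1 - s) * expR (g s) * g1 s = -1) ->
  itv_lipschitz a b h /\
  asymptotic_variance a b pt wt F = riemann_integral (fun s => wt s *
    (h s * riemann_integral (fun t => wt t * (h t * kappa s t)) a b)) a b.
Proof.
move=> wi g1L Qg dg.
have hL : itv_lipschitz a b h.
  have := itv_lipschitzM (itv_lipschitz_cst a b (-1)) (itv_lipschitzM g1L
    (itv_lipschitz_sum (index_enum 'I_pt.+2) xpredT (fun j => itv_lipschitzM
     (itv_lipschitz_cst a b (invmx (limit_mx a b pt wt) ord0 j))
     (itv_lipschitz_regressor j a_gt0 (ltW ab))))).
  by congr itv_lipschitz; apply/funext => u; rewrite mulN1r.
split=> //; have [C C0 hC] := hL.
apply: eq_riemann_integral => // s sab.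
have [l lE] := riemann_integrable_mul ab wi (mulr_gt0 (ltr0n R 3) C0)
  (covariance_kernel_lipschitz C0 hC sab).
rewrite (riemann_integralE ab lE) mulrA; apply: (riemann_integralE ab).
apply: eq_is_riemann_integral (is_riemann_integralZ _ lE) => // t tab.
have gE u : a <= u <= b -> g1 u = - (density_quantile F (1 - u) * expR (g u))^-1 /\
    density_quantile F (1 - u) != 0.
  move=> uab; have := dg u uab; set x := density_quantile _ _.
  have [->|x0] := eqVneq x 0; first by rewrite !mul0r => /eqP; rewrite eq_sym oppr_eq0 oner_eq0.
  have e0 : expR (g u) != 0 by rewrite gt_eqF ?expR_gt0.
  move=> E; split=> //; apply: (mulfI (mulf_neq0 x0 e0)).
  by rewrite E mulrN divff// mulf_neq0.
have [g1s ds] := gE s sab; have [g1t dt] := gE t tab.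
rewrite /h /weight_kernel !Qg//= g1s g1t.
(* The Brownian bridge covariance is invariant under reflection of both levels. *)
have -> : Num.min (1 - s) (1 - t) - (1 - s) * (1 - t) = kappa s t.
  by have [st|st] := leP s t; have [st'|st'] := leP (1 - s) (1 - t); lra.
have [es et] : expR (g s) != 0 /\ expR (g t) != 0 by rewrite !gt_eqF ?expR_gt0.
by field; rewrite ds dt es et.
Qed.

End covariance_limit.

(** * Limit of the estimator *)

Section measurability.
Context d (T : measurableType d) (R : realType) (P : probability T R).
Variable X : nat -> {RV P >-> R}.

(** A superlevel set of an order statistic is a superlevel set of a finite sum of indicators. An
    index out of range gives the constant default of [nth]. *)
Lemma measurable_order_stat n k :
  measurable_fun [set: T] (fun w => order_stat (fun i => X i w) n k).
Proof.
have [kn|kn] := ltnP k.-1 n; last first.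
  have -> : (fun w => order_stat (fun i => X i w) n k) = (fun=> 0).
    by apply/funext => w; rewrite /order_stat nth_default// size_sort size_mkseq.
  exact: measurable_cst.
pose j := (n - k.-1.+1)%N.
have jn : (j < n)%N by rewrite /j; lia.
have nj : (n - j)%N = k.-1.+1 by rewrite /j; lia.
have kE x : order_stat x n k = order_stat x n (n - j) :> R by rewrite nj.
pose N y w : R := \sum_(i < n) (y < X i w)%R%:R.
have mN y : measurable_fun [set: T] (N y).
  apply: measurable_sum => i.
  have -> : (fun w => (y < X i w)%R%:R) = \1_[set w | y < X i w] :> (T -> R).
    by apply/funext => w; rewrite indicE; congr ((_ : bool)%:R); apply/idP/idP; rewrite inE.
  by apply: measurable_indic; apply: measurable_ltr; exact: measurable_funPT.
apply: (measurability (RGenOInfty.G (R := R)) (RGenOInfty.measurableE R)) => //.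
move=> _ [_ [y ->] <-].
have E w : (y < order_stat (fun i => X i w) n k) = (j%:R < N y w).
  by rewrite ltNge kE order_stat_le// /N -natr_sum ltr_nat -ltnNge.
have -> : [set: T] `&` (fun w => order_stat (fun i => X i w) n k) @^-1` `]y, +oo[ =
    [set w | j%:R < N y w].
  by rewrite setTI; apply/seteqP; split=> w /=; rewrite in_itv/= andbT E.
exact: measurable_ltr.
Qed.

Lemma measurable_wls_estimator a b pt (wt : R -> R) n :
  measurable_fun [set: T] (fun w => wls_estimator a b pt wt (fun i => X i w) n).
Proof.
under eq_fun do rewrite wls_estimatorE.
apply: measurable_sum => l.
apply: measurable_funM; first exact: measurable_cst.
apply: (measurableT_comp (@measurable_ln R)).
rewrite /empirical_quantile; case: pickP => [k _|_]; last exact: measurable_cst.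
exact: measurable_order_stat.
Qed.

End measurability.

Section estimator_limit.
Context d (T : measurableType d) (R : realType) (P : probability T R).
Variables (X : nat -> {RV P >-> R}) (F g g1 : R -> R) (a b a' b' C : R).
Hypothesis indepX : mutually_independent X.
Hypothesis distX : forall i x, cdf (X i) x = (F x)%:E.
Hypothesis Fg : forall s : R, a' <= s <= b' -> F (expR (g s)) = 1 - s.
Hypotheses (a'_gt0 : 0 < a') (a'a : a' < a) (ab : a < b) (bb' : b < b') (b'_lt1 : b' < 1).
Hypotheses (C_gt0 : 0 < C) (g1L : lipschitz_itv a' b' C g1).
Hypothesis dg : forall s : R, a' <= s <= b' -> is_derive s 1 g (g1 s).
Hypothesis g1_lt0 : forall s : R, a' <= s <= b' -> g1 s < 0.
Variables (pt : nat) (wt : R -> R) (beta : 'I_pt.+2 -> R).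
Hypothesis wt_int : riemann_integrable wt a b.
Hypothesis M_unit : limit_mx a b pt wt \in unitmx.
Hypothesis g_regression : forall s : R, a <= s <= b ->
  g s = \sum_(j < pt.+2) beta j * regressor j s.

Local Notation D := (empirical_deviation X g).
Local Notation c := (wls_weight a b pt wt).
Local Notation m n := (nb_obs a b n).
Local Notation s n l := (node a n l).

Let a_gt0 : 0 < a. Proof. exact: lt_trans a'a. Qed.
Let b_lt1 : b < 1. Proof. exact: lt_trans b'_lt1. Qed.

(** Coefficient of the deviation at node [l] in the linear part of the error: least squares weight
    times the slope [- g1] of the expansion. *)
Definition score_weight n l : R := - (g1 (s n l) * c n l).

Local Notation score n := (threshold_score (fun l : 'I_(m n) => s n l)
  (fun l : 'I_(m n) => score_weight n l)).
Local Notation index n := (exceedances g (fun l : 'I_(m n) => s n l)).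

Let g_dec (u v : R) : a' <= u -> u < v -> v <= b' -> g v < g u.
Proof. exact: (log_quantile_decreasing dg g1_lt0). Qed.

Let s_itv n l : (0 < n)%N -> (l < m n)%N -> a <= s n l <= b.
Proof. by move=> n0 lm; rewrite node_ge// node_le. Qed.

Let ab_itv u : a <= u <= b -> a' <= u <= b'.
Proof. by move=> /andP[h1 h2]; rewrite (le_trans (ltW a'a) h1) (le_trans h2 (ltW bb')). Qed.

Lemma wls_weight_bounded : exists2 B, 0 < B & exists N, forall n, (N <= n)%N ->
  forall l, (l < m n)%N -> `|c n l| <= B / n%:R.
Proof.
have [N HN] := wls_weight_cvg a_gt0 ab wt_int M_unit ltr01.
have [A A0 wA] := riemann_integrable_bounded ab wt_int.
have [E E0 EL] := itv_lipschitz_sum (index_enum 'I_pt.+2) xpredT (fun j => itv_lipschitzM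
     (itv_lipschitz_cst a b (invmx (limit_mx a b pt wt) ord0 j))
     (itv_lipschitz_regressor j a_gt0 (ltW ab))).
exists (A * E + 1); first by rewrite addr_gt0// mulr_gt0.
exists N.+1 => n Nn l lm; have n0 : (0 < n)%N by exact: leq_trans Nn.
rewrite ler_pdivlMr ?ltr0n// mulrC -[n%:R]ger0_norm// -normrM.
rewrite -[n%:R * _](subrK (weight_kernel a b pt wt (s n l))) (le_trans (ler_normD _ _))//.
rewrite addrC lerD//; last by apply: HN => //; exact: ltnW.
by rewrite normrM ler_pM// ?wA ?EL.1 ?s_itv.
Qed.

Lemma score_weight_cvg e : 0 < e -> exists N, forall n, (N <= n)%N ->
  forall l, (l < m n)%N ->
  `|n%:R * score_weight n l - wt (s n l) * - (g1 (s n l) *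
     \sum_(j < pt.+2) invmx (limit_mx a b pt wt) ord0 j * regressor j (s n l))| <= e.
Proof.
move=> e0; have [N HN] := wls_weight_cvg a_gt0 ab wt_int M_unit (divr_gt0 e0 C_gt0).
exists N.+1 => n Nn l lm; have n0 : (0 < n)%N by exact: leq_trans Nn.
have -> : n%:R * score_weight n l - wt (s n l) * - (g1 (s n l) *
     \sum_(j < pt.+2) invmx (limit_mx a b pt wt) ord0 j * regressor j (s n l)) =
   - (g1 (s n l) * (n%:R * c n l - weight_kernel a b pt wt (s n l))).
  by rewrite /score_weight /weight_kernel; ring.
rewrite normrN normrM -[e](divfK (lt0r_neq0 C_gt0)) [leRHS]mulrC ler_pM//.
  by apply: g1L.1; apply: ab_itv; exact: s_itv.
by apply: HN => //; exact: ltnW.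
Qed.

Lemma log_empirical_quantile_le n l w t : (0 < n)%N -> (l < m n)%N ->
  `|D n b' w| < b' - b -> a' <= t <= b' ->
  (ln (empirical_quantile (fun i => X i w) n (1 - s n l)) <= g t) = (t + D n t w <= s n l).
Proof.
move=> n0 lm Db tab; have /andP[_ sb] := s_itv n0 lm; have b1 := b_lt1.
have n0' : 0 < n%:R :> R by rewrite ltr0n.
rewrite /node in sb *; set j := (first_index a n + l)%N in sb *.
have jn : (j < n)%N.
  by rewrite -(ltr_nat R) -[ltRHS]mul1r -ltr_pdivrMr// (le_lt_trans sb).
rewrite empirical_quantileE//; set y := order_stat _ _ _.
have key v : (y <= expR (g v)) = (v + D n v w <= j%:R / n%:R).
  rewrite /y order_stat_le// /empirical_deviation sumrB sumr_const card_ord.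
  rewrite -[_ *+ n]mulr_natr mulrBl mulfK ?gt_eqF// addrC subrK.
  by rewrite ler_pM2r ?invr_gt0// -natr_sum ler_nat.
(* Comparing through [ln] requires [y > 0]. A value at most 0 would lie below [expR (g b')], so that
   [b' + D n b' w] would be at most the node, hence at most [b], against the small deviation at
   [b']. *)
have y0 : 0 < y.
  rewrite ltNge; apply/negP => /le_trans /(_ (expR_ge0 (g b'))); rewrite key.
  by move: Db; rewrite ltr_norml => /andP[h1 _] h2; lra.
by rewrite -key -ler_expR lnK.
Qed.

(** Exactness writes [beta ord0] as the weighted sum of [g] over the nodes. Exchanging the sums over
    nodes and observations turns the linear part into a normalized sum over observations. *)
Lemma wls_linearization n w : (0 < n)%N -> gram_mx a b pt wt n \in unitmx ->
  Num.sqrt n%:R * (wls_estimator a b pt wt (fun i => X i w) n - beta ord0) -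
    normalized_sum X (index n) (score n) n w =
  Num.sqrt n%:R * \sum_(l < m n) c n l *
    (ln (empirical_quantile (fun i => X i w) n (1 - s n l)) - g (s n l) +
     g1 (s n l) * D n (s n l) w).
Proof.
move=> n0 Gu; have n0' : 0 < n%:R :> R by rewrite ltr0n.
have q0 : 0 < Num.sqrt n%:R :> R by rewrite sqrtr_gt0.
rewrite -(wls_weight_exact beta Gu) wls_estimatorE -sumrB.
have -> : normalized_sum X (index n) (score n) n w =
    Num.sqrt n%:R * \sum_(l < m n) score_weight n l * D n (s n l) w.
  rewrite /normalized_sum /threshold_score exchange_big/=.
  rewrite mulr_suml mulr_sumr; apply: eq_bigr => l _.
  rewrite -mulr_sumr /empirical_deviation.
  under eq_bigr do rewrite ffunE.
  have E : n%:R = Num.sqrt n%:R * Num.sqrt n%:R :> R by rewrite -expr2 sqr_sqrtr.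
  by rewrite [X in _ * (_ * (_ / X))]E; field; rewrite gt_eqF.
rewrite -mulrBr -sumrB; congr (_ * _); apply: eq_bigr => l _.
rewrite g_regression ?s_itv// /score_weight; ring.
Qed.

Let eta := Num.min (a - a') (b' - b).

Let eta_gt0 : 0 < eta.
Proof. by rewrite lt_min !subr_gt0 a'a. Qed.

(** Unless the deviation at [a'] or [b'] reaches [eta], which has probability at most [r / 4] for
    each by Chebyshev's inequality, the remainder is at most the weighted sum of the bounds [Y].
    That sum has mean at most [B * e1 = r * e / 2], so Markov's inequality leaves [r / 2]. *)
Lemma wls_remainder e : 0 < e ->
  fine (P [set w | e <= `|Num.sqrt n%:R *
     (wls_estimator a b pt wt (fun i => X i w) n - beta ord0) -
      normalized_sum X (index n) (score n) n w|]) @[n --> \oo] --> 0.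
Proof.
move=> e0; apply/cvgrPdist_le => r r0; have et0 := eta_gt0.
have [B B0 [N1 H1]] := wls_weight_bounded.
have [N2 H2] := gram_mx_unit a_gt0 ab wt_int M_unit.
pose e1 := r * e / (2 * B).
have e10 : 0 < e1 by rewrite !mulr_gt0// invr_gt0 mulr_gt0.
have [N3 H3] := bahadur_mean indepX distX Fg a'_gt0 a'a ab bb' b'_lt1 C_gt0 g1L dg g1_lt0 e10.
pose N4 := (Num.truncn (4 / (r * eta ^+ 2))).+1.
exists (maxn 1 (maxn N1 (maxn N2 (maxn N3 N4)))) => // n /=.
rewrite !geq_max => /and5P[n0 n1 n2 /H3[Y HY] n4].
have n0' : 0 < n%:R :> R by rewrite ltr0n.
rewrite sub0r normrN ger0_norm ?fine_prob_ge0//.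
set A := [set w | _].
pose S w := Num.sqrt n%:R * \sum_(l < m n) `|c n l| * Y (s n l) w.
have bYl (l : 'I_(m n)) : bounded_rv (Y (s n l)) by have [] := HY _ (s_itv n0 (ltn_ord l)).
have bsum : bounded_rv (fun w => \sum_(l < m n) `|c n l| * Y (s n l) w).
  by apply: bounded_rv_sum => l _; exact: bounded_rvZ.
have bS : bounded_rv S by exact: bounded_rvZ.
have S0 w : 0 <= S w.
  rewrite mulr_ge0// sumr_ge0// => l _; rewrite mulr_ge0//.
  by have [_ + _ _] := HY _ (s_itv n0 (ltn_ord l)); exact.
have bD t : bounded_rv (D n t) by exact: bounded_empirical_deviation.
have mA : measurable A.
  apply: measurable_ler; apply: (measurableT_comp (@normr_measurable R setT)).
  apply: measurable_funB.
    apply: measurable_funM; first exact: measurable_cst.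
    by apply: measurable_funB; [exact: measurable_wls_estimator|exact: measurable_cst].
  exact: (bounded_rv_normalized_sum X (measurable_exceedances _ _) _ n).1.
pose A1 := [set w | e <= S w].
pose A2 := [set w | eta <= `|D n a' w|].
pose A3 := [set w | eta <= `|D n b' w|].
have mA1 : measurable A1 by apply: measurable_ler; exact: bS.1.
have mA2 : measurable A2 by apply: measurable_ler; exact: (bounded_rv_norm (bD a')).1.
have mA3 : measurable A3 by apply: measurable_ler; exact: (bounded_rv_norm (bD b')).1.
have sub : A `<=` A1 `|` (A2 `|` A3).
  move=> w; rewrite /A/= => eA.
  have [Da|Da] := ltP `|D n a' w| eta; last by right; left.
  have [Db|Db] := ltP `|D n b' w| eta; last by right; right.
  left; apply: (le_trans eA); rewrite wls_linearization//; last exact: H2.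
  rewrite /S normrM ger0_norm// ler_wpM2l// (le_trans (ler_norm_sum _ _ _))//.
  apply: ler_sum => l _; rewrite normrM ler_wpM2l//.
  have [_ _ _ +] := HY _ (s_itv n0 (ltn_ord l)); apply=> // t tab.
  by apply: log_empirical_quantile_le => //; move: Db; rewrite lt_min => /andP[].
have P1 : fine (P A1) <= r / 2.
  apply: le_trans (markov_bounded P bS S0 e0) _; rewrite ler_pdivrMr//.
  rewrite /S meanZ// mean_sum; last by move=> l _; exact: bounded_rvZ.
  rewrite mulr_sumr.
  apply: (@le_trans _ _ (\sum_(l < m n) B / n%:R * e1)).
    apply: ler_sum => l _; rewrite meanZ// mulrCA ler_pM//.
    - by rewrite mulr_ge0// Rintegral_ge0// => w _; have [_ + _ _] := HY _ (s_itv n0 (ltn_ord l)); exact.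
    - exact: H1.
    - by have [_ _ + _] := HY _ (s_itv n0 (ltn_ord l)); exact.
  rewrite sumr_const card_ord -[_ *+ m n]mulr_natr.
  apply: (@le_trans _ _ (B / n%:R * e1 * n%:R)).
    apply: ler_wpM2l (mulr_ge0 (divr_ge0 (ltW B0) (ltW n0')) (ltW e10)) _ _ _.
    by rewrite ler_nat nb_obs_le.
  rewrite /e1 le_eqVlt; apply/orP; left; apply/eqP; field; rewrite !gt_eqF//.
have PD t : a' <= t <= b' -> fine (P [set w | eta <= `|D n t w|]) <= r / 4.
  move=> tab; apply: le_trans (chebyshev_bounded P (bD t) et0) _.
  rewrite ler_pdivrMr ?exprn_gt0//.
  apply: le_trans (mean_sqr_deviation indepX distX Fg g_dec n0 (ltW a'_gt0) (ltW b'_lt1) tab) _.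
  have re0 : 0 < r * eta ^+ 2 by rewrite mulr_gt0// exprn_gt0.
  have : 4 / (r * eta ^+ 2) <= n%:R.
    by rewrite (le_trans (ltW (truncnS_gt _)))// ler_nat.
  rewrite (ler_pdivrMr _ _ re0) => h.
  rewrite -[leLHS]mul1r ler_pdivrMr//; lra.
have ab' : a' <= b' by rewrite ltW// (lt_trans a'a)// (lt_trans ab).
have P2 := PD a' (introT andP (conj (lexx _) ab')).
have P3 := PD b' (introT andP (conj ab' (lexx _))).
have m23 : measurable (A2 `|` A3) by exact: measurableU.
have := fine_prob_le P mA (measurableU _ _ mA1 m23) sub.
have := fine_prob_setU P mA1 m23; have := fine_prob_setU P mA2 mA3.
rewrite -/A2 in P2; rewrite -/A3 in P3; lra.
Qed.

(** There are at most [n] thresholds, each with a coefficient of size at most [C * B / n]: the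
    summands stay bounded while the number of thresholds grows. *)
Let score_bounded : exists2 B, 0 < B & exists N, forall n, (N <= n)%N ->
  forall E : {ffun 'I_(m n) -> bool}, `|score n E| <= B.
Proof.
have [B B0 [N H]] := wls_weight_bounded; exists (C * B); first exact: mulr_gt0.
exists N.+1 => n Nn E; have n0 : (0 < n)%N by exact: leq_trans Nn.
have n0' : 0 < n%:R :> R by rewrite ltr0n.
rewrite /threshold_score (le_trans (ler_norm_sum _ _ _))//.
apply: (@le_trans _ _ (\sum_(l < m n) C * (B / n%:R))).
  apply: ler_sum => l _; have sab := s_itv n0 (ltn_ord l).
  rewrite normrM -[leRHS]mulr1 ler_pM//.
    by rewrite /score_weight normrN normrM ler_pM ?g1L.1 ?ab_itv ?H// ltnW.
  have a0 := a_gt0; have b1 := b_lt1; case/andP: sab => s1 s2.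
  by case: (E l) => /=; rewrite ler_norml; apply/andP; split; lra.
have CB0 : 0 <= C * (B / n%:R) by rewrite mulr_ge0 ?divr_ge0 ?ltW.
rewrite sumr_const card_ord -[_ *+ m n]mulr_natr.
apply: (@le_trans _ _ (C * (B / n%:R) * n%:R)).
  by rewrite (ler_wpM2l CB0)// ler_nat nb_obs_le.
by rewrite mulrA divfK ?gt_eqF.
Qed.

Lemma wls_cvg_in_distribution :
  (forall u, a <= u <= b -> quantile F (1 - u) = (expR (g u))%:E) ->
  (forall u, a <= u <= b -> density_quantile F (1 - u) * expR (g u) * g1 u = -1) ->
  cvg_in_distribution P
    (fun n w => Num.sqrt n%:R * (wls_estimator a b pt wt (fun i => X i w) n - beta ord0))
    (normal_law 0 (asymptotic_variance a b pt wt F)).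
Proof.
move=> Qg dQ.
have g1L' : itv_lipschitz a b g1.
  exists C => //; split=> [u uab|u v uab vab]; first by rewrite g1L.1// ab_itv.
  by rewrite g1L.2// ab_itv.
have [hL ->] := asymptotic_varianceE a_gt0 ab b_lt1 pt wt_int g1L' Qg dQ.
have [B B0 [N HB]] := score_bounded.
(* The set of patterns grows with [n], hence a family of finite types. Starting at [N.+1] ensures
   [0 < n], which places the nodes in [[a, b]]. *)
apply: (@clt_distribution _ _ _ P X indepX (fun n => {ffun 'I_(m n) -> bool}) (fun n => index n)
  (fun n => score n) _ B _ _ N.+1 B0 _ _ _ (covariance_form_cvg a_gt0 ab b_lt1 wt_int hL score_weight_cvg)).
- by move=> n E; exact: measurable_exceedances.
- by move=> n Nn; apply: HB; exact: ltnW.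
- move=> n Nn i _; apply: (mean_threshold_score distX Fg) => l.
  by apply/ab_itv/s_itv => //; exact: leq_trans Nn.
- move=> n Nn i _; apply: (mean_sqr_threshold_score distX Fg g_dec) => l.
  by apply/ab_itv/s_itv => //; exact: leq_trans Nn.
- move=> n; apply: measurable_funM; first exact: measurable_cst.
  by apply: measurable_funB; [exact: measurable_wls_estimator|exact: measurable_cst].
- exact: wls_remainder.
Qed.

End estimator_limit.

Section distribution_function.
Context d (T : measurableType d) (R : realType) (P : probability T R).
Variables (X : {RV P >-> R}) (F : R -> R).
Hypothesis distX : forall x, cdf X x = (F x)%:E.

Lemma distribution_function_nondecreasing : {homo F : x y / x <= y}.
Proof. by move=> x y xy; rewrite -lee_fin -!distX; exact: cdf_nondecreasing. Qed.

Lemma distribution_function_right_continuous x : F y @[y --> x^'+] --> F x.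
Proof.
have E : cdf X = EFin \o F by apply/funext => y; rewrite distX.
have := @cdf_right_continuous _ _ _ P X x.
by rewrite E => /fine_cvgP [].
Qed.

End distribution_function.

(** The extended logarithm is finite only at positive reals, so the model for [log Q] makes the
    quantile finite and positive. *)
Lemma lne_eq_fin {R : realType} (x : \bar R) (y : R) : lne x = y%:E -> x = (expR y)%:E.
Proof.
case: x => [x| |]//; have [x0|x0] := leP x 0; first by rewrite le0_lneNy// lee_fin.
by rewrite lne_EFin// => -[<-]; rewrite lnK.
Qed.

Theorem theorem1 (R : realType) (d : measure_display) (T : measurableType d)
  (P : probability T R) (X : nat -> {RV P >-> R}) (F : R -> R)
  (indepX : mutually_independent X)
  (distX : forall i x, cdf (X i) x = (F x)%:E)
  (alpha : R) (alpha_gt0 : 0 < alpha)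
  (p : nat) (p_gt0 : (0 < p)%N) (theta : nat -> R)
  (logQ : forall s : R, 0 < s < 1 ->
    lne (quantile F (1 - s)) =
    (- alpha * ln s + theta 0%N +
     2 * \sum_(1 <= k < p.+1) theta k * cos (2 * pi * k%:R * s))%:E)
  (a b : R) (a_gt0 : 0 < a) (a_lt_b : a < b) (b_lt1 : b < 1)
  (pt : nat) (p_lt_pt : (p < pt)%N)
  (endpoints : (lower_endpoint F < upper_endpoint F)%E)
  (F_continuous : forall x, open_support F x -> {for x, continuous F})
  (F_differentiable : forall x, open_support F x -> derivable F x 1)
  (F_twice_differentiable :
    forall x, open_support F x -> derivable F^`()%classic x 1)
  (density_neq0 : forall x, open_support F x -> F^`()%classic x != 0)
  (tail_condition :
    (ereal_sup [set (F x * (1 - F x) * `|F^`(2)%classic x / F^`()%classic x ^+ 2|)%:E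
               | x in open_support F] < +oo)%E)
  (sup_invQ :
    (ereal_sup [set (`|quantile F s|)^-1 | s in `[(1 - b)%R, (1 - a)%R]] < +oo)%E)
  (sup_invfQ :
    (ereal_sup [set ((density_quantile F s)%:E)^-1
               | s in `[(1 - b)%R, (1 - a)%R]] < +oo)%E)
  (sup_invfQQ :
    (ereal_sup [set (`|(density_quantile F s)%:E * quantile F s|)^-1
               | s in `[(1 - b)%R, (1 - a)%R]] < +oo)%E)
  (wt : R -> R) (wt_ge0 : forall u, a <= u <= b -> 0 <= wt u)
  (wt_integrable : riemann_integrable wt a b)
  (limit_mx_invertible : limit_mx a b pt wt \in unitmx) :
  cvg_in_distribution P
    (fun n w =>
      Num.sqrt n%:R * (wls_estimator a b pt wt (fun i => X i w) n - alpha))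
    (normal_law 0 (asymptotic_variance a b pt wt F)).
Proof.

pose g := log_quantile alpha p theta.
pose g1 := log_quantile' alpha p theta.
have Qg (s : R) : 0 < s < 1 -> quantile F (1 - s) = (expR (g s))%:E.
  by move=> s01; apply: lne_eq_fin; exact: logQ.
have dg (s : R) : 0 < s -> is_derive s 1 g (g1 s) by exact: is_derive_log_quantile.
have g1_lip (c e : R) : 0 < c -> c <= e -> itv_lipschitz c e g1.
  exact: itv_lipschitz_log_quantile'.
(* The inverse of 0 is [+oo] in the extended reals, so a zero of [fQ] would make the supremum of
   [1 / fQ] infinite. *)
have fQ_neq0 (s : R) : a <= s <= b -> density_quantile F (1 - s) != 0.
  move=> /andP[s1 s2]; apply/eqP => fQ0; move: sup_invfQ; rewrite ltNge leye_eq => /negP; apply.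
  rewrite -leye_eq; apply: ereal_sup_ubound; exists (1 - s) => /=.
    by rewrite in_itv/= !lerD2l !lerN2 s1 s2.
  by rewrite fQ0 inve0.
have F_nd := distribution_function_nondecreasing (distX 0%N).
have F_rc := distribution_function_right_continuous (distX 0%N).
have [a' [b' [C [[a'0 a'a bb' b'1 C0] [g1L g1_lt0 Fg]]]]] :=
  log_quantile_neighbourhood a_gt0 a_lt_b b_lt1 F_nd F_rc Qg dg g1_lip fQ_neq0.
(* The coefficients are [alpha], then [theta], padded with zeros from order [p + 1] to order
   [pt]. *)
apply: (wls_cvg_in_distribution indepX distX Fg a'0 a'a a_lt_b bb' b'1 C0 g1L _ g1_lt0
  (beta := fun j => if (j : nat) is j'.+1 then (if (j' <= p)%N then theta j' else 0) else alpha)) => //.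
- by move=> s /andP[s1 _]; apply: dg; exact: lt_le_trans s1.
- by move=> s _; exact: log_quantile_regression.
- by move=> s /andP[s1 s2]; apply: Qg; rewrite (lt_le_trans a_gt0)//= (le_lt_trans s2).
- exact: (density_quantileE a_gt0 a_lt_b b_lt1 F_nd F_rc Qg dg g1_lip fQ_neq0).
Qed.
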